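(* Assume the Setup below. Let $m=\min(p,n-1)$, $M=\max(p,n-1)$ and $A_0=M-m$ (so $A_0=n-p-1$ when $n-1\ge p$). The double shrinkage estimator $\hat\Theta^{RLS}_{\hat a_S,\hat b_S}$ is minimax, i.e. $R(\Theta,\hat\Theta^{RLS}_{\hat a_S,\hat b_S})\le1$ for all $\Theta$, if either of the following holds: (i) $\hat\alpha=c\,\mathrm{tr}(W)$ with $c>0$ and $$(mA_0+m^2-16+4/m)c^2+\{(m+1)A_0+m^2-8m-18\}c+A_0-14\ge0;$$ (ii) $\hat\alpha=\mathrm{tr}(W)/m$ and $$A_0\ge\frac{-m^4+21m^3+18m^2+16m-4}{2m^2(m+1)}.$$
   Context: Setup. Let $n\ge 2$, $p\ge1$. Let $X=(x_1,\dots,x_n)$ be a random $p\times n$ matrix whose columns are independent with $x_i\sim\mathcal N_p(\theta_i,\Sigma)$, where $\Sigma$ is a known $p\times p$ positive definite matrix and $\Theta=(\theta_1,\dots,\theta_n)\in\mathbb R^{p\times n}$ is the unknown mean matrix. The loss of an estimator $\hat\Theta$ is $L(\Theta,\hat\Theta)=\frac{1}{np}\mathrm{tr}[(\hat\Theta-\Theta)^\top\Sigma^{-1}(\hat\Theta-\Theta)]$ and its risk is $R(\Theta,\hat\Theta)=E[L(\Theta,\hat\Theta)]$; $R(\Theta,X)=1$. Let $\bar x=n^{-1}\sum_j x_j$, $\bar X=\bar x\,1_n^\top$ with $1_n=(1,\dots,1)^\top$, and $W=(X-\bar X)(X-\bar X)^\top\Sigma^{-1}$. Here the ridge statistic is $\hat\alpha=c\,\mathrm{tr}(W)$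 with a constant $c>0$, and $c_0=c$. Put $V=(W+\hat\alpha I_p)^{-1}$. For (possibly data-dependent) weights $a,b$ the ridge-type linear shrinkage estimator is $$\hat\Theta^{RLS}_{a,b}=X-\Big\{aV+\frac{b}{\mathrm{tr}(W)}I_p\Big\}(X-\bar X).$$ The estimated weights are $$\hat a_S=\frac{(n-p-1)\mathrm{tr}(V)+\hat\alpha(\mathrm{tr}V)^2}{\mathrm{tr}(V^2W)}-(2c_0+1),\qquad \hat b_S=\{(n-1)p-2\}-\mathrm{tr}(VW)\,\hat a_S.$$ An estimator is called minimax if its risk is at most $1=R(\Theta,X)$ for every $\Theta$. *)

(* Defs.v *)
From HB Require Import structures.
From mathcomp Require Import all_boot all_order all_algebra.
From mathcomp Require Import all_classical all_reals all_analysis.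
Set Implicit Arguments. Unset Strict Implicit. Unset Printing Implicit Defensive.
Import Order.TTheory GRing.Theory Num.Theory.
Local Open Scope ring_scope.

Section Defs.
Variable R : realType.

Definition posdef (p : nat) (S : 'M[R]_p) : Prop :=
  S^T = S /\ forall v : 'cV[R]_p, v != 0 -> 0 < (v^T *m S *m v) 0 0.

Definition Xbar (p n : nat) (X : 'M[R]_(p, n)) : 'M[R]_(p, n) :=
  \matrix_(i < p, j < n) ((n%:R)^-1 * \sum_(k < n) X i k).

Definition Wmat (p n : nat) (S : 'M[R]_p) (X : 'M[R]_(p, n)) : 'M[R]_p :=
  (X - Xbar X) *m (X - Xbar X)^T *m invmx S.

Definition alpha_hat (p n : nat) (c : R) (S : 'M[R]_p) (X : 'M[R]_(p, n)) : R :=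
  c * \tr (Wmat S X).

Definition Vmat (p n : nat) (c : R) (S : 'M[R]_p) (X : 'M[R]_(p, n)) : 'M[R]_p :=
  invmx (Wmat S X + (alpha_hat c S X)%:M).

Definition RLS (p n : nat) (c a b : R) (S : 'M[R]_p) (X : 'M[R]_(p, n))
  : 'M[R]_(p, n) :=
  X - (a *: Vmat c S X + (b / \tr (Wmat S X))%:M) *m (X - Xbar X).

Definition a_S (p n : nat) (c : R) (S : 'M[R]_p) (X : 'M[R]_(p, n)) : R :=
  let W := Wmat S X in let V := Vmat c S X in
  (((n%:R - p%:R - 1) * \tr V + alpha_hat c S X * (\tr V) ^+ 2)
     / \tr (V *m V *m W)) - (2 * c + 1).

Definition b_S (p n : nat) (c : R) (S : 'M[R]_p) (X : 'M[R]_(p, n)) : R :=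
  ((n%:R - 1) * p%:R - 2) - \tr (Vmat c S X *m Wmat S X) * a_S c S X.

Definition RLS_S (p n : nat) (c : R) (S : 'M[R]_p) (X : 'M[R]_(p, n))
  : 'M[R]_(p, n) :=
  RLS c (a_S c S X) (b_S c S X) S X.

Definition loss (p n : nat) (S : 'M[R]_p) (Th That : 'M[R]_(p, n)) : R :=
  (n%:R * p%:R)^-1 * \tr ((That - Th)^T *m invmx S *m (That - Th)).

(* joint density of X: columns independent, x_i ~ N_p(theta_i, Sigma) *)
Definition gauss_density (p n : nat) (S : 'M[R]_p) (Th X : 'M[R]_(p, n)) : R :=
  ((Num.sqrt ((2 * pi) ^+ p * \det S))^-1) ^+ n *
  expR (- (2^-1) * \tr ((X - Th)^T *m invmx S *m (X - Th))).

(* iterated Lebesgue integral over R^k (coordinates 0..k-1 of v : nat -> R) *)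
Fixpoint iter_int (k : nat) (F : (nat -> R) -> \bar R) : \bar R :=
  match k with
  | 0 => F (fun _ => 0)
  | k'.+1 => (\int[@lebesgue_measure R]_(x in setT)
               iter_int k' (fun v => F (fun j => if j == k' then x else v j)))%E
  end.

Definition mat_of (p n : nat) (v : nat -> R) : 'M[R]_(p, n) :=
  \matrix_(i < p, j < n) v (i + p * j)%N.

(* E_Theta[ g(X) ] for X with the above density (nonnegative g) *)
Definition expect (p n : nat) (S : 'M[R]_p) (Th : 'M[R]_(p, n))
  (g : 'M[R]_(p, n) -> R) : \bar R :=
  iter_int (p * n) (fun v =>
    (g (mat_of p n v) * gauss_density S Th (mat_of p n v))%:E).

Definition risk (p n : nat) (S : 'M[R]_p) (Th : 'M[R]_(p, n))
  (est : 'M[R]_(p, n) -> 'M[R]_(p, n)) : \bar R :=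
  expect S Th (fun X => loss S Th (est X)).

Definition minimax (p n : nat) (S : 'M[R]_p)
  (est : 'M[R]_(p, n) -> 'M[R]_(p, n)) : Prop :=
  forall Th : 'M[R]_(p, n), (risk S Th est <= 1%:E)%E.

End Defs.

(* Main.v *)
Require Import Defs.
From HB Require Import structures.
From mathcomp Require Import all_boot all_order all_algebra.
From mathcomp Require Import all_classical all_reals all_analysis.
From mathcomp Require Import measurable_realfun perm spectral complex ring lra.
Set Implicit Arguments. Unset Strict Implicit. Unset Printing Implicit Defensive.
Import Order.TTheory GRing.Theory Num.Theory.
Import numFieldNormedType.Exports.
Local Open Scope classical_set_scope.
Local Open Scope ring_scope.

(* Write Y = X - Xbar, W = Y Y^T S^-1, t = tr W, kappa = (n-1)p - 2 and let G = X - RLS_S X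
   be the shrinkage, G = (a V + b/t) Y.  By Stein's identity the risk of X - G equals
   1 + E[|G|^2 - 2 div G]/(np), where |G|^2 = tr(G^T S^-1 G).  The weight a_S is
   div(V Y)/|V Y|^2, and both weights are homogeneous of degree 0, so
     |G|^2 - 2 div G = - a^2 tr(V^2 W) - b^2/t - 2 D a,
   with D a the derivative of a in the direction V Y.  In terms of y_i = alpha/(l_i + alpha),
   where the l_i are the m = min(p, n-1) possibly nonzero eigenvalues of W, the quantity
   a^2 tr(V^2 W) + 2 D a is a rational function of the power sums of the y_i; since
   sum 1/y_i = m + 1/c it is nonnegative under (i), by the Chebyshev and Cauchy-Schwarz
   inequalities.  Condition (ii) is (i) for c = 1/m.

   G is singular at Y = 0.  It is first multiplied by a C^1 cutoff h(t) with h' >= 0 that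
   vanishes near t = 0: this adds - 2 h'(t) <grad t, G> = - 4 h'(t) kappa <= 0 to the
   unbiased risk estimate, and Fatou's lemma removes the cutoff. *)

(** * Iterated integrals *)

(** The risk is an iterated integral, so the analysis proceeds one coordinate at a time, on
    functions that are sequentially continuous in the coordinates and dominated by a product of
    Cauchy weights. Such a product dominates any polynomial times the Gaussian density, and a
    bounded translation changes it only by a bounded factor, as differentiation under the integral
    requires. [W] is not symmetric, only similar to a positive semidefinite matrix, so its spectrum
    enters through traces, determinants and rank. The case [p > n - 1] gets no separate treatment:
    with [k = p - m] one has [n - p - 1 = A0 - 2 k] and [k (A0 - k) = 0], so the [k] extra zero
    eigenvalues cancel from the numerator of [a_S] and from its derivative; this is how [A0]
    replaces [n - p - 1]. The polynomial in (i) comes from the lower bounds [y_i >= c / (c + 1)],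
    [s1 / m >= m c / (m c + 1)] and [s2 / s1 >= s1 / m], where [s1], [s2] are the first two power
    sums of the [y_i]. The sign of the cutoff term requires [kappa >= 0], and (i) implies that
    too. *)

Section IteratedIntegral.
Variable R : realType.
Implicit Types (F G : (nat -> R) -> R) (v : nat -> R) (f : R -> R) (K k : nat).
Local Notation mu := (@lebesgue_measure R).

Definition upd k (x : R) v : nat -> R := fun j => if j == k then x else v j.

Definition cauchy_weight (x : R) : R := (oneDsqr x)^-1.
Local Notation q := cauchy_weight.

Definition envelope K v : R := \prod_(j < K) q (v j).

(** Coordinatewise convergence of sequences stands in for a topology on [nat -> R]; it is the form
    in which dominated convergence delivers continuity. *)
Definition seq_cont F := forall (u : nat -> nat -> R) v,
  (forall j, u l j @[l --> \oo] --> v j) -> F (u l) @[l --> \oo] --> F v.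

Definition enveloped K (C : R) F := forall v, `|F v| <= C * envelope K v.

Fixpoint riter K F : R :=
  match K with
  | 0 => F (fun _ => 0)
  | K'.+1 => \int[mu]_x riter K' (fun v => F (upd K' x v))
  end.

Lemma cauchy_weight_gt0 x : 0 < q x.
Proof. by rewrite invr_gt0 (lt_le_trans ltr01)// oneDsqr_ge1. Qed.

Lemma cauchy_weight_le1 x : q x <= 1.
Proof. exact: oneDsqrV_le1. Qed.

Lemma envelope_gt0 K v : 0 < envelope K v.
Proof. by apply: prodr_gt0 => j _; exact: cauchy_weight_gt0. Qed.

Lemma enveloped_ge0 K C F : enveloped K C F -> 0 <= C.
Proof.
move=> /(_ (fun=> 0)) /(le_trans (normr_ge0 _)).
by rewrite pmulr_lge0// envelope_gt0.
Qed.

Lemma envelopeS K x v : envelope K.+1 (upd K x v) = q x * envelope K v.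
Proof.
rewrite /envelope big_ord_recr /= /upd eqxx mulrC; congr (_ * _).
by apply: eq_bigr => j _; rewrite (ltn_eqF (ltn_ord j)).
Qed.

Lemma enveloped_upd K C F x : enveloped K.+1 C F ->
  enveloped K (C * q x) (fun v => F (upd K x v)).
Proof. by move=> dF v; rewrite -mulrA -envelopeS. Qed.

Lemma enveloped_updW K C F x : enveloped K.+1 C F ->
  enveloped K C (fun v => F (upd K x v)).
Proof.
move=> dF v; apply: le_trans (enveloped_upd x dF v) _.
rewrite ler_wpM2r ?(ltW (envelope_gt0 _ _))//.
by rewrite ler_piMr ?cauchy_weight_le1// (enveloped_ge0 dF).
Qed.

Lemma cvg_upd K (a : nat -> R) x (u : nat -> nat -> R) v :
  a @ \oo --> x -> (forall j, u l j @[l --> \oo] --> v j) ->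
  forall j, upd K (a l) (u l) j @[l --> \oo] --> upd K x v j.
Proof. by move=> ax uv j; rewrite /upd; case: eqP. Qed.

Lemma seq_cont_upd K F x : seq_cont F -> seq_cont (fun v => F (upd K x v)).
Proof. by move=> cF u v uv; apply: cF; apply: cvg_upd => //; exact: cvg_cst. Qed.

Lemma integrable_cauchy_weight : mu.-integrable setT (EFin \o q).
Proof.
have cq : continuous q by exact: continuous_oneDsqrV.
have q0 x : 0 <= q x by rewrite ltW// cauchy_weight_gt0.
have mq : measurable_fun setT q by exact: continuous_measurable_fun.
apply/integrableP; split; first exact/measurable_EFinP.
under eq_integral do rewrite /= ger0_norm//.
rewrite ge0_symfun_integralT//; last by move=> x; rewrite /= /q /oneDsqr sqrrN.
have -> : [set x : R | 0 <= x] = `[0, +oo[%classic by rewrite set_itvcy.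
by rewrite integral0y_oneDsqr -EFinM ltry.
Qed.

Definition cauchy_mass : R := \int[mu]_x q x.

Lemma integrableZ_cauchy_weight C : mu.-integrable setT (EFin \o (fun x => C * q x)).
Proof. exact: (integrableZl measurableT C integrable_cauchy_weight). Qed.

Lemma integrable_enveloped f C : continuous f -> (forall x, `|f x| <= C * q x) ->
  mu.-integrable setT (EFin \o f).
Proof.
move=> cf fC; apply: (@le_integrable _ _ _ mu _ measurableT _ (EFin \o (fun x => C * q x))).
- by apply/measurable_EFinP; exact: continuous_measurable_fun.
- move=> x _ /=; rewrite lee_fin; apply: le_trans (fC x) _; exact: ler_norm.
- exact: integrableZ_cauchy_weight.
Qed.

Lemma Rintegral_enveloped f C : continuous f -> (forall x, `|f x| <= C * q x) ->
  `|\int[mu]_x f x| <= C * cauchy_mass.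
Proof.
move=> cf fC.
have intf := integrable_enveloped cf fC.
apply: (le_trans (le_normr_Rintegral measurableT intf)).
rewrite /cauchy_mass -RintegralZl//; last exact: integrable_cauchy_weight.
apply: le_Rintegral => //.
- exact: (integrable_norm intf).
- exact: integrableZ_cauchy_weight.
Qed.

Lemma cvg_ge0 (a : nat -> R) x : a @ \oo --> x -> (forall l, 0 <= a l) -> 0 <= x.
Proof.
move=> ax a0; rewrite -(cvg_lim (@Rhausdorff R) ax); apply: limr_ge.
  by apply/cvg_ex; eexists; exact: ax.
exact: nearW.
Qed.

Lemma cvg_normr_le (a : nat -> R) x (C : R) : a @ \oo --> x ->
  (forall l, `|a l| <= C) -> `|x| <= C.
Proof.
move=> ax aC; rewrite -subr_ge0; apply: (@cvg_ge0 (fun l => C - `|a l|)).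
  by apply: cvgB; [exact: cvg_cst|exact: cvg_norm].
by move=> l; rewrite subr_ge0.
Qed.

Lemma Rintegral_dct (fl : nat -> R -> R) f C :
  (forall l, continuous (fl l)) -> continuous f ->
  (forall l x, `|fl l x| <= C * q x) ->
  (forall x, fl l x @[l --> \oo] --> f x) ->
  \int[mu]_x fl l x @[l --> \oo] --> \int[mu]_x f x.
Proof.
move=> cfl cf flC flf.
have fC x : `|f x| <= C * q x.
  by apply: (cvg_normr_le (flf x)).
have intf := integrable_enveloped cf fC.
have [] := @dominated_convergence _ _ R mu setT measurableT
  (fun l => EFin \o fl l) (EFin \o f) (EFin \o (fun x => C * q x)).
- by move=> l; apply/measurable_EFinP; exact: continuous_measurable_fun.
- by apply/measurable_EFinP; exact: continuous_measurable_fun.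
- by apply: aeW => x _; apply: cvg_EFin; [exact: nearW|exact: flf].
- exact: integrableZ_cauchy_weight.
- by apply: aeW => x l _ /=; rewrite lee_fin.
move=> _ _ h.
apply: fine_cvg; rewrite fineK//; exact: integrable_fin_num.
Qed.

Lemma seq_continuous f :
  (forall (a : nat -> R) x, a @ \oo --> x -> f (a l) @[l --> \oo] --> f x) ->
  continuous f.
Proof. move=> h x; apply/(@cvg_nbhsP _ R^o) => a; exact: h. Qed.

(** Bound and dominated convergence go through one induction: the outer integrand must be
    continuous, which is convergence one level down, and dominated by a multiple of [q], which is
    the bound one level down. *)
Lemma riter_bound_dct K :
  (forall F C, seq_cont F -> enveloped K C F -> `|riter K F| <= C * cauchy_mass ^+ K)
  /\ forall (Fl : nat -> (nat -> R) -> R) F C,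
  (forall l, seq_cont (Fl l)) -> seq_cont F ->
  (forall l, enveloped K C (Fl l)) ->
  (forall v, Fl l v @[l --> \oo] --> F v) ->
  riter K (Fl l) @[l --> \oo] --> riter K F.
Proof.
elim: K => [|K [IHb IHd]].
  split=> [F C _ dF|Fl F C _ _ _ FlF] /=; last exact: FlF.
  by have := dF (fun=> 0); rewrite /envelope big_ord0 expr0.
have cont F C : seq_cont F -> enveloped K.+1 C F ->
    continuous (fun x => riter K (fun v => F (upd K x v))).
  move=> cF dF; apply: seq_continuous => a x ax.
  apply: (IHd _ _ C) => [l|||v]; last first.
  - by apply: cF; apply: cvg_upd => // j; exact: cvg_cst.
  - by move=> l; exact: enveloped_updW.
  - exact: seq_cont_upd.
  - exact: seq_cont_upd.
have bnd F C : seq_cont F -> enveloped K.+1 C F -> forall x,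
    `|riter K (fun v => F (upd K x v))| <= (C * cauchy_mass ^+ K) * q x.
  move=> cF dF x; rewrite mulrAC; apply: IHb; first exact: seq_cont_upd.
  exact: enveloped_upd.
split=> [F C cF dF|Fl F C cFl cF dFl FlF] /=.
  rewrite exprSr mulrA; apply: Rintegral_enveloped; first exact: cont dF.
  exact: bnd.
have dF : enveloped K.+1 C F.
  by move=> v; apply: (cvg_normr_le (FlF v)) => l; exact: dFl.
apply: (@Rintegral_dct _ _ (C * cauchy_mass ^+ K)).
- by move=> l; exact: cont (dFl l).
- exact: cont dF.
- by move=> l; exact: bnd.
- move=> x; apply: (IHd _ _ C) => //.
  + by move=> l; exact: seq_cont_upd.
  + exact: seq_cont_upd.
  + by move=> l; exact: enveloped_updW.
Qed.

Lemma riter_bound K F C : seq_cont F -> enveloped K C F ->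
  `|riter K F| <= C * cauchy_mass ^+ K.
Proof. exact: (riter_bound_dct K).1. Qed.

Lemma riter_dct K (Fl : nat -> (nat -> R) -> R) F C :
  (forall l, seq_cont (Fl l)) -> seq_cont F ->
  (forall l, enveloped K C (Fl l)) ->
  (forall v, Fl l v @[l --> \oo] --> F v) ->
  riter K (Fl l) @[l --> \oo] --> riter K F.
Proof. exact: (riter_bound_dct K).2. Qed.

Lemma continuous_riter K F C : seq_cont F -> enveloped K.+1 C F ->
  continuous (fun x => riter K (fun v => F (upd K x v))).
Proof.
move=> cF dF; apply: seq_continuous => a x ax.
apply: (@riter_dct _ _ _ C) => [l|||v]; last first.
- by apply: cF; apply: cvg_upd => // j; exact: cvg_cst.
- by move=> l; exact: enveloped_updW.
- exact: seq_cont_upd.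
- exact: seq_cont_upd.
Qed.

Lemma integrable_riter K F C : seq_cont F -> enveloped K.+1 C F ->
  mu.-integrable setT (EFin \o (fun x => riter K (fun v => F (upd K x v)))).
Proof.
move=> cF dF; apply: (@integrable_enveloped _ (C * cauchy_mass ^+ K)).
  exact: continuous_riter dF.
move=> x; rewrite mulrAC; apply: riter_bound; first exact: seq_cont_upd.
exact: enveloped_upd.
Qed.

Lemma iter_int_riter K F C : seq_cont F -> enveloped K C F ->
  iter_int K (fun v => (F v)%:E) = (riter K F)%:E.
Proof.
elim: K F C => [//|K IH] F C cF dF /=.
rewrite /Rintegral fineK; last first.
  exact: integrable_fin_num (integrable_riter cF dF).
apply: eq_integral => x _.
apply: (IH (fun v => F (upd K x v)) C); first exact: seq_cont_upd.
exact: enveloped_updW.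
Qed.

Lemma eq_riter K F G : F =1 G -> riter K F = riter K G.
Proof. by move=> /funext ->. Qed.

Lemma riterD K F G C D : seq_cont F -> enveloped K C F ->
  seq_cont G -> enveloped K D G ->
  riter K (fun v => F v + G v) = riter K F + riter K G.
Proof.
elim: K F G C D => [//|K IH] F G C D cF dF cG dG /=.
rewrite -RintegralD//; last 2 first.
- exact: integrable_riter dF.
- exact: integrable_riter dG.
apply: eq_Rintegral => x _.
apply: (IH _ _ C D); try exact: seq_cont_upd; exact: enveloped_updW.
Qed.

Lemma riterZ K F C (a : R) : seq_cont F -> enveloped K C F ->
  riter K (fun v => a * F v) = a * riter K F.
Proof.
elim: K F C => [//|K IH] F C cF dF /=.
rewrite -RintegralZl//; last exact: integrable_riter dF.
apply: eq_Rintegral => x _.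
by apply: (IH _ C); [exact: seq_cont_upd|exact: enveloped_updW].
Qed.

Lemma seq_contD F G : seq_cont F -> seq_cont G -> seq_cont (fun v => F v + G v).
Proof. by move=> cF cG u v uv; apply: cvgD; [exact: cF|exact: cG]. Qed.

Lemma seq_contM F G : seq_cont F -> seq_cont G -> seq_cont (fun v => F v * G v).
Proof. by move=> cF cG u v uv; apply: cvgM; [exact: cF|exact: cG]. Qed.

Lemma seq_cont_cst (a : R) : seq_cont (fun=> a).
Proof. by move=> u v _; exact: cvg_cst. Qed.

Lemma envelopedD K F G C D : enveloped K C F -> enveloped K D G ->
  enveloped K (C + D) (fun v => F v + G v).
Proof.
move=> dF dG v; rewrite mulrDl; apply: le_trans (ler_normD _ _) _.
exact: lerD.
Qed.

Lemma envelopedZ K F C (a : R) : enveloped K C F ->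
  enveloped K (`|a| * C) (fun v => a * F v).
Proof. by move=> dF v; rewrite normrM -mulrA ler_wpM2l. Qed.

Lemma le_riter K F G C D : seq_cont F -> enveloped K C F ->
  seq_cont G -> enveloped K D G -> (forall v, F v <= G v) ->
  riter K F <= riter K G.
Proof.
elim: K F G C D => [//|K IH] F G C D cF dF cG dG FG /=; first exact: FG.
apply: le_Rintegral => //.
- exact: integrable_riter dF.
- exact: integrable_riter dG.
move=> x _; apply: (IH _ _ C D) => //.
1,3: exact: seq_cont_upd.
1,2: exact: enveloped_updW.
Qed.

Lemma riter_sum K (I : Type) (r : seq I) (P : pred I)
    (F : I -> (nat -> R) -> R) :
  (forall i, seq_cont (F i)) -> (forall i, exists C, enveloped K C (F i)) ->
  [/\ seq_cont (fun v => \sum_(i <- r | P i) F i v),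
      exists C, enveloped K C (fun v => \sum_(i <- r | P i) F i v)
    & riter K (fun v => \sum_(i <- r | P i) F i v)
      = \sum_(i <- r | P i) riter K (F i)].
Proof.
move=> cF dF; elim: r => [|i r [IHc [C IHd] IH]].
  have e : (fun v => \sum_(i <- [::] | P i) F i v) = fun=> 0.
    by apply/funext => v; rewrite big_nil.
  have d0 : enveloped K 0 (fun=> 0) by move=> v; rewrite normr0 mul0r.
  rewrite !e big_nil; split; [exact: seq_cont_cst|by exists 0|].
  by have := riter_bound (@seq_cont_cst 0) d0; rewrite mul0r normr_le0 => /eqP.
have [D dFi] := dF i.
have e : (fun v => \sum_(i <- i :: r | P i) F i v) =
   if P i then fun v => F i v + \sum_(i <- r | P i) F i v
   else fun v => \sum_(i <- r | P i) F i v.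
  by apply/funext => v; rewrite big_cons; case: ifP.
rewrite !e big_cons; case: ifP => _; last by split=> //; exists C.
split; first exact: seq_contD.
  by exists (D + C); exact: envelopedD.
by rewrite (riterD (cF i) dFi IHc IHd) IH.
Qed.

(** The integral of a nonnegative function is a supremum over the nonnegative simple functions below
    it, and a larger function has more of them. *)
Lemma ge0_le_integral_nonmeasurable (f g : R -> \bar R) : (forall x, 0 <= f x)%E ->
  (forall x, f x <= g x)%E -> (\int[mu]_x f x <= \int[mu]_x g x)%E.
Proof.
move=> f0 fg; have g0 x : (0 <= g x)%E by exact: le_trans (f0 x) (fg x).
rewrite !ge0_integralTE//; apply: ge_ereal_sup => _ [h /= hf <-]; apply: ereal_sup_ubound.
by exists h => //= x; exact: le_trans (hf x) (fg x).
Qed.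

Lemma iter_int_ge0 K (F : (nat -> R) -> \bar R) : (forall v, 0 <= F v)%E ->
  (0 <= iter_int K F)%E.
Proof.
elim: K F => [//|K IH] F F0 /=; first exact: F0.
by apply: integral_ge0 => x _; exact: IH.
Qed.

(* Only the approximating functions need be measurable: the lower integral of
   a nonnegative function is monotone without any measurability. *)
Lemma iter_int_fatou K (Fl : nat -> (nat -> R) -> R) F :
  (forall l, seq_cont (Fl l)) -> (forall l, exists C, enveloped K C (Fl l)) ->
  (forall l v, 0 <= Fl l v) -> (forall v, Fl l v @[l --> \oo] --> F v) ->
  (iter_int K (fun v => (F v)%:E) <= limn_einf (fun l => (riter K (Fl l))%:E))%E.
Proof.
elim: K Fl F => [|K IH] Fl F cFl dFl F0 FlF /=.
  have h : (Fl l (fun=> 0))%:E @[l --> \oo] --> (F (fun=> 0))%:E.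
    by apply: cvg_EFin; [exact: nearW|exact: FlF].
  by rewrite (cvg_limn_einf_sup h).1.
have Fge0 v : 0 <= F v.
  exact: (cvg_ge0 (FlF v)).
(* In the intermediate term the limit inferior stands inside the outer integral only. Its integrands
   are continuous in [x], hence measurable, so Fatou's lemma applies to them. *)
apply: (@le_trans _ _ (\int[mu]_x limn_einf (fun l =>
   (riter K (fun v => Fl l (upd K x v)))%:E))%E).
  apply: ge0_le_integral_nonmeasurable => x.
    by apply: iter_int_ge0 => v; rewrite lee_fin.
  apply: (IH (fun l v => Fl l (upd K x v)) (fun v => F (upd K x v))).
  - by move=> l; exact: seq_cont_upd.
  - by move=> l; have [C dF] := dFl l; exists C; exact: enveloped_updW.
  - by [].
  - by move=> v.
have cr l : continuous (fun x => riter K (fun v => Fl l (upd K x v))).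
  by have [C dF] := dFl l; exact: continuous_riter dF.
apply: le_trans (fatou _ _ _ _) _ => //.
- by move=> l; apply/measurable_EFinP; exact: continuous_measurable_fun.
- move=> l x _; have [C dF] := dFl l.
  rewrite -(@iter_int_riter K _ C); last 2 first.
  + exact: seq_cont_upd.
  + exact: enveloped_updW.
  by apply: iter_int_ge0 => v; rewrite lee_fin.
rewrite le_eqVlt; apply/orP; left; apply/eqP; congr limn_einf.
apply/funext => l; have [C dF] := dFl l.
rewrite /Rintegral fineK//.
exact: integrable_fin_num (integrable_riter (cFl l) dF).
Qed.

End IteratedIntegral.

(** * Translation invariance and integrals of derivatives *)

Section Translation.
Variable R : realType.
Implicit Types (F G : (nat -> R) -> R) (v : nat -> R) (f : R -> R) (K k : nat).
Local Notation mu := (@lebesgue_measure R).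
Local Notation q := (@cauchy_weight R).

Lemma continuous_cauchy_weight : continuous q.
Proof. exact: continuous_oneDsqrV. Qed.

Lemma integral_shift_ge0 f (s : R) : continuous f -> (forall x, 0 <= f x) ->
  (\int[mu]_x (f x)%:E = \int[mu]_x (f (x + s))%:E)%E.
Proof.
move=> cf f0.
have dF (x : R) : is_derive x 1 (fun x : R => x + s) 1.
  have := @is_deriveD _ _ _ _ _ _ _ _ _ (is_derive_id x 1) (is_derive_cst s x 1).
  by rewrite addr0.
have F'E : (fun x : R => x + s)^`()%classic = fun=> 1.
  by apply/funext => x; rewrite derive1E (@derive_val _ _ _ _ _ _ _ (dF x)).
rewrite (@increasing_ge0_integration_by_substitutionT R (fun x => x + s) f) //.
- apply: eq_integral => x _ /=.
  rewrite -[(_ * _) x]/(f (x + s) * (fun x : R => x + s)^`()%classic x).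
  by rewrite F'E mulr1.
- by move=> x y xy; rewrite ltrD2r.
- by rewrite F'E; exact: cst_continuous.
- by rewrite F'E; apply: is_cvg_cst.
- by rewrite F'E; apply: is_cvg_cst.
- by apply: cvg_addrr_Ny.
- by apply: cvg_addrr.
Qed.

Lemma Rintegral_shift f (s C : R) : continuous f -> (forall x, `|f x| <= C * q x) ->
  \int[mu]_x f (x + s) = \int[mu]_x f x.
Proof.
move=> cf fC.
have cs : continuous (fun x : R => x + s).
  by move=> x; apply: cvgD; [exact: cvg_id|exact: cvg_cst].
have cg : continuous (fun x => C * q x).
  by move=> x; apply: cvgM; [exact: cvg_cst|exact: continuous_cauchy_weight].
have ig : mu.-integrable setT (EFin \o (fun x => C * q x)) by exact: integrableZ_cauchy_weight.
have if_ := integrable_enveloped cf fC.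
have g0 x : 0 <= C * q x by apply: le_trans (fC x).
(* The change of variables is stated for nonnegative functions, so [f] is written as
   [C * q - (C * q - f)], a difference of two integrable nonnegative functions. *)
have gf0 x : 0 <= C * q x - f x.
  by rewrite subr_ge0; apply: le_trans (fC x); exact: ler_norm.
have cgf : continuous (fun x => C * q x - f x).
  by move=> x; apply: cvgB; [exact: cg|exact: cf].
have shift_int (h : R -> R) : continuous h -> (forall x, 0 <= h x) ->
    mu.-integrable setT (EFin \o h) ->
    mu.-integrable setT (EFin \o (fun x => h (x + s))).
  move=> ch h0 /integrableP[_ ih]; apply/integrableP; split.
    apply/measurable_EFinP; apply: continuous_measurable_fun => x.
    by apply: continuous_comp; [exact: cs|exact: ch].
  move: ih; under eq_integral do rewrite /= ger0_norm//.
  under [X in _ -> (X < _)%E]eq_integral do rewrite /= ger0_norm//.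
  by rewrite (integral_shift_ge0 s).
have eqi (h : R -> R) : continuous h -> (forall x, 0 <= h x) ->
    \int[mu]_x h (x + s) = \int[mu]_x h x.
  by move=> ch h0; rewrite /Rintegral -(integral_shift_ge0 s).
have igf : mu.-integrable setT (EFin \o (fun x => C * q x - f x)).
  exact: (integrableB measurableT ig if_).
have fE x : f x = C * q x - (C * q x - f x) by rewrite subKr.
under eq_Rintegral do rewrite fE.
rewrite RintegralB//; last 2 first.
- exact: (shift_int _ cg).
- exact: (shift_int _ cgf).
rewrite (eqi _ cg)// (eqi _ cgf)// -RintegralB//.
by apply: eq_Rintegral => x _; rewrite subKr.
Qed.

Definition shift k (s : R) v : nat -> R := fun j => if j == k then v j + s else v j.

Lemma shift_upd_eq k s x v : shift k s (upd k x v) = upd k (x + s) v.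
Proof. by apply/funext => j; rewrite /shift /upd; case: eqP. Qed.

Lemma shift_upd_neq k K s x v : k != K ->
  shift k s (upd K x v) = upd K x (shift k s v).
Proof.
move=> kK; apply/funext => j; rewrite /shift /upd; case: eqP => [->|//].
by rewrite (negbTE kK).
Qed.

Lemma seq_cont_shift F k s : seq_cont F -> seq_cont (fun v => F (shift k s v)).
Proof.
move=> cF u v uv; apply: cF => j; rewrite /shift; case: eqP => _ //.
by apply: cvgD; [exact: uv|exact: cvg_cst].
Qed.

Lemma cauchy_weight_shift (x s : R) : `|s| <= 1 -> q (x + s) <= 3 * q x.
Proof.
move=> s1; rewrite /cauchy_weight /oneDsqr.
have s2 : s ^+ 2 <= 1 by rewrite -real_normK ?num_real// expr_le1.
have h (y : R) : 0 < 1 + y ^+ 2 by rewrite ltr_pwDl// sqr_ge0.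
rewrite ler_pdivlMr// mulrC ler_pdivrMr//.
have := sqr_ge0 (x + 2 * s); nra.
Qed.

Lemma envelope_shift K k s v : `|s| <= 1 ->
  envelope K (shift k s v) <= 3 * envelope K v.
Proof.
move=> s1; rewrite /envelope; have [kK|Kk] := ltnP k K; last first.
  rewrite (eq_bigr (fun j : 'I_K => q (v j))) => [|j _].
    by rewrite ler_peMl ?ler1n// prodr_ge0// => j _; rewrite ltW// cauchy_weight_gt0.
  by rewrite /shift ltn_eqF// (leq_trans (ltn_ord j)).
rewrite (bigD1 (Ordinal kK))//= [X in _ <= 3 * X](bigD1 (Ordinal kK))//= mulrA.
rewrite (eq_bigr (fun j : 'I_K => q (v j))) => [|j jk].
  rewrite ler_wpM2r ?prodr_ge0// => [j _|]; first by rewrite ltW// cauchy_weight_gt0.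
  by rewrite /shift eqxx cauchy_weight_shift.
by rewrite /shift -[k]/(val (Ordinal kK)) (inj_eq val_inj) (negbTE jk).
Qed.

Lemma enveloped_shift F K k s C : `|s| <= 1 -> enveloped K C F ->
  enveloped K (C * 3) (fun v => F (shift k s v)).
Proof.
move=> s1 dF v; apply: le_trans (dF _) _.
by rewrite -mulrA ler_wpM2l ?(enveloped_ge0 dF)// envelope_shift.
Qed.

Lemma riter_shift F K k s C : (k < K)%N -> `|s| <= 1 ->
  seq_cont F -> enveloped K C F -> riter K (fun v => F (shift k s v)) = riter K F.
Proof.
move=> + s1; elim: K F C => [//|K IH] F C kK cF dF /=.
have [->|nkK] := eqVneq k K.
  rewrite -[RHS](@Rintegral_shift _ s (C * cauchy_mass R ^+ K)).
  - by apply: eq_Rintegral => x _; apply: eq_riter => v; rewrite shift_upd_eq.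
  - exact: continuous_riter dF.
  - move=> x; rewrite mulrAC; apply: riter_bound; first exact: seq_cont_upd.
    exact: enveloped_upd.
apply: eq_Rintegral => x _.
under eq_riter do rewrite shift_upd_neq//.
apply: (IH (fun v => F (upd K x v)) C).
- by rewrite ltn_neqAle nkK -ltnS.
- exact: seq_cont_upd.
- exact: enveloped_updW.
Qed.

Lemma is_derive_seq f (x d : R) : is_derive x 1 f d ->
  l.+1%:R^-1^-1 * (f (x + l.+1%:R^-1) - f x) @[l --> \oo] --> d.
Proof.
move=> df; have h := @ex_derive _ _ _ _ _ _ _ df.
have hl := @derive_val _ _ _ _ _ _ _ df.
have {}h : (fun t => t^-1 *: (f (t *: 1 + x) - f x)) @ 0^' --> d.
  by rewrite -hl; exact: h.
have := (cvgr_dnbhsP _ _ _).1 h (fun l => l.+1%:R^-1) (conj _ (@cvg_harmonic R)).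
move=> /(_ (fun l => _)) {}h.
have {}h : l.+1%:R^-1^-1 *: (f (l.+1%:R^-1 *: 1 + x) - f x) @[l --> \oo] --> d.
  by apply: h => l; rewrite invr_eq0 pnatr_eq0.
apply: cvg_trans h; apply: near_eq_cvg; apply: nearW => l.
by rewrite [_%:A]mulr1 (addrC x).
Qed.

Lemma is_derive_shift F G k v (s : R) :
  (forall v, is_derive (0 : R) 1 (fun t => F (shift k t v)) (G v)) ->
  is_derive s 1 (fun t => F (shift k t v)) (G (shift k s v)).
Proof.
move=> dF; have h := dF (shift k s v).
have -> : (fun t => F (shift k t v)) =
    (fun t => F (shift k t (shift k s v))) \o (fun t : R => t - s).
  apply/funext => t /=; congr F; apply/funext => j; rewrite /shift.
  by case: eqP => // _; rewrite -addrA (addrC s) subrK.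
rewrite -[G _]mulr1.
have ds : is_derive s (1 : R) (fun t : R => t - s) 1.
  have := @is_deriveB _ _ _ _ _ _ _ _ _ (is_derive_id s 1) (is_derive_cst s s 1).
  by rewrite subr0.
by apply: is_derive1_comp; rewrite subrr.
Qed.

(* The integral is translation invariant, so the integrals of the difference
   quotients vanish; their limit is the integral of the derivative. *)
Lemma riter_derive F G K k C D : (k < K)%N ->
  seq_cont F -> enveloped K C F -> seq_cont G -> enveloped K D G ->
  (forall v, is_derive (0 : R) 1 (fun t => F (shift k t v)) (G v)) ->
  riter K G = 0.
Proof.
move=> kK cF dF cG dG dFG.
pose e (l : nat) : R := l.+1%:R^-1.
have e0 l : 0 < e l by rewrite invr_gt0.
have e1 l : e l <= 1 by rewrite invf_le1// ler1n.
have ne1 l : `|e l| <= 1 by rewrite gtr0_norm.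
pose Q l v := (e l)^-1 * (F (shift k (e l) v) + (- 1) * F v).
have cN : seq_cont (fun v => (- 1) * F v) by apply: seq_contM => //; exact: seq_cont_cst.
have dN := @envelopedZ _ K F C (-1) dF.
have cs l := @seq_cont_shift F k (e l) cF.
have ds l := @enveloped_shift F K k (e l) C (ne1 l) dF.
have cQ l : seq_cont (Q l).
  by apply: seq_contM; [exact: seq_cont_cst|exact: seq_contD].
have Q0 l : riter K (Q l) = 0.
  rewrite (riterZ _ (seq_contD (cs l) cN) (envelopedD (ds l) dN)).
  rewrite (riterD (cs l) (ds l) cN dN) (riterZ _ cF dF).
  by rewrite (riter_shift kK (ne1 l) cF dF) mulN1r subrr mulr0.
(* By the mean value theorem the quotient is [G] at a point shifted by some [t] between [0] and
   [e l <= 1], so all quotients share the envelope of [G] up to the factor 3. *)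
have dQ l : enveloped K (D * 3) (Q l).
  move=> v.
  have cont : {within `[0, e l], continuous (fun t => F (shift k t v))}.
    apply: continuous_subspaceT => t.
    apply/differentiable_continuous/derivable1_diffP; exact: (@ex_derive _ _ _ _ _ _ _ (is_derive_shift v t dFG)).
  have [t /andP[t0 te] Ft] := MVT (e0 l) (fun t _ => is_derive_shift v t dFG) cont.
  have F0 : F (shift k 0 v) = F v.
    by congr F; apply/funext => j; rewrite /shift addr0 if_same.
  have -> : Q l v = G (shift k t v).
    rewrite /Q mulN1r -F0 Ft subr0 mulrC mulfK// gt_eqF//.
  apply: enveloped_shift => //.
  rewrite /= in t0 te; rewrite ger0_norm ?(ltW t0)//; apply: le_trans (e1 l); exact: ltW.
have QG v : Q l v @[l --> \oo] --> G v.
  have := is_derive_seq (dFG v); apply: cvg_trans; apply: near_eq_cvg.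
  apply: nearW => l; rewrite /Q mulN1r add0r; congr (_ * (_ - F _)).
  by apply/funext => j; rewrite /shift addr0 if_same.
have := riter_dct cQ cG dQ QG.
under eq_cvg do rewrite Q0.
by move=> /(cvg_lim (@Rhausdorff R)) <-; rewrite lim_cst.
Qed.
End Translation.

(** * The Gaussian density *)

Section GaussianMass.
Variable R : realType.
Implicit Types (v : nat -> R) (K : nat).
Local Notation mu := (@lebesgue_measure R).

Lemma integral_gauss (d a C : R) : 0 < d -> 0 <= C ->
  (\int[mu]_x (C * expR (- (2^-1) * (d * (x + a) ^+ 2)))%:E)%E
  = (C * Num.sqrt (2 * pi / d))%:E.
Proof.
move=> d0 C0.
pose s : R := Num.sqrt d^-1.
have s2 : s ^+ 2 = d^-1 by rewrite sqr_sqrtr// invr_ge0 ltW.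
have s0 : s != 0 by rewrite sqrtr_eq0 -ltNge invr_gt0.
pose k := Num.sqrt (2 * pi / d).
have kE : normal_peak s = k^-1.
  by rewrite /normal_peak s2 /k; congr ((Num.sqrt _)^-1); rewrite mulr2n; ring.
have k0 : 0 < k.
  by rewrite sqrtr_gt0 divr_gt0// mulr_gt0// pi_gt0.
transitivity (\int[mu]_x ((C * k)%:E * (normal_pdf (- a) s x)%:E))%E.
  apply: eq_integral => x _; rewrite -EFinM; congr EFin.
  rewrite normal_pdfE// kE /normal_fun [RHS]mulrA mulfK ?gt_eqF//; congr (_ * expR _).
  by rewrite s2 opprK; field; rewrite gt_eqF.
rewrite ge0_integralZl//; last 2 first.
- by move=> x _; rewrite lee_fin normal_pdf_ge0.
- by rewrite lee_fin mulr_ge0// ltW.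
- by rewrite integral_normal_pdf mule1.
by apply/measurable_EFinP; exact: measurable_normal_pdf.
Qed.

(** Coordinate 0 is integrated innermost. The offset [s j] involves only coordinates above [j],
    which are fixed when [v j] is integrated, and the mass of a one-dimensional Gaussian does not
    depend on its centre. *)
Lemma iter_int_triangular_gauss K (d : nat -> R) (s : nat -> (nat -> R) -> R) C :
  (forall j, 0 < d j) -> 0 <= C ->
  (forall j v w, (j < K)%N -> (forall k, (j < k < K)%N -> v k = w k) ->
     s j v = s j w) ->
  iter_int K (fun v => (C * \prod_(j < K)
     expR (- (2^-1) * (d j * (v j + s j v) ^+ 2)))%:E)
  = (C * \prod_(j < K) Num.sqrt (2 * pi / d j))%:E.
Proof.
move=> d0; elim: K s C => [|K IH] s C C0 hs /=; first by rewrite !big_ord0.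
pose a := s K (fun=> 0).
transitivity (\int[mu]_x (C * \prod_(j < K) Num.sqrt (2 * pi / d j)
    * expR (- (2^-1) * (d K * (x + a) ^+ 2)))%:E)%E; last first.
  rewrite integral_gauss//; first by rewrite big_ord_recr/= mulrA.
  by rewrite mulr_ge0// prodr_ge0// => j _; rewrite sqrtr_ge0.
apply: eq_integral => x _; rewrite mulrAC.
rewrite -(IH (fun j v => s j (upd K x v))); last 2 first.
- by rewrite mulr_ge0// expR_ge0.
- move=> j v w jK vw; apply: hs => [|k /andP[jk]]; first exact: ltnW.
  rewrite /upd ltnS leq_eqVlt => /orP[/eqP->|kK]; first by rewrite eqxx.
  by rewrite ltn_eqF// vw// jk.
congr iter_int; apply/funext => v; congr EFin.
rewrite big_ord_recr/= -mulrA; congr (_ * _); rewrite mulrC; congr (_ * _).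
  rewrite eqxx; congr (expR (_ * (_ * (_ + _) ^+ 2))); apply: hs => // k.
  by move=> /andP[Kk]; rewrite ltnS leqNgt Kk.
by apply: eq_bigr => j _; rewrite (ltn_eqF (ltn_ord j)).
Qed.

Lemma sum_mat_of (p n : nat) (F : nat -> R) :
  \sum_(k < p * n) F k = \sum_(j < n) \sum_(i < p) F (i + p * j)%N.
Proof.
rewrite -!(big_mkord xpredT) -(big_mkord xpredT (fun j => \sum_(i < p) F (i + p * j)%N)).
elim: n => [|n IH]; first by rewrite muln0 !big_geq.
rewrite big_nat_recr//= -IH (@big_cat_nat _ _ _ (p * n))//=; last first.
  by rewrite leq_mul2l leqnSn orbT.
congr (_ + _); rewrite -{1}[(p * n)%N]add0n big_addn mulnS addnK big_mkord.
by apply: eq_bigr => i _.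
Qed.

Lemma prod_mat_of (p n : nat) (F : nat -> R) :
  \prod_(k < p * n) F k = \prod_(j < n) \prod_(i < p) F (i + p * j)%N.
Proof.
rewrite -!(big_mkord xpredT) -(big_mkord xpredT (fun j => \prod_(i < p) F (i + p * j)%N)).
elim: n => [|n IH]; first by rewrite muln0 !big_geq.
rewrite big_nat_recr//= -IH (@big_cat_nat _ _ _ (p * n))//=; last first.
  by rewrite leq_mul2l leqnSn orbT.
congr (_ * _); rewrite -{1}[(p * n)%N]add0n big_addn mulnS addnK big_mkord.
by apply: eq_bigr => i _.
Qed.

End GaussianMass.

(** * Positive definite matrices and the mass of the density *)

Section PosDef.
Variable R : realType.

Lemma posdef_unit (p : nat) (S : 'M[R]_p) : posdef S -> S \in unitmx.
Proof.
move=> [St Sp]; rewrite unitmxE unitfE; apply/negP => /eqP/eqP/det0P[v v0 vS].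
have := Sp v^T; rewrite trmx_eq0 => /(_ v0).
by rewrite trmxK vS mul0mx mxE ltxx.
Qed.

Lemma posdef_inv (p : nat) (S : 'M[R]_p) : posdef S -> posdef (invmx S).
Proof.
move=> Spd; have Su := posdef_unit Spd; case: (Spd) => St Sp; split.
  by rewrite trmx_inv St.
move=> v v0; have := Sp (invmx S *m v).
rewrite trmx_mul trmx_inv St mulmxKV// mulmxA; apply; apply: contraNneq v0 => h.
by rewrite -[v](mulKVmx Su) h mulmx0.
Qed.

(** Induction on the Schur complement of the leading entry. [T] is upper triangular so that row [i]
    of [T *m X] involves only rows [l >= i] of [X], in agreement with the order of integration in
    [iter_int_triangular_gauss]. *)
Lemma posdef_ldl (p : nat) (A : 'M[R]_p) : posdef A ->
  exists T : 'M[R]_p, exists d : 'rV[R]_p,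
  [/\ forall i, 0 < d 0 i, forall i, T i i = 1,
      forall i j : 'I_p, (j < i)%N -> T i j = 0 & A = T^T *m diag_mx d *m T].
Proof.
elim: p A => [|p IH] A [At Ap].
  by exists 0, 0; split; try case=> //; apply/matrixP; case.
pose a := A 0 0.
move: A At Ap @a; rewrite -[p.+1]/(1 + p)%N => A At Ap a.
pose b := ursubmx A; pose C := drsubmx A.
have Adl : dlsubmx A = b^T by rewrite /b trmx_ursub At.
have Ct : C^T = C by rewrite /C trmx_drsub At.
have Aul : ulsubmx A = a%:M.
  apply/matrixP => i j; rewrite !ord1 !mxE eqxx mulr1n /a.
  by congr (A _ _); apply/val_inj.
have AE : A = block_mx a%:M b b^T C by rewrite -[LHS]submxK Aul Adl.
have a0 : 0 < a.
  have := Ap (delta_mx 0 0); rewrite trmx_delta -rowE -colE !mxE; apply.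
  by apply/eqP => /matrixP/(_ 0 0); rewrite !mxE !eqxx/= => /eqP; rewrite oner_eq0.
pose B := C - a^-1 *: (b^T *m b).
have AUBU (T : 'M[R]_p) (d : 'rV[R]_p) : B = T^T *m diag_mx d *m T ->
    A = (block_mx 1%:M (a^-1 *: b) 0 T)^T *m diag_mx (row_mx a%:M d)
        *m block_mx 1%:M (a^-1 *: b) 0 T.
  move=> BE; rewrite AE diag_mx_row tr_block_mx !mulmx_block.
  have -> : diag_mx (a%:M : 'rV[R]_1) = a%:M :> 'M[R]_1.
    by apply/matrixP => i j; rewrite !ord1 !mxE eqxx.
  rewrite !trmx1 !mul1mx !mulmx1 !trmx0 !mul0mx !mulmx0 !addr0 !add0r.
  have ab : a%:M *m (a^-1 *: b) = b.
    by rewrite mul_scalar_mx scalerA mulfV ?scale1r ?gt_eqF.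
  have ba : (a^-1 *: b)^T *m a%:M = b^T.
    by rewrite mul_mx_scalar linearZ/= scalerA mulfV ?scale1r ?gt_eqF.
  rewrite ab ba -BE mul0mx addr0; congr block_mx.
  by rewrite /B -scalemxAr addrC subrK.
have Bpd : posdef B.
  split; first by rewrite /B linearB linearZ/= trmx_mul trmxK Ct.
  move=> y y_neq0.
  (* The first entry of [z] minimizes the quadratic form of [A] for a given [y]; the minimum is the
     form of the Schur complement at [y]. *)
  pose z : 'cV[R]_(1 + p) := col_mx (- (a^-1 *: (b *m y))) y.
  have z0 : z != 0.
    apply/eqP => z0; case/eqP: y_neq0.
    rewrite -[y](col_mxKd (- (a^-1 *: (b *m y)))) -/z z0.
    by apply/matrixP => i j; rewrite !mxE.
  have := Ap z z0; congr (0 < _ 0 0).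
  rewrite AE /z tr_col_mx mul_row_block mul_row_col.
  have -> : (- (a^-1 *: (b *m y)))^T *m a%:M + y^T *m b^T = 0.
    rewrite mul_mx_scalar linearN linearZ/= scalerN scalerA mulfV ?gt_eqF//.
    by rewrite scale1r trmx_mul addNr.
  rewrite mul0mx add0r linearN linearZ/= trmx_mul; congr (_ *m _).
  by rewrite mulNmx -scalemxAl addrC /B mulmxBr -scalemxAr mulmxA.
have [T [d [d0 T1 T0 BE]]] := IH B Bpd.
exists (block_mx 1%:M (a^-1 *: b) 0 T), (row_mx a%:M d); split; last exact: AUBU.
- move=> i; rewrite -(fintype.splitK i); case: (fintype.split i) => k /=.
    by rewrite row_mxEl !ord1 mxE eqxx mulr1n.
  by rewrite row_mxEr.
- move=> i; rewrite -(fintype.splitK i); case: (fintype.split i) => k /=.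
    by rewrite block_mxEul !mxE !eqxx.
  by rewrite block_mxEdr.
- move=> i j; rewrite -(fintype.splitK i) -(fintype.splitK j).
  case: (fintype.split i) => k; case: (fintype.split j) => l /= lk.
  + by rewrite !ord1 in lk.
  + by move: lk; rewrite ord1.
  + by rewrite block_mxEdl mxE.
  + by rewrite block_mxEdr T0// -(ltn_add2l 1).
Qed.

Lemma sqrtr_prod (I : Type) (r : seq I) (P : pred I) (F : I -> R) :
  (forall i, 0 <= F i) ->
  \prod_(i <- r | P i) Num.sqrt (F i) = Num.sqrt (\prod_(i <- r | P i) F i).
Proof.
move=> F0; elim: r => [|i r IH]; first by rewrite !big_nil sqrtr1.
by rewrite !big_cons; case: (P i) => //; rewrite IH sqrtrM.
Qed.

Lemma det_unit_triangular (p : nat) (T : 'M[R]_p) :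
  (forall i, T i i = 1) -> (forall i j : 'I_p, (j < i)%N -> T i j = 0) ->
  \det T = 1.
Proof.
move=> T1 T0; rewrite -det_tr det_trig.
  by rewrite big1// => i _; rewrite mxE.
by apply/is_trig_mxP => i j ij; rewrite mxE T0.
Qed.

Lemma posdef_gram (p : nat) (A : 'M[R]_p) : posdef A ->
  exists2 Q : 'M[R]_p, Q \in unitmx & A = Q^T *m Q.
Proof.
move=> Apd; have [T [d [d0 T1 T0 AE]]] := posdef_ldl Apd.
pose D : 'M[R]_p := diag_mx (map_mx Num.sqrt d).
have DD : D^T *m D = diag_mx d.
  rewrite tr_diag_mx mulmx_diag; congr diag_mx; apply/rowP => i.
  by rewrite !mxE -expr2 sqr_sqrtr// ltW.
exists (D *m T).
  have := posdef_unit Apd; rewrite AE -DD !mulmxA -trmx_mul -mulmxA unitmx_mul.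
  by case/andP.
by rewrite trmx_mul AE -DD !mulmxA.
Qed.

Lemma trace_gram (p n : nat) (Q : 'M[R]_p) (A : 'M[R]_(p, n)) (d : 'rV[R]_p) :
  \tr (A^T *m (Q^T *m diag_mx d *m Q) *m A)
  = \sum_(j < n) \sum_(i < p) d 0 i * (Q *m A) i j ^+ 2.
Proof.
rewrite !mulmxA -mulmxA -trmx_mul; apply: eq_bigr => j _.
rewrite -mulmxA mxE; apply: eq_bigr => i _.
by rewrite mul_diag_mx !mxE mulrCA -expr2.
Qed.

Lemma iter_gauss_density (p n : nat) (S : 'M[R]_p) (Th : 'M[R]_(p, n)) :
  (0 < p)%N -> (0 < n)%N -> posdef S ->
  iter_int (p * n) (fun v => (gauss_density S Th (mat_of p n v))%:E) = 1%E.
Proof.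
case: p S Th => // p S Th _; case: n Th => // n Th _ Spd.
have [T [d [d0 T1 T0 AE]]] := posdef_ldl (posdef_inv Spd).
pose I k : 'I_p.+1 := inord (k %% p.+1).
pose J k : 'I_n.+1 := inord (k %/ p.+1).
have IE (i : 'I_p.+1) (j : nat) : I (i + p.+1 * j)%N = i.
  apply/val_inj; rewrite /I addnC mulnC modnMDl modn_small ?ltn_ord//=.
  by rewrite inordK.
have JE (i : 'I_p.+1) (j : 'I_n.+1) : J (i + p.+1 * j)%N = j.
  by apply/val_inj; rewrite /J addnC mulnC divnMDl// divn_small ?ltn_ord// addn0 /= inordK.
(* [v k + s k v] is the entry [(I k, J k)] of [T *m (X - Th)], because [T] has unit diagonal and
   vanishes below it. *)
pose s k v : R := - Th (I k) (J k)
  + \sum_(l < p.+1 | (I k < l)%N) T (I k) l * (v (l + p.+1 * J k)%N - Th l (J k)).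
pose e k := d 0 (I k).
pose C := ((Num.sqrt ((2 * pi) ^+ p.+1 * \det S))^-1) ^+ n.+1.
have e0 k : 0 < e k by exact: d0.
have detS : \det S * \prod_i d 0 i = 1.
  have := congr1 determinant AE; rewrite det_inv !det_mulmx det_tr.
  rewrite (det_unit_triangular T1 T0) mul1r mulr1 det_diag => <-.
  rewrite mulfV//; have := posdef_unit Spd.
  by rewrite unitmxE unitfE.
have C0 : 0 <= C by rewrite exprn_ge0// invr_ge0 sqrtr_ge0.
transitivity (iter_int (p.+1 * n.+1) (fun v => (C * \prod_(k < p.+1 * n.+1)
   expR (- (2^-1) * (e k * (v k + s k v) ^+ 2)))%:E)).
  congr iter_int; apply/funext => v; congr EFin.
  rewrite /gauss_density -/C; congr (_ * _).
  rewrite -expR_sum -mulr_sumr; congr (expR (_ * _)).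
  rewrite AE trace_gram [RHS](sum_mat_of _ _ (fun k => e k * (v k + s k v) ^+ 2)).
  apply: eq_bigr => j _; apply: eq_bigr => i _.
  rewrite /e IE; congr (_ * _ ^+ 2); rewrite /s IE JE mxE.
  rewrite (bigID (fun l : 'I_p.+1 => (i < l)%N))/= addrC addrA; congr (_ + _).
    rewrite (bigD1 i) ?ltnn//= big1 ?addr0 => [|l /andP[il li]].
      by rewrite T1 mul1r !mxE.
    rewrite T0 ?mul0r//; move: il; rewrite -leqNgt leq_eqVlt.
    by rewrite (inj_eq val_inj) (negbTE li).
  by apply: eq_bigr => l _; rewrite !mxE.
rewrite iter_int_triangular_gauss//; last first.
  move=> k v w kK vw; congr (_ + _); apply: eq_bigr => l Il; rewrite vw//.
  apply/andP; split.
    rewrite [X in (X < _)%N](divn_eq k p.+1) addnC mulnC.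
    rewrite /J inordK; last by rewrite ltn_divLR// mulnC.
    by rewrite ltn_add2r; move: Il; rewrite /I inordK// ltn_mod.
  apply: (@leq_trans (p.+1 + p.+1 * J k)); first by rewrite ltn_add2r.
  by rewrite -mulnS leq_mul2l/= ltn_ord.
congr EFin; rewrite (prod_mat_of _ _ (fun k => Num.sqrt (2 * pi / e k))).
rewrite (eq_bigr (fun=> \prod_(i < p.+1) Num.sqrt (2 * pi / d 0 i))) => [|j _]; last first.
  by apply: eq_bigr => i _; rewrite /e IE.
rewrite prodr_const card_ord -exprMn.
have -> : \prod_(i < p.+1) Num.sqrt (2 * pi / d 0 i)
    = Num.sqrt ((2 * pi) ^+ p.+1 * \det S).
  rewrite sqrtr_prod; last by move=> i; rewrite divr_ge0// ltW// ?mulr_gt0// pi_gt0.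
  rewrite prodf_div prodr_const card_ord; congr (Num.sqrt (_ * _)).
  have dn0 : \prod_i d 0 i != 0 by rewrite gt_eqF// prodr_gt0.
  by apply: (mulIf dn0); rewrite mulVf.
rewrite mulVf ?expr1n// sqrtr_eq0 -ltNge mulr_gt0 ?exprn_gt0 ?mulr_gt0 ?pi_gt0//.
have d1 : 0 < \prod_i d 0 i by rewrite prodr_gt0.
by rewrite -(pmulr_lgt0 _ d1) detS.
Qed.

End PosDef.

(** * Differentiable functions of polynomial growth *)

Section PolynomialGrowthCalculus.
Variables (R : realType) (p n : nat).
Variables (tau : 'M[R]_(p, n) -> R).
Hypothesis tau_ge1 : forall X, 1 <= tau X.
Variable D : set 'M[R]_(p, n).
Local Notation M := 'M[R]_(p, n).
Implicit Types (F G : M -> R) (dF dG : M -> M -> R).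

Definition mx_cvg (u : nat -> M) (X : M) :=
  forall i j, u l i j @[l --> \oo] --> X i j.

Definition cont_in F := forall u X, (forall l, D (u l)) -> D X -> mx_cvg u X ->
  F (u l) @[l --> \oo] --> F X.

Definition poly_bounded F := exists C k, forall X, D X -> `|F X| <= C * tau X ^+ k.

(** [dF E] is the derivative along the fixed direction [E]; Stein's identity uses line derivatives
    with growth bounded by powers of [tau]. The set [D] allows regularity to be stated away from the
    zeros of [W]. *)
Definition C1 F dF :=
  [/\ cont_in F, poly_bounded F, forall E, cont_in (dF E),
      forall E, poly_bounded (dF E)
    & forall E X, D X -> is_derive (0 : R) 1 (fun s : R => F (X + s *: E)) (dF E X)].

(** [F] and [G] must agree everywhere, since a difference quotient at a point of [D] may leave [D];
    the derivatives are compared on [D] only. *)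
Lemma eq_C1 F dF G dG : F =1 G -> (forall E X, D X -> dF E X = dG E X) ->
  C1 F dF -> C1 G dG.
Proof.
move=> /funext <- e [cF bF cdF bdF derF]; split=> // E.
- move=> u X Du DX uX; rewrite -e//; have := cdF E u X Du DX uX.
  by under eq_cvg do rewrite e//.
- by have [C [k h]] := bdF E; exists C, k => X DX; rewrite -e// h.
- by move=> X DX; rewrite -e//; exact: derF.
Qed.

Lemma poly_boundedW F C k : (forall X, D X -> `|F X| <= C * tau X ^+ k) ->
  exists2 C', 0 <= C' & forall j X, (k <= j)%N -> D X -> `|F X| <= C' * tau X ^+ j.
Proof.
move=> FC; exists `|C| => // j X kj DX; apply: le_trans (FC X DX) _.
apply: (@le_trans _ _ (`|C| * tau X ^+ k)).
  by rewrite ler_wpM2r ?ler_norm// exprn_ge0// (le_trans ler01).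
by rewrite ler_wpM2l// ler_weXn2l.
Qed.

Lemma poly_boundedD F G : poly_bounded F -> poly_bounded G ->
  poly_bounded (fun X => F X + G X).
Proof.
move=> [C [k /poly_boundedW [C' C0 FC]]] [B [l /poly_boundedW [B' B0 GB]]].
exists (C' + B'), (maxn k l) => X DX; rewrite mulrDl.
apply: le_trans (ler_normD _ _) _; apply: lerD.
  by apply: FC; rewrite // leq_maxl.
by apply: GB; rewrite // leq_maxr.
Qed.

Lemma poly_boundedM F G : poly_bounded F -> poly_bounded G ->
  poly_bounded (fun X => F X * G X).
Proof.
move=> [C [k FC]] [B [l GB]]; exists (C * B), (k + l)%N => X DX.
by rewrite normrM exprD mulrACA ler_pM// ?FC ?GB.
Qed.

Lemma poly_bounded_cst (a : R) : poly_bounded (fun=> a).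
Proof. by exists `|a|, 0%N => X _; rewrite expr0 mulr1. Qed.

Lemma cont_inD F G : cont_in F -> cont_in G -> cont_in (fun X => F X + G X).
Proof. by move=> cF cG u X Du DX uX; apply: cvgD; [exact: cF|exact: cG]. Qed.

Lemma cont_inM F G : cont_in F -> cont_in G -> cont_in (fun X => F X * G X).
Proof. by move=> cF cG u X Du DX uX; apply: cvgM; [exact: cF|exact: cG]. Qed.

Lemma cont_in_cst (a : R) : cont_in (fun=> a).
Proof. by move=> u X _ _ _; exact: cvg_cst. Qed.

Lemma C1_cst (a : R) : C1 (fun=> a) (fun _ _ => 0).
Proof.
split=> [||_|_|_ _ _]; [exact: cont_in_cst|exact: poly_bounded_cst|
  exact: cont_in_cst|exact: poly_bounded_cst|exact: is_derive_cst].
Qed.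

Lemma C1D F dF G dG : C1 F dF -> C1 G dG ->
  C1 (fun X => F X + G X) (fun E X => dF E X + dG E X).
Proof.
move=> [cF bF cdF bdF derF] [cG bG cdG bdG derG]; split.
- exact: cont_inD.
- exact: poly_boundedD.
- by move=> E; exact: cont_inD.
- by move=> E; exact: poly_boundedD.
- by move=> E X DX; exact: (is_deriveD (derF E X DX) (derG E X DX)).
Qed.

Lemma C1M F dF G dG : C1 F dF -> C1 G dG ->
  C1 (fun X => F X * G X) (fun E X => dF E X * G X + F X * dG E X).
Proof.
move=> [cF bF cdF bdF derF] [cG bG cdG bdG derG]; split.
- exact: cont_inM.
- exact: poly_boundedM.
- by move=> E; apply: cont_inD; exact: cont_inM.
- by move=> E; apply: poly_boundedD; exact: poly_boundedM.
- move=> E X DX; apply: is_derive_eq (is_deriveM (derF E X DX) (derG E X DX)) _.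
  by rewrite scale0r addr0 /GRing.scale/= addrC mulrC.
Qed.

Lemma C1Z (a : R) F dF : C1 F dF -> C1 (fun X => a * F X) (fun E X => a * dF E X).
Proof.
move=> hF; apply: (eq_C1 _ _ (C1M (C1_cst a) hF)) => // E X DX.
by rewrite mul0r add0r.
Qed.

Lemma C1V F dF : C1 F dF -> (forall X, D X -> F X != 0) ->
  poly_bounded (fun X => (F X)^-1) ->
  C1 (fun X => (F X)^-1) (fun E X => - dF E X / F X ^+ 2).
Proof.
move=> [cF bF cdF bdF derF] F0 bV.
have cV : cont_in (fun X => (F X)^-1).
  by move=> u X Du DX uX; apply: cvgV; [exact: F0|exact: cF].
split=> //.
- move=> E; have h := cont_inM (cont_inM (@cont_in_cst (-1)) (cdF E)) (cont_inM cV cV).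
  by move=> u X Du DX uX; have := h u X Du DX uX; under eq_cvg do
    rewrite mulN1r -invfM -expr2; rewrite mulN1r -invfM -expr2.
- move=> E; have [C [k h]] := poly_boundedM
    (poly_boundedM (poly_bounded_cst (-1)) (bdF E)) (poly_boundedM bV bV).
  by exists C, k => X DX; have := h X DX; rewrite mulN1r -invfM -expr2.
- move=> E X DX.
  have F0' : F (X + 0 *: E) != 0 by rewrite scale0r addr0 F0.
  apply: is_derive_eq (is_deriveV F0' (derF E X DX)) _.
  by rewrite scale0r addr0 /GRing.scale/= mulNr mulNr mulrC.
Qed.

Lemma C1_sum (I : Type) (r : seq I) (P : pred I) (F : I -> M -> R)
    (dF : I -> M -> M -> R) : (forall i, P i -> C1 (F i) (dF i)) ->
  C1 (fun X => \sum_(i <- r | P i) F i X) (fun E X => \sum_(i <- r | P i) dF i E X).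
Proof.
move=> hF; elim: r => [|i r IH].
  by apply: (eq_C1 _ _ (C1_cst 0)) => [X|E X _]; rewrite big_nil.
have [Pi|nPi] := boolP (P i).
  by apply: (eq_C1 _ _ (C1D (hF i Pi) IH)) => [X|E X _]; rewrite big_cons Pi.
by apply: (eq_C1 _ _ IH) => [X|E X _]; rewrite big_cons (negbTE nPi).
Qed.

Lemma C1_prod (I : Type) (r : seq I) (P : pred I) (F : I -> M -> R) :
  (forall i, exists dF, C1 (F i) dF) ->
  exists dF, C1 (fun X => \prod_(i <- r | P i) F i X) dF.
Proof.
move=> hF; elim: r => [|i r [dG IH]].
  exists (fun _ _ => 0).
  by apply: (eq_C1 _ _ (C1_cst 1)) => [X|//]; rewrite big_nil.
have [dF hFi] := hF i; have [Pi|nPi] := boolP (P i); eexists.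
  by apply: (eq_C1 _ _ (C1M hFi IH)) => [X|E X _]; rewrite ?big_cons ?Pi.
by apply: (eq_C1 _ _ IH) => [X|E X _]; rewrite ?big_cons ?(negbTE nPi).
Qed.

Lemma C1_unique F dF dF' E X : C1 F dF -> C1 F dF' -> D X -> dF E X = dF' E X.
Proof.
move=> [_ _ _ _ h] [_ _ _ _ h'] DX.
by rewrite -(@derive_val _ _ _ _ _ _ _ (h E X DX)) -(@derive_val _ _ _ _ _ _ _ (h' E X DX)).
Qed.

Definition C1mx (r s : nat) (A : M -> 'M[R]_(r, s)) (dA : M -> M -> 'M[R]_(r, s)) :=
  forall i j, C1 (fun X => A X i j) (fun E X => dA E X i j).

Lemma eq_C1mx r s (A B : M -> 'M[R]_(r, s)) dA dB : A =1 B ->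
  (forall E X, D X -> dA E X = dB E X) -> C1mx A dA -> C1mx B dB.
Proof.
move=> AB dAB hA i j; apply: (eq_C1 _ _ (hA i j)) => [X|E X DX]; first by rewrite AB.
by rewrite dAB.
Qed.

Lemma C1mx_cst r s (A : 'M[R]_(r, s)) : C1mx (fun=> A) (fun _ _ => 0).
Proof.
by move=> i j; apply: (eq_C1 _ _ (C1_cst (A i j))) => // E X _; rewrite mxE.
Qed.

Lemma C1mxD r s (A B : M -> 'M[R]_(r, s)) dA dB : C1mx A dA -> C1mx B dB ->
  C1mx (fun X => A X + B X) (fun E X => dA E X + dB E X).
Proof.
by move=> hA hB i j; apply: (eq_C1 _ _ (C1D (hA i j) (hB i j))) => [X|E X _]; rewrite !mxE.
Qed.

Lemma C1mxZ r s F dF (A : M -> 'M[R]_(r, s)) dA : C1 F dF -> C1mx A dA ->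
  C1mx (fun X => F X *: A X) (fun E X => dF E X *: A X + F X *: dA E X).
Proof.
by move=> hF hA i j; apply: (eq_C1 _ _ (C1M hF (hA i j))) => [X|E X _]; rewrite !mxE.
Qed.

Lemma C1mxM r s q (A : M -> 'M[R]_(r, s)) (B : M -> 'M[R]_(s, q)) dA dB :
  C1mx A dA -> C1mx B dB ->
  C1mx (fun X => A X *m B X) (fun E X => dA E X *m B X + A X *m dB E X).
Proof.
move=> hA hB i j.
apply: (eq_C1 _ _ (C1_sum (index_enum 'I_s) (P := xpredT)
   (fun k _ => C1M (hA i k) (hB k j)))) => [X|E X _]; rewrite !mxE//.
by rewrite -big_split.
Qed.

Lemma C1mx_tr r s (A : M -> 'M[R]_(r, s)) dA : C1mx A dA ->
  C1mx (fun X => (A X)^T) (fun E X => (dA E X)^T).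
Proof. by move=> hA i j; apply: (eq_C1 _ _ (hA j i)) => [X|E X _]; rewrite mxE. Qed.

Lemma C1_trace r (A : M -> 'M[R]_r) dA : C1mx A dA ->
  C1 (fun X => \tr (A X)) (fun E X => \tr (dA E X)).
Proof. by move=> hA; apply: C1_sum => i _; exact: hA. Qed.

Lemma C1mx_scalar r F dF : C1 F dF ->
  C1mx (fun X => (F X)%:M : 'M[R]_r) (fun E X => (dF E X)%:M).
Proof.
move=> hF i j; have [e|ne] := eqVneq i j.
  by apply: (eq_C1 _ _ hF) => [X|E X _]; rewrite mxE e eqxx.
by apply: (eq_C1 _ _ (C1_cst 0)) => [X|E X _]; rewrite mxE (negbTE ne).
Qed.

Lemma C1_det r (A : M -> 'M[R]_r) dA : C1mx A dA ->
  exists dd, C1 (fun X => \det (A X)) dd.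
Proof.
move=> hA.
have h (s : 'S_r) : exists dF, C1 (fun X => \prod_i A X i (s i)) dF.
  by apply: C1_prod => i; eexists; exact: hA.
have [df hf] := choice h.
exists (fun E X => \sum_(s : 'S_r) (-1) ^+ s * df s E X).
apply: (@C1_sum _ (index_enum _) xpredT (fun (s : 'S_r) X => (-1) ^+ s * \prod_i A X i (s i))
  (fun s E X => (-1) ^+ s * df s E X)) => s _.
by apply: C1Z; exact: hf.
Qed.

Lemma C1_cofactor r (A : M -> 'M[R]_r) dA i j : C1mx A dA ->
  exists dd, C1 (fun X => cofactor (A X) i j) dd.
Proof.
move=> hA; have [dd hd] : exists dd, C1 (fun X => \det (row' i (col' j (A X)))) dd.
  apply: (@C1_det _ _ (fun E X => row' i (col' j (dA E X)))) => k l.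
  by apply: (eq_C1 _ _ (hA (lift i k) (lift j l))) => [X|E X _]; rewrite !mxE.
by eexists; exact: C1Z hd.
Qed.

(* The identity [invmx A = (\det A)^-1 *: \adj A] may fail outside [D] where
   [A] is singular (invmx is then the identity function), hence hypothesis [VE]. *)
Lemma C1mx_inv r (A V : M -> 'M[R]_r) dA : C1mx A dA ->
  (forall X, V X = (\det (A X))^-1 *: \adj (A X)) ->
  (forall X, D X -> A X \in unitmx) ->
  poly_bounded (fun X => (\det (A X))^-1) ->
  C1mx V (fun E X => - (V X *m dA E X *m V X)).
Proof.
move=> hA VE Au bV.
have [dd hd] := C1_det hA.
have d0 X : D X -> \det (A X) != 0.
  by move=> /Au; rewrite unitmxE unitfE.
have hdV := C1V hd d0 bV.
have [dadj hadj] : exists dadj, C1mx (fun X => \adj (A X)) dadj.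
  have h (ij : 'I_r * 'I_r) : exists dF, C1 (fun X => \adj (A X) ij.1 ij.2) dF.
    have [dF hF] := C1_cofactor ij.2 ij.1 hA; exists dF.
    by apply: eq_C1 hF => // X; rewrite mxE.
  have [df hf] := choice h.
  exists (fun E X => \matrix_(i, j) df (i, j) E X) => i j.
  by apply: (eq_C1 _ _ (hf (i, j))) => // E X _; rewrite mxE.
apply: (eq_C1mx _ _ (C1mxZ hdV hadj)) => [X|E X DX]; first by rewrite VE.
(* Differentiating [\adj A *m A = (\det A)%:M] on both sides expresses the derivative of the
   adjugate through that of the determinant, and the latter cancels at the end. *)
have eq_dadj : dadj E X *m A X + \adj (A X) *m dA E X = (dd E X)%:M.
  apply/matrixP => i j.
  have h1 := C1mxM hadj hA i j.
  have h2 := @C1mx_scalar r _ _ hd i j.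
  have h3 : C1 (fun X => ((\det (A X))%:M : 'M[R]_r) i j)
      (fun E X => (dadj E X *m A X + \adj (A X) *m dA E X) i j).
    by apply: eq_C1 h1 => // Z; rewrite mul_adj_mx.
  exact: (C1_unique E h3 h2 DX).
have AV : A X *m V X = 1%:M.
  by rewrite VE -scalemxAr mul_mx_adj scale_scalar_mx mulVf// d0.
have -> : dadj E X = (dd E X) *: V X - \adj (A X) *m dA E X *m V X.
  have := congr1 (mulmx^~ (V X)) eq_dadj.
  rewrite mulmxDl -mulmxA AV mulmx1 mul_scalar_mx => <-; by rewrite addrK.
have dn0 := d0 X DX.
have -> : \adj (A X) = \det (A X) *: V X by rewrite VE scalerA mulfV// scale1r.
rewrite scalerBr !scalerA -!scalemxAl scalerA mulVf// scale1r addrA -scalerDl.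
have -> : - dd E X / \det (A X) ^+ 2 * \det (A X) + (\det (A X))^-1 * dd E X = 0.
  by field.
by rewrite scale0r sub0r.
Qed.

End PolynomialGrowthCalculus.

(** * The moment inequality *)

Section ScalarInequality.
Variable R : realFieldType.
Implicit Types (m c l h D rho : R).

(** In the application [l] bounds every [y_i] from below, [h] bounds their mean from below,
    [D = A0 + s1] and [rho = s2 / s1]. *)
Lemma drift_bound_ge2 m l h D rho : 2 <= m -> 0 <= l -> l <= h -> h <= rho ->
  rho <= 1 -> 0 < D -> m * h <= D ->
  14 - (8 - 4 / m) * l - (6 - 12 / m + 4 / m ^+ 2) * h <= D ->
  0 <= D - 8 * rho / m - 2 * (1 - rho) - 8 * (1 - l) - 4 * rho * (1 - rho) / D.
Proof.
move=> m2 l0 lh hr r1 D0 mhD BD.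
have m0 : 0 < m by lra.
pose k := m^-1.
have k0 : 0 < k by rewrite invr_gt0.
have k2 : k <= 2^-1 by rewrite lef_pV2// posrE.
have mk : m * k = 1 by rewrite mulfV// gt_eqF.
have {}BD : 14 - (8 - 4 * k) * l - (6 - 12 * k + 4 * k ^+ 2) * h <= D.
  by move: BD; rewrite -exprVn.
rewrite -/k.
have h0 : 0 <= h by lra.
have hk : 0 <= h * k by rewrite mulr_ge0// ltW.
have lk : 0 <= l * k by rewrite mulr_ge0// ltW.
have hkk : h * k ^+ 2 <= h * k / 2 by rewrite expr2 mulrA ler_wpM2l.
(* If [D >= m / 2], the quotient by [D] is at most [8 (1 - rho) / m] and joins the other terms.
   Otherwise [m h <= D] gives [l <= h < 1 / 2], the condition gives [D >= 7], hence [m > 14], and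
   the quotient is at most [1 / 7]. *)
have [mD|Dm] := lerP (m / 2) D.
  have -> : 4 * rho * (1 - rho) / D = 4 * (rho * (1 - rho)) * D^-1 by ring.
  have DV : D^-1 <= 2 * k.
    rewrite -[leRHS]invrK lef_pV2 ?posrE ?invr_gt0 ?mulr_gt0//.
    by rewrite invfM invrK mulrC.
  have e1 : rho * (1 - rho) * D^-1 <= (1 - rho) * (2 * k).
    apply: ler_pM => //; rewrite ?invr_ge0; nra.
  have kh : k * h <= 2^-1 * h by rewrite ler_wpM2r.
  have rk : rho * k <= k by nra.
  nra.
have h2 : h < 2^-1.
  rewrite -(ltr_pM2l m0); apply: le_lt_trans mhD _; lra.
have D7 : 7 <= D by nra.
have k14 : k <= 14^-1 by rewrite lef_pV2// ?posrE//; lra.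
have rr : rho * (1 - rho) <= 4^-1.
  by have := sqr_ge0 (rho - 2^-1); nra.
have DV : D^-1 <= 7^-1 by rewrite lef_pV2// ?posrE//.
have DV0 : 0 < D^-1 by rewrite invr_gt0.
have e1 : rho * (1 - rho) * D^-1 <= 4^-1 * 7^-1.
  by apply: ler_pM => //; nra.
have rk : rho * k <= 14^-1 by nra.
have -> : 4 * rho * (1 - rho) / D = 4 * (rho * (1 - rho) * D^-1) by ring.
nra.
Qed.

(** The case [m = 1], where [h = rho = l] and the quotient by [D] is absent. *)
Lemma drift_bound_eq1 l D : 0 <= l -> l <= 1 -> 14 - 4 * l + 2 * l <= D ->
  0 <= D - 8 * l - 2 * (1 - l) - 8 * (1 - l).
Proof. lra. Qed.

(* With [l = c / (c + 1)] and [h = m c / (m c + 1)], the polynomial condition on [c]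
   is [(c + 1) (m c + 1)] times an affine condition in [l] and [h]. *)
Lemma condition_affine m c A0 : 0 < m -> 0 < c ->
  0 <= (m * A0 + m ^+ 2 - 16 + 4 / m) * c ^+ 2
       + ((m + 1) * A0 + m ^+ 2 - 8 * m - 18) * c + A0 - 14 ->
  14 - (8 - 4 / m) * (c / (c + 1)) - (6 - 12 / m + 4 / m ^+ 2) * (m * c / (m * c + 1))
  <= A0 + m * (m * c / (m * c + 1)).
Proof.
move=> m0 c0 H.
have c1 : 0 < c + 1 by lra.
have mc1 : 0 < m * c + 1 by nra.
rewrite -subr_ge0 -(pmulr_rge0 _ (mulr_gt0 c1 mc1)).
apply: le_trans H _; rewrite le_eqVlt; apply/orP; left; apply/eqP.
by field; rewrite ?gt_eqF.
Qed.

(** At [c = 1 / m], the polynomial of (i) times [m ^+ 3] is affine in [A0]: it equals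
    [2 m^2 (m + 1) A0] minus the numerator in (ii). *)
Lemma condition_ii_i m c A0 : 0 < m -> c = m^-1 ->
  (- m ^+ 4 + 21 * m ^+ 3 + 18 * m ^+ 2 + 16 * m - 4) / (2 * m ^+ 2 * (m + 1)) <= A0 ->
  0 <= (m * A0 + m ^+ 2 - 16 + 4 / m) * c ^+ 2
       + ((m + 1) * A0 + m ^+ 2 - 8 * m - 18) * c + A0 - 14.
Proof.
move=> m0 ->; have k0 : 0 < 2 * m ^+ 2 * (m + 1) by rewrite !mulr_gt0// ?exprn_gt0//; lra.
rewrite ler_pdivrMr// => H.
have m3 : 0 < m ^+ 3 by rewrite exprn_gt0.
rewrite -(pmulr_rge0 _ m3); move: H; rewrite -subr_ge0 => H.
apply: le_trans H _; rewrite le_eqVlt; apply/orP; left; apply/eqP.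
by field; rewrite ?gt_eqF.
Qed.

(* With [s_k] the power sums of the [y_i], the conclusion is
   [alpha (a ^+ 2 * tr (V ^+ 2 W) + 2 D a) >= 0]. *)
Lemma drift_of_moment_bounds m c A0 l pt s1 s2 s3 s4 :
  forall u q r P D, u = m - s1 -> q = s1 - s2 -> r = s2 - s3 ->
  P = s1 * (A0 + s1) -> D = A0 + s1 ->
  0 < m -> 0 < c -> 0 < s1 -> 0 <= s2 -> 0 < q -> 0 <= r -> 0 < D ->
  s2 <= s1 ^+ 2 -> s3 - s4 <= r ->
  m * (c * q) <= s2 -> m * (c * u) <= s1 -> 0 <= l -> l <= c * u -> l <= 1 ->
  r <= s1 * q -> r <= s2 * (1 - l) ->
  4 * (r - c * u * q) <= pt * (s1 * D) ->
  0 <= D - 8 * (s2 / s1) / m - 2 * (1 - s2 / s1) - 8 * (1 - l) - pt ->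
  0 <= (P / q - (2 * c + 1)) ^+ 2 * q
     + 2 * ((- (A0 + 2 * s1) * (2 * r + 2 * c * u * s2) + 2 * c * u * s1 ^+ 2) / q
            - P / q ^+ 2 * (- 4 * (s2 - 2 * s3 + s4) - 4 * c * u * r + 2 * r)).
Proof.
move=> u q r P D uE qE rE PE DE m0 c0 s10 s20 q0 r0 D0 s2s1 s34 mcq mcu l0 lu l1 rsq rl Hpt H.
have P0 : 0 < P by rewrite PE -DE mulr_gt0.
pose e1 := c * u.
have Ps1 : 0 < P * s1 by rewrite mulr_gt0.
set w := - 4 * (s2 - 2 * s3 + s4) - 4 * c * u * r + 2 * r.
have wle : w <= 2 * r * (1 - l).
  have -> : w = - 2 * r + 4 * (s3 - s4) - 4 * (e1 * r) by rewrite /w rE /e1; ring.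
  have h1 : l * r <= e1 * r by rewrite ler_wpM2r.
  have h2 : 0 <= l * r by rewrite mulr_ge0.
  nra.
have wq : P * w / q <= 2 * P * s1 * (1 - l).
  rewrite ler_pdivrMr//; apply: (@le_trans _ _ (P * (2 * r * (1 - l)))).
    by rewrite ler_pM2l.
  have -> : 2 * P * s1 * (1 - l) * q = P * (2 * (s1 * q) * (1 - l)) by ring.
  by rewrite ler_pM2l// ler_wpM2r ?subr_ge0// ler_pM2l.
rewrite -(pmulr_rge0 _ q0).
have -> : q * ((P / q - (2 * c + 1)) ^+ 2 * q
     + 2 * ((- (A0 + 2 * s1) * (2 * r + 2 * c * u * s2) + 2 * c * u * s1 ^+ 2) / q
            - P / q ^+ 2 * w))
   = (P - (2 * c + 1) * q) ^+ 2 - 4 * D * (r + e1 * s2) - 4 * s1 * (r - e1 * q)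
     - 2 * (P * w / q).
  by rewrite /e1 DE PE; move: q0; rewrite qE => q0; field; rewrite gt_eqF.
have sq : P ^+ 2 - 2 * (2 * c + 1) * q * P <= (P - (2 * c + 1) * q) ^+ 2.
  have -> : (P - (2 * c + 1) * q) ^+ 2
      = P ^+ 2 - 2 * (2 * c + 1) * q * P + ((2 * c + 1) * q) ^+ 2 by ring.
  by rewrite lerDl sqr_ge0.
(* Up to the factor [P s1], the term [8 rho / m] collects [4 c q P] and [4 D e1 s2] ([b1], [b2]),
   [2 (1 - rho)] is [2 q P], [8 (1 - l)] collects [2 P w / q] and [4 D r] ([wq], [b3]), and [pt]
   covers [4 s1 (r - e1 q)] ([b4]). *)
have main : 0 <= P * s1 * (D - 8 * (s2 / s1) / m - 2 * (1 - s2 / s1) - 8 * (1 - l) - pt).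
  by rewrite mulr_ge0// ltW.
have E : P * s1 * (D - 8 * (s2 / s1) / m - 2 * (1 - s2 / s1) - 8 * (1 - l) - pt)
  = P ^+ 2 - 8 * P * (s2 / m) - 2 * P * q - 8 * P * s1 * (1 - l) - pt * (s1 * D) * s1.
  by rewrite PE qE DE; field; rewrite !gt_eqF.
rewrite E in main.
have cq : c * q <= s2 / m by rewrite ler_pdivlMr// mulrC.
have b1 : P * (c * q) <= P * (s2 / m) by rewrite ler_pM2l.
have e1s : e1 <= s1 / m by rewrite ler_pdivlMr// mulrC.
have b2 : D * (e1 * s2) <= P * (s2 / m).
  have -> : P * (s2 / m) = D * (s1 / m * s2) by rewrite PE DE; ring.
  by rewrite ler_pM2l// ler_wpM2r.
have b3 : D * r <= P * s1 * (1 - l).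
  have -> : P * s1 * (1 - l) = D * (s1 ^+ 2 * (1 - l)) by rewrite PE DE; ring.
  by rewrite ler_pM2l//; apply: le_trans rl _; rewrite ler_wpM2r// subr_ge0.
have b4 : 4 * s1 * (r - e1 * q) <= pt * (s1 * D) * s1.
  have -> : 4 * s1 * (r - e1 * q) = 4 * (r - c * u * q) * s1 by rewrite /e1; ring.
  by rewrite ler_pM2r.
nra.
Qed.

End ScalarInequality.

(** * Chebyshev and Cauchy-Schwarz inequalities for power sums *)

Section MomentInequalities.
Variables (R : realFieldType) (I : finType) (J : {set I}) (y : I -> R).
Hypothesis y01 : forall i, i \in J -> 0 < y i <= 1.
Local Notation s k := (\sum_(i in J) y i ^+ k).
Local Notation m := (#|J|%:R : R).

Lemma moment_le k l : (k <= l)%N -> s l <= s k.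
Proof.
move=> kl; apply: ler_sum => i /y01 /andP[y0 y1].
by rewrite ler_wiXn2l// ltW.
Qed.

Lemma le_moment1 i : i \in J -> y i <= s 1.
Proof.
move=> iJ; rewrite (bigD1 i)//= expr1 lerDl sumr_ge0// => j /andP[/y01 /andP[y0 _] _].
by rewrite expr1 ltW.
Qed.

(** Summed over all pairs, [(f i - f j) * (g j - g i)] equals twice the difference of the two
    sides. *)
Lemma chebyshev_sum (f g : I -> R) :
  (forall i j, i \in J -> j \in J -> 0 <= (f i - f j) * (g j - g i)) ->
  m * \sum_(i in J) f i * g i <= (\sum_(i in J) f i) * (\sum_(i in J) g i).
Proof.
move=> fg.
have : 0 <= \sum_(i in J) \sum_(j in J) (f i - f j) * (g j - g i).
  by apply: sumr_ge0 => i iJ; apply: sumr_ge0 => j jJ; exact: fg.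
set F := \sum_(i in J) f i; set G := \sum_(i in J) g i.
set FG := \sum_(i in J) f i * g i.
have inner i : \sum_(j in J) (f i - f j) * (g j - g i)
    = f i * G - m * (f i * g i) - FG + F * g i.
  rewrite (eq_bigr (fun j => f i * g j - f i * g i - f j * g j + f j * g i)); last first.
    by move=> j _; ring.
  rewrite !big_split/= !sumrN sumr_const -mulr_natl -mulr_sumr -mulr_suml -/F -/G -/FG; ring.
rewrite (eq_bigr _ (fun i _ => inner i)).
rewrite !big_split/= !sumrN sumr_const -[FG *+ _]mulr_natl -mulr_suml -!mulr_sumr.
rewrite -/F -/G -/FG => h.
have : 0 <= 2 * (F * G - m * FG) by apply: le_trans h _; rewrite le_eqVlt; apply/orP; left; apply/eqP; ring.
by rewrite pmulr_rge0 ?ltr0n// subr_ge0.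
Qed.

(** The weighted variance of [y] about its weighted mean [A / W] is nonnegative. *)
Lemma weighted_cauchy_schwarz (w : I -> R) : (forall i, i \in J -> 0 <= w i) ->
  0 < \sum_(i in J) w i ->
  (\sum_(i in J) w i * y i) ^+ 2
  <= (\sum_(i in J) w i) * (\sum_(i in J) w i * y i ^+ 2).
Proof.
move=> w0; set W := \sum_(i in J) w i; set A := \sum_(i in J) w i * y i.
set B := \sum_(i in J) _ => W0.
have : 0 <= \sum_(i in J) w i * (y i - A / W) ^+ 2.
  by apply: sumr_ge0 => i iJ; rewrite mulr_ge0 ?w0// sqr_ge0.
rewrite (eq_bigr (fun i => w i * y i ^+ 2 + (- 2 * A / W) * (w i * y i)
    + (A / W) ^+ 2 * w i)) => [|i _]; last by ring.
rewrite !big_split/= -!mulr_sumr -/W -/A -/B => h.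
have := mulr_ge0 (ltW W0) h.
have -> : W * (B + - 2 * A / W * A + (A / W) ^+ 2 * W) = W * B - A ^+ 2.
  by field; rewrite gt_eqF.
by rewrite subr_ge0.
Qed.

(** The weights [om i = 1 / y_i - 1] have total [1 / c], decrease in [y_i], and satisfy
    [y^(k+1) om = y^k - y^(k+1)]. Differences of consecutive power sums are thus weighted sums,
    which Chebyshev's inequality compares with the power sums themselves. *)
Lemma moment_drift_ge0 c A0 : (0 < #|J|)%N -> 0 < c -> 0 <= A0 ->
  \sum_(i in J) ((y i)^-1 - 1) = c^-1 ->
  0 <= (m * A0 + m ^+ 2 - 16 + 4 / m) * c ^+ 2
       + ((m + 1) * A0 + m ^+ 2 - 8 * m - 18) * c + A0 - 14 ->
  forall u q r P, u = m - s 1 -> q = s 1 - s 2 -> r = s 2 - s 3 ->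
  P = s 1 * (A0 + s 1) ->
  0 <= (P / q - (2 * c + 1)) ^+ 2 * q
     + 2 * ((- (A0 + 2 * s 1) * (2 * r + 2 * c * u * s 2) + 2 * c * u * s 1 ^+ 2) / q
            - P / q ^+ 2 * (- 4 * (s 2 - 2 * s 3 + s 4) - 4 * c * u * r + 2 * r)).
Proof.
move=> J0 c0 A00 sc H u q r P uE qE rE PE.
have m0 : 0 < m by rewrite ltr0n.
have y0 i : i \in J -> 0 < y i by move=> /y01 /andP[].
have y1 i : i \in J -> y i <= 1 by move=> /y01 /andP[].
pose om i := (y i)^-1 - 1.
have om0 i : i \in J -> 0 <= om i.
  by move=> iJ; rewrite subr_ge0 invf_ge1 ?y0// y1.
have som : \sum_(i in J) om i = c^-1 by [].
have yom i k : i \in J -> y i ^+ k.+1 * om i = y i ^+ k - y i ^+ k.+1.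
  by move=> iJ; rewrite /om exprSr; have := y0 i iJ => yi; field; rewrite gt_eqF.
have msom k : \sum_(i in J) y i ^+ k.+1 * om i = s k - s k.+1.
  by rewrite -sumrB; apply: eq_bigr => i iJ; rewrite yom.
have cheb k : m * (c * (s k - s k.+1)) <= s k.+1.
  have := @chebyshev_sum (fun i => y i ^+ k.+1) om; rewrite msom som => h.
  rewrite mulrCA -ler_pdivlMl// [leRHS]mulrC; apply: h => i j iJ jJ.
  rewrite /om opprB addrA subrK.
  have yi := y0 i iJ; have yj := y0 j jJ.
  have key : 0 <= (y i ^+ k.+1 - y j ^+ k.+1) * (y i - y j).
    have [ij|ji] := lerP (y i) (y j).
      by rewrite mulr_le0// subr_le0// lerXn2r// nnegrE ltW.
    by rewrite mulr_ge0// subr_ge0 ?lerXn2r ?nnegrE ?ltW.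
  have -> : (y j)^-1 - (y i)^-1 = (y i - y j) * ((y i)^-1 * (y j)^-1).
    by field; rewrite !gt_eqF.
  by rewrite mulrA mulr_ge0// mulr_ge0// invr_ge0 ltW.
pose l := c / (c + 1).
have c1 : 0 < c + 1 by rewrite addr_gt0.
have l0 : 0 <= l by rewrite divr_ge0 ?ltW.
have l1 : l <= 1 by rewrite ler_pdivrMr// mul1r lerDl.
(* A single weight is at most the total: [1 / y_i - 1 <= 1 / c]. *)
have ly i : i \in J -> l <= y i.
  move=> iJ; have yi := y0 i iJ.
  have : om i <= c^-1.
    by rewrite -som (bigD1 i)//= lerDl sumr_ge0// => j /andP[/om0].
  rewrite /om lerBlDr => h.
  rewrite ler_pdivrMr// -ler_pdivrMl//.
  have := ler_wpM2l (ltW c0) h; rewrite mulrDr mulfV ?gt_eqF// mulr1 => h'.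
  by rewrite mulrC; lra.
have cE : c != 0 by rewrite gt_eqF.
have msom0 : \sum_(i in J) y i * om i = u.
  rewrite uE -[X in X%:R]sum1_card natr_sum -sumrB; apply: eq_bigr => i iJ.
  by rewrite expr1 /om; have := y0 i iJ => yi; field; rewrite gt_eqF.
have s1E : s 1 = \sum_(i in J) y i by apply: eq_bigr => i _; rewrite expr1.
have cheb0 : m * (c * u) <= s 1.
  have := @chebyshev_sum (fun i => y i) om; rewrite msom0 som => h.
  rewrite mulrCA -ler_pdivlMl// [leRHS]mulrC.
  rewrite s1E; apply: h => i j iJ jJ; rewrite /om opprB addrA subrK.
  have yi := y0 i iJ; have yj := y0 j jJ.
  have -> : (y j)^-1 - (y i)^-1 = (y i - y j) * ((y i)^-1 * (y j)^-1).
    by field; rewrite !gt_eqF.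
  by rewrite mulrA -expr2 mulr_ge0 ?sqr_ge0// mulr_ge0// invr_ge0 ltW.
have lcu : l <= c * u.
  rewrite -ler_pdivrMl// mulrC -som -msom0 mulr_sumr; apply: ler_sum => i iJ.
  by rewrite ler_wpM2r ?om0 ?ly.
have s10 : 0 < s 1.
  case/card_gt0P: J0 => i iJ; apply: lt_le_trans (le_moment1 iJ); exact: y0.
have ys1 i k : i \in J -> y i ^+ k.+1 <= s 1 * y i ^+ k.
  by move=> iJ; rewrite exprS ler_wpM2r ?le_moment1// exprn_ge0// ltW// y0.
have q0 : 0 < q.
  have lgt0 : 0 < l by rewrite divr_gt0.
  apply: (@lt_le_trans _ _ (l ^+ 2 * c^-1)); first by rewrite mulr_gt0 ?exprn_gt0 ?invr_gt0.
  rewrite qE -msom -som mulr_sumr; apply: ler_sum => i iJ.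
  by rewrite ler_wpM2r ?om0// lerXn2r ?ly ?nnegrE// ltW// y0.
have qS k : s k.+1 - s k.+2 = \sum_(i in J) y i ^+ k.+1 * (1 - y i).
  by rewrite -sumrB; apply: eq_bigr => i _; rewrite mulrBr mulr1 -exprSr.
have yo i : i \in J -> 0 <= 1 - y i by move=> iJ; rewrite subr_ge0 y1.
have s20 : 0 <= s 2 by apply: sumr_ge0 => i iJ; rewrite exprn_ge0// ltW// y0.
have D0 : 0 < A0 + s 1 by lra.
have r0 : 0 <= r by rewrite rE subr_ge0 moment_le.
have s2s1 : s 2 <= s 1 ^+ 2.
  rewrite expr2 {2}s1E mulr_sumr; apply: ler_sum => i iJ.
  by have := ys1 i 1%N iJ; rewrite expr1.
have s34 : s 3 - s 4 <= r.
  rewrite rE !qS; apply: ler_sum => i iJ; rewrite ler_wpM2r ?yo//.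
  by rewrite ler_wiXn2l ?y1// ltW// y0.
have mcq : m * (c * q) <= s 2 by rewrite qE; exact: cheb.
have rsq : r <= s 1 * q.
  rewrite rE qE !qS mulr_sumr; apply: ler_sum => i iJ; rewrite mulrA ler_wpM2r ?yo//.
  exact: ys1.
have rl : r <= s 2 * (1 - l).
  rewrite rE qS mulr_suml; apply: ler_sum => i iJ.
  by rewrite ler_wpM2l ?lerD2l ?lerN2 ?ly// exprn_ge0// ltW// y0.
(* Cauchy-Schwarz with weights [y_i] gives [s2^2 <= s1 s3], which rearranges to this. *)
have rs : r * s 1 <= s 2 * q.
  have e2 : \sum_(i in J) y i * y i = s 2 by apply: eq_bigr => i _; rewrite expr2.
  have e3 : \sum_(i in J) y i * y i ^+ 2 = s 3 by apply: eq_bigr => i _; rewrite exprS.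
  have := @weighted_cauchy_schwarz y; rewrite -s1E e2 e3.
  move=> /(_ (fun i iJ => ltW (y0 i iJ)) s10); rewrite rE qE; nra.
have ms2 : s 1 ^+ 2 <= m * s 2.
  have e1 : \sum_(i in J) 1 * y i = s 1 by rewrite s1E; apply: eq_bigr => i _; rewrite mul1r.
  have e2 : \sum_(i in J) 1 * y i ^+ 2 = s 2 by apply: eq_bigr => i _; rewrite mul1r.
  have := @weighted_cauchy_schwarz (fun=> 1).
  rewrite e1 e2 sumr_const => h; apply: h => [i _|]; [exact: ler01|by []].
have mc1 : 0 < m * c + 1 by rewrite addr_gt0// mulr_gt0.
(* Cauchy-Schwarz with weights [1 / y_i], whose total is [m + 1 / c]. *)
have ms1 : m * (m * c / (m * c + 1)) <= s 1.
  have e1 : \sum_(i in J) (y i)^-1 * y i = m.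
    by rewrite -[RHS]sumr_const; apply: eq_bigr => i iJ; rewrite mulVf// gt_eqF// y0.
  have e2 : \sum_(i in J) (y i)^-1 * y i ^+ 2 = s 1.
    apply: eq_bigr => i iJ; rewrite expr1 expr2 mulrA mulVf ?mul1r// gt_eqF//.
    exact: y0.
  have := @weighted_cauchy_schwarz (fun i => (y i)^-1); rewrite e1 e2.
  have -> : \sum_(i in J) (y i)^-1 = c^-1 + m.
    by rewrite -sc sumrB sumr_const subrK.
  move=> h; have {}h : m ^+ 2 <= (c^-1 + m) * s 1.
    apply: h => [i iJ|]; first by rewrite invr_ge0 ltW// y0.
    by rewrite addr_gt0// invr_gt0.
  have -> : m * (m * c / (m * c + 1)) = m ^+ 2 * c / (m * c + 1) by ring.
  rewrite ler_pdivrMr//.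
  have -> : s 1 * (m * c + 1) = (c^-1 + m) * s 1 * c by field.
  by rewrite ler_pM2r.
have s21 : s 2 <= s 1 by exact: moment_le.
have cond := condition_affine m0 c0 H.
have m1 : 1 <= m by rewrite (ler_nat _ 1).
have lh : l <= m * c / (m * c + 1).
  by rewrite ler_pdivrMr// mulrAC ler_pdivlMr//; nra.
(* For [m = 1] the constraint determines the single [y_i = l], and [r = c u q] exactly, so [pt] can
   be taken to be 0. For [m >= 2], [c u q] is dropped and [rs] bounds [r]. *)
have [J1|J2] : #|J| = 1%N \/ (2 <= #|J|)%N by case: #|J| J0 => [//|[|k]] _; [left|right].
  have /cards1P[j Jj] : #|J| == 1%N by rewrite J1.
  have sj k : s k = y j ^+ k by rewrite Jj big_set1.
  have yj : y j = l.
    have := sc; rewrite Jj big_set1 => /eqP; rewrite subr_eq => /eqP h.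
    by rewrite -[LHS]invrK h /l; field; rewrite cE gt_eqF//= addrC.
  have l1' : c * (1 - l) = l by rewrite /l; field; rewrite gt_eqF.
  have mE : m = 1 by rewrite J1.
  have rcuq : r - c * u * q = 0.
    by rewrite rE uE qE !sj yj mE expr1 l1'; ring.
  have s21' : s 2 / s 1 = l.
    by rewrite !sj yj; have := s10; rewrite sj yj expr1 => l_gt0; field; rewrite gt_eqF.
  apply: (@drift_of_moment_bounds _ m c A0 l 0 (s 1) (s 2) (s 3) (s 4) u q r P (A0 + s 1)) => //.
    by rewrite rcuq mulr0 mul0r.
  rewrite s21' mE divr1 subr0; apply: drift_bound_eq1 => //.
  move: cond; rewrite mE mul1r -/l !divr1 expr1n divr1 sj yj expr1; lra.
set h := m * c / (m * c + 1) in ms1 cond lh.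
apply: (@drift_of_moment_bounds _ m c A0 l
  (4 * (s 2 / s 1) * (1 - s 2 / s 1) / (A0 + s 1)) (s 1) (s 2) (s 3) (s 4) u q r P (A0 + s 1)) => //.
- have cuq : 0 <= c * u * q by rewrite mulr_ge0 ?(ltW q0)//; apply: le_trans lcu.
  have -> : 4 * (s 2 / s 1) * (1 - s 2 / s 1) / (A0 + s 1) * (s 1 * (A0 + s 1))
      = 4 * (s 2 * q / s 1) by rewrite qE; field; rewrite !gt_eqF.
  have : r <= s 2 * q / s 1 by rewrite ler_pdivlMr.
  lra.
- apply: (@drift_bound_ge2 _ m l h) => //.
  + by rewrite ler_nat.
  + rewrite ler_pdivlMr//; apply: (@le_trans _ _ (s 1 / m * s 1)).
      by rewrite ler_wpM2r ?(ltW s10)// ler_pdivlMr// mulrC.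
    by rewrite -(ler_pM2l m0) mulrA mulrCA mulfV ?gt_eqF// mulr1 -expr2.
  + by rewrite ler_pdivrMr// mul1r.
  + lra.
  + apply: le_trans cond _; rewrite -/h; lra.
Qed.

End MomentInequalities.

(** * Simultaneous diagonalization *)

Section Diagonalization.
Variables (R C : fieldType) (toC : {rmorphism R -> C}) (p : nat).
Implicit Types (A B : 'M[R]_p) (f g : 'I_p -> R) (U : 'M[C]_p).

(** The eigenvalues [f] are given in the real field while the basis [U] lives in the extension,
    where the spectral theorem is available. [U] is merely invertible, as [W] is not symmetric. *)
Definition diagonalized U A f :=
  map_mx toC A = invmx U *m diag_mx (\row_i toC (f i)) *m U.

Section FixedBasis.
Variable U : 'M[C]_p.
Hypothesis Uu : U \in unitmx.

Lemma diagonalizedM A B f g : diagonalized U A f -> diagonalized U B g ->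
  diagonalized U (A *m B) (fun i => f i * g i).
Proof.
move=> hA hB; rewrite /diagonalized map_mxM/= hA hB !mulmxA mulmxK//.
rewrite -[_ *m diag_mx _ *m diag_mx _]mulmxA mulmx_diag; congr (_ *m diag_mx _ *m _).
by apply/rowP => i; rewrite !mxE rmorphM.
Qed.

Lemma diagonalizedD A B f g : diagonalized U A f -> diagonalized U B g ->
  diagonalized U (A + B) (fun i => f i + g i).
Proof.
move=> hA hB; rewrite /diagonalized map_mxD/= hA hB -mulmxDl -mulmxDr.
congr (_ *m _ *m _); apply/matrixP => i j.
by rewrite !mxE rmorphD mulrnDl.
Qed.

Lemma diagonalized_scalar (a : R) : diagonalized U a%:M (fun=> a).
Proof.
rewrite /diagonalized map_scalar_mx.
have -> : diag_mx (\row_(i < p) toC a) = (toC a)%:M.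
  by apply/matrixP => i j; rewrite !mxE; case: eqP.
by rewrite mul_mx_scalar -scalemxAl mulVmx// scalemx1.
Qed.

Lemma diagonalizedN A f : diagonalized U A f -> diagonalized U (- A) (fun i => - f i).
Proof.
move=> hA; rewrite /diagonalized map_mxN/= hA -mulNmx -mulmxN.
congr (_ *m _ *m _); apply/matrixP => i j.
by rewrite !mxE rmorphN mulNrn.
Qed.

Lemma diagonalized_trace A f : diagonalized U A f -> \tr A = \sum_i f i.
Proof.
move=> hA; apply: (fmorph_inj toC).
rewrite -trace_map_mx hA mxtrace_mulC mulKVmx// mxtrace_diag.
by rewrite rmorph_sum; apply: eq_bigr => i _; rewrite mxE.
Qed.

Lemma diagonalized_det A f : diagonalized U A f -> \det A = \prod_i f i.
Proof.
move=> hA; apply: (fmorph_inj toC).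
rewrite -det_map_mx hA !det_mulmx det_diag mulrC mulrA.
rewrite -det_mulmx mulmxV// det1 mul1r.
by rewrite rmorph_prod; apply: eq_bigr => i _; rewrite mxE.
Qed.

Lemma diagonalized_unit A f : diagonalized U A f -> (forall i, f i != 0) ->
  A \in unitmx.
Proof.
by move=> hA f0; rewrite unitmxE unitfE (diagonalized_det hA); apply/prodf_neq0 => i _.
Qed.

Lemma diagonalized_inv A f : diagonalized U A f -> (forall i, f i != 0) ->
  diagonalized U (invmx A) (fun i => (f i)^-1).
Proof.
move=> hA f0; have Au := diagonalized_unit hA f0.
have Cu : map_mx toC A \in unitmx by rewrite map_unitmx.
rewrite /diagonalized -[LHS]mulmx1.
have -> : 1%:M = map_mx toC A *m (invmx U *m diag_mx (\row_i toC (f i)^-1) *m U).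
  rewrite hA !mulmxA mulmxK// -[_ *m diag_mx _ *m diag_mx _]mulmxA mulmx_diag.
  have -> : \row_j ((\row_i toC (f i)) 0 j * (\row_i toC (f i)^-1) 0 j) = const_mx 1.
    by apply/rowP => i; rewrite !mxE -rmorphM mulfV// rmorph1.
  by rewrite diag_const_mx mulmx1 mulVmx.
by rewrite mulmxA -map_mxM/= mulVmx// map_mx1 mul1mx.
Qed.

(** The principal submatrix on the nonzero diagonal entries is invertible, so its size is at most
    the rank. *)
Lemma diagonalized_rank A f : diagonalized U A f ->
  (#|[set i | f i != 0%R]%SET| <= \rank A)%N.
Proof.
move=> hA; set K := [set i | f i != 0%R]%SET.
pose D := diag_mx (\row_i toC (f i)).
have -> : \rank A = \rank D.
  rewrite -(mxrank_map toC) hA mxrankMfree ?row_free_unit//.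
  rewrite -mxrank_tr trmx_mul mxrankMfree ?row_free_unit ?unitmx_tr ?unitmx_inv//.
  by rewrite mxrank_tr.
pose e := fun k : 'I_#|K| => enum_val k.
have eK k : f (e k) != 0 by have := enum_valP k; rewrite inE.
have Du : mxsub e e D \in unitmx.
  have -> : mxsub e e D = diag_mx (\row_k toC (f (e k))).
    by apply/matrixP => i j; rewrite !mxE (inj_eq enum_val_inj).
  rewrite unitmxE det_diag unitfE; apply/prodf_neq0 => k _.
  by rewrite mxE fmorph_eq0.
rewrite -[leqLHS](mxrank_unit Du) -[D in mxsub _ _ D]mulmx1 mxsub_mul.
by apply: leq_trans (mxrankM_maxl _ _) _; rewrite rowsubE mxrankM_maxr.
Qed.

End FixedBasis.

Lemma diagonalized_conj U A f (Q : 'M[R]_p) : U \in unitmx -> Q \in unitmx ->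
  diagonalized U (Q *m A *m invmx Q) f ->
  diagonalized (U *m map_mx toC Q) A f.
Proof.
move=> Uu Qu; have Cu : map_mx toC Q \in unitmx by rewrite map_unitmx.
rewrite /diagonalized !map_mxM/= map_invmx => h.
have -> : map_mx toC A = invmx (map_mx toC Q) *m (map_mx toC Q *m map_mx toC A
     *m invmx (map_mx toC Q)) *m map_mx toC Q.
  by rewrite !mulmxA mulVmx// mul1mx mulmxKV.
have -> : invmx (U *m map_mx toC Q) = invmx (map_mx toC Q) *m invmx U.
  have UQ : U *m map_mx toC Q \in unitmx by rewrite unitmx_mul Uu.
  apply: (can_inj (mulKmx UQ)); rewrite mulmxV// mulmxA mulmxK//.
  by rewrite mulmxV.
by rewrite h !mulmxA.
Qed.

End Diagonalization.

(** * Spectrum of a real Gram matrix *)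

Section Spectrum.
Variables (R : realType) (p : nat).
Local Notation toC := (real_complex R).

Lemma toC_real (x : R) : toC x \is Num.real.
Proof. by rewrite realE !lecE /= eqxx le_total. Qed.

Lemma gram_diagonalized (N : nat) (B : 'M[R]_(p, N)) :
  exists (U : 'M[R[i]]_p) f, [/\ U \in unitmx, forall i, 0 <= f i
    & diagonalized toC U (B *m B^T) f].
Proof.
pose A := map_mx toC (B *m B^T).
have An : A \is normalmx.
  apply: symmetric_normalmx.
    apply/is_hermitianmxP; rewrite expr0 scale1r map_mx_id//.
    apply/matrixP => i j; rewrite [LHS]mxE [RHS]mxE [RHS]mxE; congr toC.
    by rewrite !mxE; apply: eq_bigr => k _; rewrite !mxE mulrC.
  by apply/mxOverP => i j; rewrite mxE toC_real.
pose P := spectralmx A.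
have Pu : P \in unitmx := spectral_unit A.
have AE : A = invmx P *m diag_mx (spectral_diag A) *m P by exact/orthomx_spectralP.
pose Z := P *m map_mx toC B.
(* The diagonal matrix is [Z] times its conjugate transpose, so its entries are sums of squared
   moduli, hence real and nonnegative. *)
have DE : diag_mx (spectral_diag A) = Z *m map_mx Num.conj Z^T.
  have -> : map_mx Num.conj Z^T = map_mx toC B^T *m invmx P.
    rewrite invmx_unitary ?spectral_unitarymx// /Z trmx_mul map_mxM; congr (_ *m _).
    by apply/matrixP => i j; rewrite !mxE; apply: conj_Creal; exact: toC_real.
  have -> : Z *m (map_mx toC B^T *m invmx P) = P *m A *m invmx P.
    by rewrite /Z /A map_mxM !mulmxA.
  by rewrite [in RHS]AE !mulmxA mulmxV// mul1mx mulmxK.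
have sp_ge0 i : 0 <= spectral_diag A 0 i.
  have -> : spectral_diag A 0 i = diag_mx (spectral_diag A) i i by rewrite !mxE eqxx.
  by rewrite DE mxE; apply: sumr_ge0 => k _; rewrite !mxE mul_conjC_ge0.
pose f i := complex.Re (spectral_diag A 0 i).
have fE i : spectral_diag A 0 i = toC (f i).
  rewrite /f; have := sp_ge0 i; rewrite lecE /= => /andP[+ _].
  by case: (spectral_diag A 0 i) => a b /= /eqP ->.
have f_ge0 i : 0 <= f i by have := sp_ge0 i; rewrite lecE /= => /andP[].
have fd : spectral_diag A = \row_i toC (f i).
  by apply/rowP => i; rewrite mxE fE.
exists P, f; split; [exact: Pu|exact: f_ge0|].
by rewrite /diagonalized -fd; exact: AE.
Qed.

End Spectrum.

(** * From eigenvalues to power sums *)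

Section TraceInequality.
Variable R : realType.

(** [W] may have rank below [min(p, n-1)]. Its nonzero eigenvalues are then padded with zero ones,
    for which [y_i = 1], to reach exactly the number [m] of the condition. *)
Lemma superset_card (T : finType) (K : {set T}) (k : nat) :
  (#|K| <= k <= #|T|)%N -> exists2 J : {set T}, (K \subset J)%SET & #|J| = k.
Proof.
elim: k => [|k IH] /andP[Kk kT].
  by exists K => //; apply/eqP; rewrite -leqn0.
move: Kk; rewrite leq_eqVlt => /orP[/eqP Kk|]; first by exists K.
rewrite ltnS => Kk; have [|J KJ Jk] := IH; first by rewrite Kk ltnW.
have [x xJ] : exists x, x \notin J.
  have /card_gt0P[x] : (0 < #|~: J|)%N by rewrite cardsCs finset.setCK Jk subn_gt0.
  by rewrite inE; exists x.
exists (x |: J)%SET; last by rewrite cardsU1 xJ Jk.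
exact: (fintype.subset_trans KJ (finset.subsetUr _ _)).
Qed.

Lemma sum_off_support (p : nat) (J : {set 'I_p}) (g : 'I_p -> R) (a : R) :
  (forall i, i \notin J -> g i = a) ->
  \sum_i g i = \sum_(i in J) g i + (p%:R - #|J|%:R) * a.
Proof.
move=> gJ; rewrite (bigID (mem J))/=; congr (_ + _).
rewrite (eq_bigr (fun=> a)) => [|i /gJ//]; rewrite sumr_const -[LHS]mulr_natl; congr (_ * _).
have /(congr1 (fun k => k%:R : R)) := cardC (mem J); rewrite card_ord natrD => h.
by apply: (addrI #|J|%:R); rewrite h addrC subrK.
Qed.

(* [z] lists the eigenvalues of [V], [lam] those of [W]; [v], [u], [w] are the traces of
   [V], [V W], [V ^+ 2 W], and [dv], [dw] the derivatives of [v], [w] along [V Y]. *)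
Lemma spectral_drift_ge0 (p n : nat) (J : {set 'I_p}) (lam : 'I_p -> R) (c : R) :
  let m : R := #|J|%:R in
  let A0 : R := (maxn p n.-1)%:R - (minn p n.-1)%:R in
  let t := \sum_i lam i in let al := c * t in let A1 : R := n%:R - p%:R - 1 in
  let z i := (lam i + al)^-1 in
  let v := \sum_i z i in let u := \sum_i z i * lam i in
  let w := \sum_i z i * z i * lam i in
  let dv := - 2 * \sum_i z i * z i * z i * lam i - 2 * c * u * \sum_i z i * z i in
  let dw := - 4 * \sum_i z i * z i * z i * z i * lam i * lam i
            + (2 - 4 * c * u) * \sum_i z i * z i * z i * lam i in
  let N := A1 * v + al * v ^+ 2 in
  let dN := A1 * dv + 2 * c * u * v ^+ 2 + 2 * al * v * dv in
  (0 < n)%N -> #|J| = minn p n.-1 -> (0 < #|J|)%N ->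
  (forall i, 0 <= lam i) -> (forall i, i \notin J -> lam i = 0) ->
  0 < t -> 0 < c ->
  0 <= (m * A0 + m ^+ 2 - 16 + 4 / m) * c ^+ 2
       + ((m + 1) * A0 + m ^+ 2 - 8 * m - 18) * c + A0 - 14 ->
  (0 <= (N / w - (2 * c + 1)) ^+ 2 * w + 2 * (dN / w - N * dw / w ^+ 2)) : Prop.
Proof.
move=> m A0 t al A1 z v u w dv dw N dN n0 Jm J0 lam0 lamJ t0 c0 cond.
have al0 : 0 < al by rewrite mulr_gt0.
have al_neq0 : al != 0 by rewrite gt_eqF.
pose y i := al * z i.
have la0 i : 0 < lam i + al by rewrite ltr_wpDl.
have z0 i : 0 < z i by rewrite invr_gt0.
have y01 i : i \in J -> 0 < y i <= 1.
  by move=> _; rewrite mulr_gt0//= ler_pdivrMr// mul1r lerDr.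
have A00 : 0 <= A0 by rewrite subr_ge0 ler_nat leq_max !geq_min !leqnn ?orbT.
have lamE i : lam i = al * ((y i)^-1 - 1).
  by rewrite /y /z; field; rewrite al_neq0 gt_eqF.
have yJ i : i \notin J -> y i = 1.
  by move=> /lamJ h; rewrite /y /z h add0r mulfV.
have y_neq0 i : y i != 0 by rewrite gt_eqF// mulr_gt0.
have zE i : z i = al^-1 * y i by rewrite /y mulrA mulVf ?mul1r.
have sc : \sum_(i in J) ((y i)^-1 - 1) = c^-1.
  have tE : t = al * \sum_(i in J) ((y i)^-1 - 1).
    rewrite /t (sum_off_support (J := J) (a := 0)) ?mulr0 ?addr0// mulr_sumr.
    by apply: eq_bigr => i _; rewrite lamE.
  have : t / al = c^-1 by rewrite /al; field; rewrite !gt_eqF.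
  by rewrite {1}tE mulrAC mulfV// mul1r.
have := moment_drift_ge0 y01 J0 c0 A00 sc cond.
set s1 := \sum_(i in J) y i ^+ 1; set s2 := \sum_(i in J) y i ^+ 2.
set s3 := \sum_(i in J) y i ^+ 3; set s4 := \sum_(i in J) y i ^+ 4.
pose k : R := p%:R - #|J|%:R.
have vE : al * v = s1 + k.
  rewrite mulr_sumr -[LHS]/(\sum_i y i) (sum_off_support yJ) mulr1.
  by congr (_ + _); apply: eq_bigr => i _; rewrite expr1.
have uE : u = #|J|%:R - s1.
  rewrite /u (sum_off_support (J := J) (a := 0)); last by move=> i /lamJ ->; rewrite mulr0.
  rewrite mulr0 addr0 -[X in X%:R - _]sum1_card natr_sum -sumrB.
  by apply: eq_bigr => i _; rewrite expr1 lamE zE; field; rewrite y_neq0.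
have wE : al * w = s1 - s2.
  rewrite mulr_sumr (sum_off_support (J := J) (a := 0)); last by move=> i /lamJ ->; rewrite !mulr0.
  rewrite mulr0 addr0 -sumrB; apply: eq_bigr => i _.
  by rewrite lamE zE; field; rewrite al_neq0 y_neq0.
have zzE : al ^+ 2 * \sum_i z i * z i = s2 + k.
  rewrite mulr_sumr (eq_bigr (fun i => y i ^+ 2)) => [|i _]; last by rewrite zE; field.
  rewrite (sum_off_support (J := J) (a := 1)) ?mulr1// => i /yJ ->.
  by rewrite expr1n.
have rE : al ^+ 2 * \sum_i z i * z i * z i * lam i = s2 - s3.
  rewrite mulr_sumr (sum_off_support (J := J) (a := 0)); last by move=> i /lamJ ->; rewrite !mulr0.
  rewrite mulr0 addr0 -sumrB; apply: eq_bigr => i _.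
  by rewrite lamE zE; field; rewrite al_neq0 y_neq0.
have r4E : al ^+ 2 * \sum_i z i * z i * z i * z i * lam i * lam i = s2 - 2 * s3 + s4.
  rewrite mulr_sumr (sum_off_support (J := J) (a := 0)); last by move=> i /lamJ ->; rewrite !mulr0.
  rewrite mulr0 addr0 mulr_sumr -sumrB -big_split; apply: eq_bigr => i _ /=.
  by rewrite lamE zE; field; rewrite al_neq0 y_neq0.
move=> /(_ u (s1 - s2) (s2 - s3) (s1 * (A0 + s1)) uE erefl erefl erefl).
(* [k] is 0 if [p <= n - 1] and [A0] otherwise. These two relations remove [k] from [NE] and [dNE]
   below. *)
have kA : A1 = A0 - 2 * k /\ k * (A0 - k) = 0.
  rewrite /A1 /A0 /k Jm -{1}(prednK n0) -[n.-1.+1]addn1 natrD.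
  have [pn|np] := leqP p n.-1.
    by rewrite subrr; split; ring.
  by rewrite subrr mulr0; split; [ring|].
have [A1E kk] := kA.
have dvE : al ^+ 2 * dv = - 2 * (s2 - s3) - 2 * c * u * (s2 + k).
  by rewrite -rE -zzE /dv; ring.
have dwE : al ^+ 2 * dw = - 4 * (s2 - 2 * s3 + s4) + (2 - 4 * c * u) * (s2 - s3).
  by rewrite -rE -r4E /dw; ring.
have NE : al * N = s1 * (A0 + s1).
  have -> : al * N = A1 * (al * v) + (al * v) ^+ 2 by rewrite /N; ring.
  rewrite vE A1E -[RHS]addr0 -kk; ring.
have dNE : al ^+ 2 * dN = - (A0 + 2 * s1) * (2 * (s2 - s3) + 2 * c * u * s2)
     + 2 * c * u * s1 ^+ 2.
  have -> : al ^+ 2 * dN = (A1 + 2 * (al * v)) * (al ^+ 2 * dv) + 2 * c * u * (al * v) ^+ 2.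
    by rewrite /dN; ring.
  rewrite vE dvE A1E.
  have -> : - (A0 + 2 * s1) * (2 * (s2 - s3) + 2 * c * u * s2) + 2 * c * u * s1 ^+ 2
    = - (A0 + 2 * s1) * (2 * (s2 - s3) + 2 * c * u * s2) + 2 * c * u * s1 ^+ 2
      - 2 * c * u * (k * (A0 - k)) by rewrite kk; ring.
  by ring.
have w0 : 0 < w.
  have [i li] : exists i, 0 < lam i.
    apply: contrapT => /forallNP h; have : t <= 0.
      by apply: sumr_le0 => i _; rewrite leNgt; apply/negP/h.
    by rewrite leNgt t0.
  rewrite /w (bigD1 i)//= ltr_pwDl//; first by rewrite !mulr_gt0.
  by apply: sumr_ge0 => j _; rewrite !mulr_ge0// ltW.
rewrite -NE -dNE -wE => h.
(* Each trace is a power of [al] times its expression in power sums, and the powers combine to a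
   single factor [al^-1]. *)
have -> : (N / w - (2 * c + 1)) ^+ 2 * w + 2 * (dN / w - N * dw / w ^+ 2)
  = al^-1 * ((al * N / (al * w) - (2 * c + 1)) ^+ 2 * (al * w) +
     2 * (al ^+ 2 * dN / (al * w) - al * N / (al * w) ^+ 2 * (al ^+ 2 * dw))).
  by field; rewrite al_neq0 gt_eqF.
rewrite mulr_ge0 ?invr_ge0 ?(ltW al0)//; move: h; rewrite dwE.
by congr (0 <= _ + 2 * (_ - _ * _)); ring.
Qed.

End TraceInequality.

(** * The divergence of the shrinkage *)

Section MatrixDelta.
Variables (R : fieldType) (p n : nat).

Lemma mulmx_delta_mulmx (q r : nat) (A : 'M[R]_(q, p)) (B : 'M[R]_(n, r)) i j k l :
  (A *m delta_mx i j *m B) k l = A k i * B j l.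
Proof.
rewrite -mulmxA mxE (bigD1 i)//= big1 => [|s si]; last first.
  rewrite mxE big1 ?mulr0// => t _; rewrite mxE (negbTE si) /=.
  by rewrite mul0r.
rewrite addr0 mxE (bigD1 j)//= big1 => [|t tj]; last first.
  by rewrite mxE (negbTE tj) andbF mul0r.
by rewrite addr0 mxE !eqxx mul1r.
Qed.

Lemma div_mulmx (A : 'M[R]_p) (B : 'M[R]_n) :
  \sum_i \sum_j (A *m delta_mx i j *m B) i j = \tr A * \tr B.
Proof.
rewrite /mxtrace mulr_suml; apply: eq_bigr => i _; rewrite mulr_sumr.
by apply: eq_bigr => j _; rewrite mulmx_delta_mulmx.
Qed.

(** Chain rule for scalar weights: with [L] the differential of a weight, partial derivatives paired
    with the entries of [H] add up to the derivative along [H]. *)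
Lemma linear_delta_sum (L : 'M[R]_(p, n) -> R) :
  (forall E F, L (E + F) = L E + L F) -> (forall a E, L (a *: E) = a * L E) ->
  forall H : 'M[R]_(p, n), \sum_i \sum_j L (delta_mx i j) * H i j = L H.
Proof.
move=> LD LZ H; rewrite [in RHS](matrix_sum_delta H).
have L0 : L 0 = 0 by rewrite -(scale0r 0) LZ mul0r.
rewrite (big_morph L LD L0); apply: eq_bigr => i _.
by rewrite (big_morph L LD L0); apply: eq_bigr => j _; rewrite LZ mulrC.
Qed.

End MatrixDelta.

Lemma div_mulmx_tr (R : fieldType) (p n : nat) (A B : 'M[R]_(p, n)) :
  \sum_i \sum_j (A *m (delta_mx i j)^T *m B) i j = \tr (A^T *m B).
Proof.
rewrite exchange_big; apply: eq_bigr => j _; rewrite mxE; apply: eq_bigr => i _.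
by rewrite trmx_delta mulmx_delta_mulmx mxE.
Qed.

Section Divergence.
Variables (R : realType) (C : fieldType) (toC : {rmorphism R -> C}) (p n : nat).
Variables (P : 'M[R]_p) (Cn : 'M[R]_n) (Y : 'M[R]_(p, n)) (c : R).
Variables (V : 'M[R]_p) (U : 'M[C]_p) (lam : 'I_p -> R).
Local Notation W := (Y *m Y^T *m P).
Local Notation t := (\tr W).
Local Notation al := (c * t).
Hypotheses (PT : P^T = P) (CnT : Cn^T = Cn) (YCn : Y *m Cn = Y)
  (trCn : \tr Cn = n%:R - 1).
Hypotheses (Uu : U \in unitmx) (dW : diagonalized toC U W lam)
  (lam_al : forall i, lam i + al != 0) (VE : V = invmx (W + al%:M)).
Local Notation z i := ((lam i + al)^-1).

(** A displacement [E] of [X] moves the centred matrix [Y] by [E *m Cn]. *)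
Definition der_W (E : 'M[R]_(p, n)) := (E *m Cn *m Y^T + Y *m (E *m Cn)^T) *m P.
(* All statistics depend on [Y] through [W] only, so their derivatives are written as
   linear functions of the derivative [w] of [W]. *)
Definition der_V (w : 'M[R]_p) := - (V *m (w + (c * \tr w)%:M) *m V).
Definition der_trV w := \tr (der_V w).
Definition der_trVW w := \tr (der_V w *m W + V *m w).
Definition der_trVVW w := \tr (der_V w *m V *m W + V *m der_V w *m W + V *m V *m w).

Let v := \tr V.
Let u := \tr (V *m W).
Let w2 := \tr (V *m V *m W).
Let A1 : R := n%:R - p%:R - 1.
Let kappa : R := (n%:R - 1) * p%:R - 2.
Let N := A1 * v + al * v ^+ 2.

Definition der_N w := A1 * der_trV w + (c * \tr w) * v ^+ 2 + 2 * al * v * der_trV w.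
Definition weight_a := N / w2 - (2 * c + 1).
Definition der_a w := der_N w / w2 - N * der_trVVW w / w2 ^+ 2.
Definition weight_b := kappa - u * weight_a.
Definition der_b w := - (der_trVW w * weight_a + u * der_a w).
Definition shrink := (weight_a *: V + (weight_b / t)%:M) *m Y.
Definition der_shrink E := let w := der_W E in
  (der_a w *: V + weight_a *: der_V w
   + (der_b w / t - weight_b * \tr w / t ^+ 2)%:M) *m Y
  + (weight_a *: V + (weight_b / t)%:M) *m (E *m Cn).

Lemma diagonalized_WalM : diagonalized toC U (W + al%:M) (fun i => lam i + al).
Proof. exact: diagonalizedD dW (diagonalized_scalar toC Uu _). Qed.

Lemma diagonalized_V : diagonalized toC U V (fun i => z i).
Proof. by rewrite VE; exact: diagonalized_inv diagonalized_WalM _. Qed.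

Lemma mulVWal : V *m (W + al%:M) = 1%:M.
Proof. by rewrite VE mulVmx// (diagonalized_unit Uu diagonalized_WalM). Qed.

Lemma mulWalV : (W + al%:M) *m V = 1%:M.
Proof. by rewrite VE mulmxV// (diagonalized_unit Uu diagonalized_WalM). Qed.

Lemma mulPV : P *m V = V^T *m P.
Proof.
have PM : P *m (W + al%:M) = (W + al%:M)^T *m P.
  rewrite [(_ + _)^T]linearD/= tr_scalar_mx !trmx_mul trmxK PT mulmxDl mulmxDr !mulmxA.
  by rewrite mul_mx_scalar mul_scalar_mx.
rewrite -[RHS]mulmx1 -mulWalV mulmxA -[_ *m P *m _]mulmxA PM mulmxA.
by rewrite -trmx_mul mulWalV trmx1 mul1mx.
Qed.

(** The hypothesis says that [A] is self-adjoint for the form [P]. It covers the identity, [V], and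
    their products and combinations, hence every direction in which a weight is differentiated. *)
Lemma der_W_shrunk (A : 'M[R]_p) : P *m A = A^T *m P -> der_W (A *m Y) = A *m W + W *m A.
Proof.
move=> PA; rewrite /der_W -[A *m Y *m Cn]mulmxA YCn mulmxDl trmx_mul !mulmxA.
by congr (_ + _); rewrite -!mulmxA PA.
Qed.

Lemma der_WD E F : der_W (E + F) = der_W E + der_W F.
Proof.
rewrite /der_W -mulmxDl; congr (_ *m _).
by rewrite mulmxDl linearD/= mulmxDl mulmxDr addrACA.
Qed.

Lemma der_WZ a E : der_W (a *: E) = a *: der_W E.
Proof.
rewrite /der_W -scalemxAl linearZ/= -scalemxAl -scalemxAr -scalerDr.
by rewrite -scalemxAl.
Qed.

Lemma der_VD w w' : der_V (w + w') = der_V w + der_V w'.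
Proof.
rewrite /der_V mxtraceD mulrDr [(_ + _)%:M]raddfD /= addrACA mulmxDr mulmxDl.
by rewrite opprD.
Qed.

Lemma der_VZ a w : der_V (a *: w) = a *: der_V w.
Proof.
rewrite /der_V mxtraceZ.
have -> : (c * (a * \tr w))%:M = a *: (c * \tr w)%:M :> 'M[R]_p.
  by rewrite scale_scalar_mx mulrCA.
by rewrite -scalerDr -scalemxAr -scalemxAl scalerN.
Qed.

Lemma der_aD w w' : der_a (w + w') = der_a w + der_a w'.
Proof.
rewrite /der_a /der_N /der_trVVW /der_trV der_VD !(mulmxDl, mulmxDr) !mxtraceD.
ring.
Qed.

Lemma der_aZ a w : der_a (a *: w) = a * der_a w.
Proof.
rewrite /der_a /der_N /der_trVVW /der_trV der_VZ.
rewrite !(=^~ scalemxAr, =^~ scalemxAl) !(mxtraceD, mxtraceZ); ring.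
Qed.

Lemma der_bD w w' : der_b (w + w') = der_b w + der_b w'.
Proof.
rewrite /der_b der_aD /der_trVW der_VD !(mulmxDl, mulmxDr) !mxtraceD; ring.
Qed.

Lemma der_bZ a w : der_b (a *: w) = a * der_b w.
Proof.
rewrite /der_b der_aZ /der_trVW der_VZ !(=^~ scalemxAr, =^~ scalemxAl).
rewrite !(mxtraceD, mxtraceZ); ring.
Qed.

Lemma delta_sum_der_W (L : 'M[R]_p -> R) :
  (forall w w', L (w + w') = L w + L w') -> (forall a w, L (a *: w) = a * L w) ->
  forall H : 'M[R]_(p, n), \sum_i \sum_j L (der_W (delta_mx i j)) * H i j = L (der_W H).
Proof.
move=> LD LZ H; apply: (@linear_delta_sum _ _ _ (fun E => L (der_W E))) => [E F|a E].
  by rewrite der_WD LD.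
by rewrite der_WZ LZ.
Qed.

Lemma der_W_Y : der_W Y = W + W.
Proof.
by rewrite -{1}[Y]mul1mx der_W_shrunk ?mul1mx ?mulmx1// trmx1 mul1mx.
Qed.

Lemma trVW_trV : \tr (V *m W) = p%:R - al * v.
Proof.
have -> : V *m W = 1%:M - al *: V.
  by apply/eqP; rewrite eq_sym subr_eq -mul_mx_scalar -mulmxDr mulVWal.
by rewrite raddfB/= mxtrace1 mxtraceZ.
Qed.

(** In the derivative of [V], the term in [E] contributes [v u], the term in [E^T] contributes [w2],
    and the variation of the ridge [c t] contributes [2 c w2]. This is the origin of the constant
    [2 c + 1] in the weight [a]. *)
Lemma div_der_V_Y :
  \sum_i \sum_j (der_V (der_W (delta_mx i j)) *m Y) i j = - v * u - (2 * c + 1) * w2.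
Proof.
have entry i j : (der_V (der_W (delta_mx i j)) *m Y) i j =
    - (V *m delta_mx i j *m (Cn *m Y^T *m P *m V *m Y)) i j
    - (V *m Y *m (delta_mx i j)^T *m (P *m V *m Y)) i j
    - c * (\tr (der_W (delta_mx i j)) * (V *m V *m Y) i j).
  set E := delta_mx i j.
  have -> : der_V (der_W E) *m Y = - (V *m E *m (Cn *m Y^T *m P *m V *m Y))
     - (V *m Y *m E^T *m (P *m V *m Y)) - (c * \tr (der_W E)) *: (V *m V *m Y).
    rewrite /der_V mulNmx mulmxDr !mulmxDl opprD mul_mx_scalar -!scalemxAl.
    congr (_ - _); rewrite -opprD; congr (- _).
    rewrite /der_W mulmxDl mulmxDr !mulmxDl trmx_mul CnT !mulmxA; congr (_ + _).
    by rewrite -[V *m Y *m Cn]mulmxA YCn.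
  by rewrite !mxE mulrA.
under eq_bigr do under eq_bigr do rewrite entry.
under eq_bigr do rewrite !big_split/= !sumrN -mulr_sumr.
rewrite !big_split/= !sumrN -mulr_sumr div_mulmx div_mulmx_tr.
rewrite (@delta_sum_der_W (fun w => \tr w)); last 2 first.
- by move=> w w'; rewrite mxtraceD.
- by move=> a w; rewrite mxtraceZ.
rewrite der_W_shrunk; last by rewrite trmx_mul mulmxA mulPV -mulmxA mulPV mulmxA.
rewrite mxtraceD [\tr (W *m _)]mxtrace_mulC -/w2.
have -> : \tr (Cn *m Y^T *m P *m V *m Y) = u.
  rewrite mxtrace_mulC !mulmxA YCn -mxtrace_mulC.
  by rewrite !mulmxA /u !mulmxA.
have -> : \tr ((V *m Y)^T *m (P *m V *m Y)) = w2.
  rewrite trmx_mul -!mulmxA [V^T *m _]mulmxA -mulPV mxtrace_mulC -!mulmxA.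
  by rewrite mxtrace_mulC /w2 !mulmxA.
rewrite /v; ring.
Qed.

Lemma diagonalized_der_V w g : diagonalized toC U w g ->
  diagonalized toC U (der_V w) (fun i => - (z i * (g i + c * \tr w) * z i)).
Proof.
move=> hw; apply: diagonalizedN.
exact: (diagonalizedM Uu (diagonalizedM Uu diagonalized_V
  (diagonalizedD hw (diagonalized_scalar toC Uu _))) diagonalized_V).
Qed.

Lemma trV_sum : v = \sum_i z i.
Proof. exact: (diagonalized_trace Uu diagonalized_V). Qed.

Lemma trVW_sum : u = \sum_i z i * lam i.
Proof. exact: (diagonalized_trace Uu (diagonalizedM Uu diagonalized_V dW)). Qed.

Lemma trVVW_sum : w2 = \sum_i z i * z i * lam i.
Proof.
exact: (diagonalized_trace Uu
  (diagonalizedM Uu (diagonalizedM Uu diagonalized_V diagonalized_V) dW)).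
Qed.

Lemma der_trE w g (f := fun i => - (z i * (g i + c * \tr w) * z i)) :
  diagonalized toC U w g ->
  [/\ der_trV w = \sum_i f i, der_trVW w = \sum_i (f i * lam i + z i * g i)
    & der_trVVW w = \sum_i (f i * z i * lam i + z i * f i * lam i + z i * z i * g i)].
Proof.
move=> hw; have hV := diagonalized_V; have hdV := diagonalized_der_V hw.
split; apply: (diagonalized_trace Uu); first exact: hdV.
- exact: (diagonalizedD (diagonalizedM Uu hdV dW) (diagonalizedM Uu hV hw)).
- apply: diagonalizedD; last exact: (diagonalizedM Uu (diagonalizedM Uu hV hV) hw).
  apply: diagonalizedD; first exact: (diagonalizedM Uu (diagonalizedM Uu hdV hV) dW).
  exact: (diagonalizedM Uu (diagonalizedM Uu hV hdV) dW).
Qed.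

(* Weights are homogeneous of degree 0 and [u] is too, so derivatives in the radial
   direction [Y], for which [der_W Y = W + W], vanish. *)
Lemma der_radial : w2 != 0 -> der_trVW (W + W) = 0 /\ der_a (W + W) = 0.
Proof.
move=> w0; have [dvE duE dwE] := der_trE (diagonalizedD dW dW).
have fE i : - (z i * (lam i + lam i + c * \tr (W + W)) * z i) = - 2 * z i.
  rewrite mxtraceD; have -> : lam i + lam i + c * (t + t) = 2 * (lam i + al) by ring.
  by field; exact: lam_al.
split.
  by rewrite duE big1// => i _; rewrite fE; ring.
have dv : der_trV (W + W) = - 2 * v.
  by rewrite dvE trV_sum [RHS]mulr_sumr; apply: eq_bigr => i _; rewrite fE.
have dw : der_trVVW (W + W) = - 2 * w2.
  rewrite dwE trVVW_sum [RHS]mulr_sumr; apply: eq_bigr => i _; rewrite fE; ring.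
rewrite /der_a /der_N dv dw mxtraceD /N; field; exact: w0.
Qed.

Lemma der_b_radial : w2 != 0 -> der_b (W + W) = 0.
Proof. by move=> w0; rewrite /der_b; case: der_radial => // -> ->; ring. Qed.

Lemma div_shrink : w2 != 0 -> t != 0 ->
  \sum_i \sum_j der_shrink (delta_mx i j) i j
  = der_a (V *m W + W *m V) + weight_a ^+ 2 * w2 + weight_b * kappa / t.
Proof.
move=> w0 t0.
have entry i j : der_shrink (delta_mx i j) i j =
    der_a (der_W (delta_mx i j)) * (V *m Y) i j
    + weight_a * (der_V (der_W (delta_mx i j)) *m Y) i j
    + t^-1 * (der_b (der_W (delta_mx i j)) * Y i j)
    - weight_b / t ^+ 2 * (\tr (der_W (delta_mx i j)) * Y i j)
    + weight_a * (V *m delta_mx i j *m Cn) i j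
    + weight_b / t * (1%:M *m delta_mx i j *m Cn) i j.
  set E := delta_mx i j.
  rewrite /der_shrink mul1mx !mulmxDl !mul_scalar_mx -!scalemxAl.
  rewrite -[V *m E *m Cn]mulmxA.
  set B1 := V *m Y; set B2 := der_V _ *m Y; set B3 := V *m (E *m Cn); set B4 := E *m Cn.
  rewrite !mxE; ring.
under eq_bigr do under eq_bigr do rewrite entry.
under eq_bigr do rewrite !big_split/= sumrN -!mulr_sumr.
rewrite !big_split/= sumrN -!mulr_sumr div_der_V_Y !div_mulmx mxtrace1 trCn.
rewrite (@delta_sum_der_W der_a der_aD der_aZ) (@delta_sum_der_W der_b der_bD der_bZ).
rewrite (@delta_sum_der_W (fun w => \tr w)); last 2 first.
- by move=> w w'; rewrite mxtraceD.
- by move=> a w; rewrite mxtraceZ.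
rewrite der_W_Y der_b_radial// der_W_shrunk ?mulPV// mxtraceD.
have -> : \tr V = v by [].
(* The right side is [div (V Y)], namely [(n - 1) v - v u - (2 c + 1) w2] with [u = p - al v]. *)
have aw : weight_a * w2 = A1 * v + al * v ^+ 2 - (2 * c + 1) * w2.
  by rewrite /weight_a /N; field; exact: w0.
have -> : weight_a ^+ 2 * w2 = weight_a * (weight_a * w2) by ring.
rewrite aw {1}/u trVW_trV /kappa /A1; field; exact: t0.
Qed.

Lemma norm_shrink :
  \tr (shrink^T *m P *m shrink)
  = weight_a ^+ 2 * w2 + 2 * weight_a * (weight_b / t) * u + (weight_b / t) ^+ 2 * t.
Proof.
pose T := weight_a *: V + (weight_b / t)%:M.
have PT' : T^T *m P = P *m T.
  rewrite /T [(_ + _)^T]linearD/= linearZ/= tr_scalar_mx mulmxDl mulmxDr.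
  by rewrite -scalemxAl -scalemxAr mulPV mul_mx_scalar mul_scalar_mx.
have -> : \tr (shrink^T *m P *m shrink) = \tr (T *m T *m W).
  rewrite /shrink -/T trmx_mul -[Y^T *m _ *m P]mulmxA PT' mxtrace_mulC.
  by rewrite !mulmxA mxtrace_mulC !mulmxA.
have hT : diagonalized toC U T (fun i => weight_a * z i + weight_b / t).
  apply: diagonalizedD; last exact: diagonalized_scalar.
  by rewrite -mul_scalar_mx; apply: diagonalizedM diagonalized_V => //; exact: diagonalized_scalar.
rewrite (diagonalized_trace Uu (diagonalizedM Uu (diagonalizedM Uu hT hT) dW)).
have sq (x y : R) (f : 'I_p -> R) : \sum_i (x * f i + y) * (x * f i + y) * lam i
    = x ^+ 2 * \sum_i f i * f i * lam i + 2 * x * y * \sum_i f i * lam i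
      + y ^+ 2 * \sum_i lam i.
  rewrite !mulr_sumr -!big_split; apply: eq_bigr => i _ /=; ring.
rewrite sq -trVW_sum -trVVW_sum -(diagonalized_trace Uu dW); ring.
Qed.

(** The weight [b] is chosen so that [kappa = b + u a]; the cross term [2 a b u / t] of the squared
    norm then cancels against the divergence. *)
Lemma risk_difference : w2 != 0 -> t != 0 ->
  \tr (shrink^T *m P *m shrink) - 2 * \sum_i \sum_j der_shrink (delta_mx i j) i j
  = - (weight_a ^+ 2 * w2 + 2 * der_a (V *m W + W *m V)) - weight_b ^+ 2 / t.
Proof.
move=> w0 t0; rewrite norm_shrink div_shrink//.
have uaE : kappa = weight_b + u * weight_a by rewrite /weight_b subrK.
rewrite uaE; field; exact: t0.
Qed.

(** The left side is [2 tr ((a V + b / t) W) = 2 (a u + b)], a constant by the choice of [b]; its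
    sign decides the sign of the cutoff term. *)
Lemma shrink_radial : t != 0 ->
  \sum_i \sum_j \tr (der_W (delta_mx i j)) * shrink i j = 2 * kappa.
Proof.
move=> t0; rewrite (@delta_sum_der_W (fun w => \tr w)); last 2 first.
- by move=> w w'; rewrite mxtraceD.
- by move=> a w; rewrite mxtraceZ.
rewrite /shrink der_W_shrunk; last first.
  rewrite [(_ + _)^T]linearD/= linearZ/= tr_scalar_mx mulmxDl mulmxDr.
  by rewrite -scalemxAl -scalemxAr mulPV mul_mx_scalar mul_scalar_mx.
rewrite mxtraceD [\tr (W *m _)]mxtrace_mulC mulmxDl mul_scalar_mx -scalemxAl.
rewrite mxtraceD !mxtraceZ /weight_b -/u; field; exact: t0.
Qed.

End Divergence.

(** * The centering matrix *)

Section Centering.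
Variables (R : realType) (p n : nat).
Hypothesis n_gt0 : (0 < n)%N.

Definition centering : 'M[R]_n := 1%:M - const_mx n%:R^-1.
Local Notation Cn := centering.

Lemma n_neq0 : n%:R != 0 :> R.
Proof. by rewrite pnatr_eq0 -lt0n. Qed.

Lemma centeringE (X : 'M[R]_(p, n)) : X - Xbar X = X *m Cn.
Proof.
rewrite /centering mulmxBr mulmx1; congr (_ - _).
by apply/matrixP => i j; rewrite !mxE mulr_sumr; apply: eq_bigr => k _; rewrite mxE mulrC.
Qed.

Lemma centering_tr : Cn^T = Cn.
Proof. by rewrite /centering linearB/= trmx1 trmx_const. Qed.

Lemma centering_row_sum i : \sum_k Cn i k = 0.
Proof.
rewrite (eq_bigr (fun k => (i == k)%:R - n%:R^-1)) => [|k _]; last by rewrite !mxE.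
rewrite sumrB sumr_const card_ord -[_ *+ n]mulr_natl mulfV ?n_neq0//.
rewrite (bigD1 i)//= big1 => [|k ki]; last by rewrite eq_sym (negbTE ki).
by rewrite eqxx addr0 subrr.
Qed.

Lemma centering_const (q : nat) (a : R) : Cn *m const_mx a = 0 :> 'M[R]_(n, q).
Proof.
apply/matrixP => i j; rewrite [LHS]mxE [RHS]mxE.
rewrite (eq_bigr (fun k => Cn i k * a)) => [|k _]; last by rewrite [const_mx _ _ _]mxE.
by rewrite -mulr_suml centering_row_sum mul0r.
Qed.

Lemma centering_idem : Cn *m Cn = Cn.
Proof. by rewrite {2}/centering mulmxBr mulmx1 centering_const subr0. Qed.

Lemma centering_trace : \tr Cn = n%:R - 1.
Proof.
rewrite /centering raddfB/= mxtrace1; congr (_ - _).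
rewrite /mxtrace; under eq_bigr do rewrite mxE.
by rewrite sumr_const card_ord -[LHS]mulr_natl mulfV// n_neq0.
Qed.

Lemma centering_rank : (\rank Cn <= n.-1)%N.
Proof.
rewrite -ltnS prednK// ltn_neqAle rank_leq_row andbT; apply/negP => h.
have Cu : Cn \in unitmx by rewrite -row_full_unit.
have := centering_const 1 1; move=> /(congr1 (mulmx (invmx Cn))); rewrite mulKmx// mulmx0.
move=> /matrixP/(_ (Ordinal n_gt0) 0); rewrite !mxE => /eqP.
by rewrite oner_eq0.
Qed.

End Centering.

(** * Spectrum and lower bounds for the scatter matrix *)

Section Scatter.
Variables (R : realType) (p n : nat) (S : 'M[R]_p) (c : R).
Hypotheses (n_gt0 : (0 < n)%N) (p_gt0 : (0 < p)%N) (Spd : posdef S) (c0 : 0 < c).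
Local Notation toC := (real_complex R).
Local Notation M := 'M[R]_(p, n).
Implicit Types X : M.
Local Notation P := (invmx S).

(** With [S^-1 = Q^T Q], conjugation by [Q] turns [W] into the Gram matrix of [Q Y]. The rank bound
    [n - 1] comes from the centering. *)
Lemma scatter_spectrum X : exists (U : 'M[R[i]]_p) lam,
  [/\ U \in unitmx, forall i, 0 <= lam i, diagonalized toC U (Wmat S X) lam
    & (#|[set i | lam i != 0%R]%SET| <= minn p n.-1)%N].
Proof.
have [Q Qu PE] := posdef_gram (posdef_inv Spd).
have [U [lam [Uu lam0 h]]] := gram_diagonalized (Q *m (X - Xbar X)).
have h2 : diagonalized toC U (Q *m Wmat S X *m invmx Q) lam.
  suff -> : Q *m Wmat S X *m invmx Q = Q *m (X - Xbar X) *m (Q *m (X - Xbar X))^T by [].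
  by rewrite /Wmat PE trmx_mul !mulmxA mulmxK.
have hW := diagonalized_conj Uu Qu h2.
have Uu' : U *m map_mx toC Q \in unitmx by rewrite unitmx_mul Uu map_unitmx.
exists (U *m map_mx toC Q), lam; split; [exact: Uu'|exact: lam0|exact: hW|].
apply: leq_trans (diagonalized_rank Uu' hW) _; rewrite leq_min rank_leq_row/=.
apply: (leq_trans _ (centering_rank R n_gt0)).
rewrite /Wmat centeringE trmx_mul -!mulmxA.
apply: leq_trans (mxrankM_maxr _ _) _; exact: mxrankM_maxl.
Qed.

Lemma trW_ge0 X : 0 <= \tr (Wmat S X).
Proof.
have [U [lam [Uu lam0 h _]]] := scatter_spectrum X.
by rewrite (diagonalized_trace Uu h); apply: sumr_ge0 => i _; exact: lam0.
Qed.

Lemma Wmat_eq0 X : \tr (Wmat S X) = 0 -> Wmat S X = 0.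
Proof.
have [U [lam [Uu lam0 h _]]] := scatter_spectrum X.
rewrite (diagonalized_trace Uu h) => /eqP; rewrite psumr_eq0; last by move=> i _; exact: lam0.
move=> /allP l0; have hD : \row_i toC (lam i) = 0.
  by apply/rowP => i; rewrite !mxE; have /eqP -> := l0 i (mem_index_enum i); rewrite rmorph0.
have : map_mx toC (Wmat S X) = map_mx toC 0.
  rewrite h hD map_mx0; have -> : diag_mx 0 = 0 :> 'M[R[i]]_p.
    by apply/matrixP => i j; rewrite !mxE mul0rn.
  by rewrite mulmx0 mul0mx.
by move/map_mx_inj.
Qed.

(** The formula holds for every [X], as [C1mx_inv] demands: [W + alpha] is singular only at [t = 0],
    where it is the zero matrix, and there both sides are 0 by the conventions for [invmx] and
    [0^-1]. *)
Lemma Vmat_adj X : Vmat c S X = (\det (Wmat S X + (alpha_hat c S X)%:M))^-1 *: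
  \adj (Wmat S X + (alpha_hat c S X)%:M).
Proof.
rewrite /Vmat /invmx; case: ifPn => // nu.
suff -> : Wmat S X + (alpha_hat c S X)%:M = 0.
  by rewrite -{2}(scale0r 1%:M) detZ expr0n gtn_eqF// mul0r invr0 scale0r.
have [U [lam [Uu lam0 h _]]] := scatter_spectrum X.
have [t0|tn0] := eqVneq (\tr (Wmat S X)) 0.
  by rewrite /alpha_hat t0 Wmat_eq0// mulr0 raddf0 addr0.
case/negP: nu; have al0 : 0 < alpha_hat c S X.
  by rewrite mulr_gt0// lt_neqAle eq_sym tn0 trW_ge0.
apply: (diagonalized_unit Uu (diagonalizedD h (diagonalized_scalar toC Uu _))) => i.
by rewrite gt_eqF// ltr_wpDl.
Qed.

Section Nondegenerate.
Variable X : M.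
Hypothesis t0 : 0 < \tr (Wmat S X).

Let al0 : 0 < alpha_hat c S X. Proof. exact: mulr_gt0. Qed.

Lemma det_lower_bound : alpha_hat c S X ^+ p <= \det (Wmat S X + (alpha_hat c S X)%:M).
Proof.
have [U [lam [Uu lam0 h _]]] := scatter_spectrum X.
rewrite (diagonalized_det Uu (diagonalizedD h (diagonalized_scalar toC Uu _))).
rewrite -[X in _ ^+ X]card_ord -prodr_const; apply: ler_prod => i _.
by rewrite (ltW al0) lerDr lam0.
Qed.

(** Every [lam i + alpha] is at most [t (1 + c)], and the [lam i] add up to [t]. Hence the inverse
    of this trace, which occurs in [a_S], has polynomial growth. *)
Lemma trVVW_lower_bound : (\tr (Wmat S X) * (1 + c) ^+ 2)^-1
  <= \tr (Vmat c S X *m Vmat c S X *m Wmat S X).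
Proof.
have [U [lam [Uu lam0 h _]]] := scatter_spectrum X.
have la0 i : 0 < lam i + alpha_hat c S X by rewrite ltr_wpDl.
have hV := diagonalized_inv Uu (diagonalizedD h (diagonalized_scalar toC Uu (alpha_hat c S X)))
  (fun i => lt0r_neq0 (la0 i)).
rewrite (diagonalized_trace Uu (diagonalizedM Uu (diagonalizedM Uu hV hV) h)).
have t_gt0 := t0; set t := \tr (Wmat S X) in t_gt0 *; have tE : t = \sum_i lam i by rewrite /t (diagonalized_trace Uu h).
have c1 : 0 < 1 + c by rewrite addr_gt0.
have lt_ i : (lam i + alpha_hat c S X) <= t * (1 + c).
  rewrite mulrDr mulr1 [t * c]mulrC lerD2r tE (bigD1 i)//= lerDl.
  by apply: sumr_ge0 => j _; exact: lam0.
apply: (@le_trans _ _ (\sum_i (t * (1 + c))^-1 * (t * (1 + c))^-1 * lam i)).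
  rewrite -mulr_sumr -tE le_eqVlt; apply/orP; left; apply/eqP.
  by field; rewrite !gt_eqF.
apply: ler_sum => i _; rewrite ler_wpM2r//.
by apply: ler_pM; rewrite ?invr_ge0 ?lef_pV2 ?posrE ?mulr_gt0// ?ltW// mulr_gt0.
Qed.

Lemma trVVW_gt0 : 0 < \tr (Vmat c S X *m Vmat c S X *m Wmat S X).
Proof.
apply: lt_le_trans trVVW_lower_bound.
by rewrite invr_gt0 mulr_gt0// exprn_gt0// addr_gt0.
Qed.

End Nondegenerate.
End Scatter.

Section DriftSums.
Variables (R : fieldType) (p : nat) (z lam : 'I_p -> R) (c u : R).
(** [g] lists the eigenvalues of [V W + W V], the derivative of [W] along [V Y], whose trace is
    [2 u]; [f] lists those of the resulting derivative of [V]. *)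
Let g i := z i * lam i + lam i * z i.
Let f i := - (z i * (g i + c * (2 * u)) * z i).

Lemma drift_sum_trV : \sum_i f i
  = - 2 * \sum_i z i * z i * z i * lam i - 2 * c * u * \sum_i z i * z i.
Proof. rewrite !mulr_sumr -sumrB; apply: eq_bigr => i _; rewrite /f /g; ring. Qed.

Lemma drift_sum_trVVW :
  \sum_i (f i * z i * lam i + z i * f i * lam i + z i * z i * g i)
  = - 4 * \sum_i z i * z i * z i * z i * lam i * lam i
    + (2 - 4 * c * u) * \sum_i z i * z i * z i * lam i.
Proof. rewrite !mulr_sumr -big_split; apply: eq_bigr => i _; rewrite /f /g /=; ring. Qed.

End DriftSums.

(** * The pointwise risk inequality *)

Section ShrinkCalculus.
Variables (R : realType) (p n : nat) (S : 'M[R]_p) (c : R).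
Hypotheses (n_gt0 : (0 < n)%N) (p_gt0 : (0 < p)%N) (Spd : posdef S) (c0 : 0 < c).
Local Notation M := 'M[R]_(p, n).
Implicit Types X E : M.
Local Notation P := (invmx S).
Local Notation Cn := (centering R n).
Local Notation Y X := (X - Xbar X).
Local Notation W X := (Wmat S X).
Local Notation t X := (\tr (Wmat S X)).
Local Notation V X := (Vmat c S X).
Local Notation dW X E := (der_W P Cn (Y X) E).

Definition shrinkage X : M := shrink P (Y X) c (V X).
Definition der_shrinkage E X : M := der_shrink P Cn (Y X) c (V X) E.

Lemma RLS_S_shrinkage X : RLS_S c S X = X - shrinkage X.
Proof. by []. Qed.

Let PT : P^T = P. Proof. by case: (posdef_inv Spd). Qed.
Let CnT : Cn^T = Cn. Proof. exact: centering_tr. Qed.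
Let YCn X : Y X *m Cn = Y X.
Proof. by rewrite centeringE -mulmxA centering_idem. Qed.
Let trCn : \tr Cn = n%:R - 1. Proof. exact: centering_trace. Qed.

Section Pointwise.
Variable X : M.
Hypothesis t0 : 0 < t X.
Let tn0 : t X != 0. Proof. by rewrite gt_eqF. Qed.

Lemma shrinkage_radial :
  \sum_i \sum_j \tr (dW X (delta_mx i j)) * shrinkage X i j
  = 2 * ((n%:R - 1) * p%:R - 2).
Proof.
have [U [lam [Uu lam0 h _]]] := scatter_spectrum n_gt0 Spd X.
have la0 i : lam i + c * t X != 0 by rewrite gt_eqF// ltr_wpDl// mulr_gt0.
exact: (shrink_radial PT (YCn X) Uu h la0 erefl tn0).
Qed.

Lemma shrinkage_risk_difference :
  let m : R := (minn p n.-1)%:R in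
  let A0 : R := (maxn p n.-1)%:R - (minn p n.-1)%:R in
  (1 < n)%N ->
  0 <= (m * A0 + m ^+ 2 - 16 + 4 / m) * c ^+ 2
       + ((m + 1) * A0 + m ^+ 2 - 8 * m - 18) * c + A0 - 14 ->
  (\tr ((shrinkage X)^T *m P *m shrinkage X)
   <= 2 * \sum_i \sum_j der_shrinkage (delta_mx i j) X i j) : Prop.
Proof.
move=> m A0 n1 cond.
have [U [lam [Uu lam0 h card_lam]]] := scatter_spectrum n_gt0 Spd X.
have la0 i : lam i + c * t X != 0 by rewrite gt_eqF// ltr_wpDl// mulr_gt0.
have w0 := trVVW_gt0 n_gt0 Spd c0 t0.
have [J KJ cJ] : exists2 J : {set 'I_p},
    ([set i | lam i != 0%R]%SET \subset J)%SET & #|J| = minn p n.-1.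
  by apply: superset_card; rewrite card_lam card_ord geq_minl.
have lamJ i : i \notin J -> lam i = 0.
  move=> iJ; apply/eqP; apply: contraNT iJ => li; apply: (fintype.subsetP KJ).
  by rewrite inE.
have J0 : (0 < #|J|)%N by rewrite cJ leq_min p_gt0 -ltnS prednK.
rewrite -subr_le0 (risk_difference PT CnT (YCn X) trCn Uu h la0 erefl _ tn0) ?gt_eqF//.
rewrite -opprD oppr_le0 addr_ge0//; last by rewrite divr_ge0 ?sqr_ge0// ltW.
have tE := diagonalized_trace Uu h.
have := @spectral_drift_ge0 R p n J lam c n_gt0 cJ J0 lam0 lamJ.
rewrite -tE cJ => /(_ t0 c0 cond).
have hV := diagonalized_V Uu h la0 erefl.
have hw := diagonalizedD (diagonalizedM Uu hV h) (diagonalizedM Uu h hV).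
have [dv _ dw] := der_trE Uu h la0 erefl hw.
have tr_w : \tr (V X *m W X + W X *m V X) = 2 * \sum_i (lam i + c * t X)^-1 * lam i.
  by rewrite mxtraceD [\tr (W X *m _)]mxtrace_mulC (trVW_sum Uu h la0 erefl) mulr2n; ring.
rewrite tr_w drift_sum_trV in dv; rewrite tr_w drift_sum_trVVW in dw.
rewrite /weight_a /der_a /der_N dv dw tr_w (trV_sum Uu h la0 erefl) (trVVW_sum Uu h la0 erefl).
congr (0 <= _ + 2 * ((_ + _ + _) / _ - _)).
ring.
Qed.

End Pointwise.
End ShrinkCalculus.

(** * Regularity of the shrinkage away from the degenerate set *)

Section ShrinkC1.
Variables (R : realType) (p n : nat) (S : 'M[R]_p) (c : R).
Hypotheses (n_gt0 : (0 < n)%N) (p_gt0 : (0 < p)%N) (Spd : posdef S) (c0 : 0 < c).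
Local Notation M := 'M[R]_(p, n).
Implicit Types X E : M.
Local Notation P := (invmx S).
Local Notation Cn := (centering R n).
Local Notation Y X := (X - Xbar X).
Local Notation W X := (Wmat S X).
Local Notation t X := (\tr (Wmat S X)).
Local Notation V X := (Vmat c S X).
Local Notation dW E X := (der_W P Cn (Y X) E).

Variable tau : M -> R.
Hypothesis tau_ge1 : forall X, 1 <= tau X.
Hypothesis tau_coord : forall i j, exists B, forall X, `|X i j| <= B * tau X.

Section AnyDomain.
Variable D : set M.

Lemma C1mx_id : C1mx tau D (fun X => X) (fun E X => E).
Proof.
move=> i j; split.
- by move=> u X _ _; apply.
- by have [B hB] := tau_coord i j; exists B, 1%N => X _; rewrite expr1.
- by move=> E; exact: cont_in_cst.
- by move=> E; exact: poly_bounded_cst.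
- move=> E X _.
  have -> : (fun s : R => (X + s *: E) i j) = (fun s => X i j + s * E i j).
    by apply/funext => s; rewrite !mxE.
  have h := is_deriveD (is_derive_cst (X i j) (0 : R) 1)
    (is_deriveM (is_derive_id (0 : R) 1) (is_derive_cst (E i j) (0 : R) 1)).
  apply: is_derive_eq h _.
  by rewrite /GRing.scale/= mulr0 !add0r mulr1.
Qed.

Lemma C1mx_centered : C1mx tau D (fun X => Y X) (fun E X => E *m Cn).
Proof.
apply: (eq_C1mx _ _ (C1mxM tau_ge1 C1mx_id (C1mx_cst tau D Cn))) => [X|E X _].
  by rewrite centeringE.
by rewrite mulmx0 addr0.
Qed.

Lemma C1mx_Wmat : C1mx tau D (fun X => W X) (fun E X => dW E X).
Proof.
have h := C1mxM tau_ge1 (C1mxM tau_ge1 C1mx_centered (C1mx_tr C1mx_centered))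
  (C1mx_cst tau D P).
by apply: (eq_C1mx _ _ h) => // E X _; rewrite mulmx0 addr0.
Qed.

Lemma C1_trW : C1 tau D (fun X => t X) (fun E X => \tr (dW E X)).
Proof. exact: C1_trace C1mx_Wmat. Qed.

End AnyDomain.

Variable delta : R.
Hypothesis delta0 : 0 < delta.
Local Notation D := [set X : M | delta < t X].

Let tgt0 X : D X -> 0 < t X.
Proof. by rewrite /=; exact: lt_trans. Qed.

(** Where [t > delta], the determinant of [W + alpha] is at least [(c delta)^p], so its inverse is
    bounded. *)
Lemma C1mx_Vmat : C1mx tau D (fun X => V X) (fun E X => der_V c (V X) (dW E X)).
Proof.
have hal := C1Z tau_ge1 c (C1_trW D).
have hM := C1mxD tau_ge1 (C1mx_Wmat D) (C1mx_scalar hal (r := p)).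
have al0 X : D X -> 0 < alpha_hat c S X by move=> /tgt0 t0; rewrite mulr_gt0.
have detM X : D X -> (c * delta) ^+ p <= \det (W X + (c * t X)%:M).
  move=> DX; apply: le_trans (det_lower_bound n_gt0 Spd c0 (tgt0 DX)).
  by rewrite lerXn2r ?nnegrE ?mulr_ge0 ?ler_pM2l// ltW// ?tgt0.
have cd0 : 0 < (c * delta) ^+ p by rewrite exprn_gt0// mulr_gt0.
apply: (eq_C1mx _ _ (C1mx_inv tau_ge1 hM (V := fun X => V X) _ _ _)) => //.
- by move=> X; exact: Vmat_adj.
- by move=> X DX; rewrite unitmxE unitfE gt_eqF// (lt_le_trans cd0)// detM.
- exists ((c * delta) ^+ p)^-1, 0%N => X DX; rewrite expr0 mulr1.
  have d0 := lt_le_trans cd0 (detM X DX).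
  by rewrite ger0_norm ?invr_ge0 ?(ltW d0)// lef_pV2// detM.
Qed.

Lemma C1_trW_inv : C1 tau D (fun X => (t X)^-1) (fun E X => - \tr (dW E X) / t X ^+ 2).
Proof.
apply: (C1V (C1_trW D)) => [X /tgt0 t0|]; first by rewrite gt_eqF.
exists delta^-1, 0%N => X DX; rewrite expr0 mulr1.
have t0 := tgt0 DX; rewrite ger0_norm ?invr_ge0 ?(ltW t0)// lef_pV2 ?posrE//.
exact: ltW.
Qed.

Local Notation w2 X := (\tr (V X *m V X *m W X)).

Lemma C1_trVVW : C1 tau D (fun X => w2 X)
  (fun E X => der_trVVW P (Y X) c (V X) (dW E X)).
Proof.
have h := C1_trace tau_ge1 (C1mxM tau_ge1 (C1mxM tau_ge1 C1mx_Vmat C1mx_Vmat) (C1mx_Wmat D)).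
by apply: (eq_C1 _ _ h) => // E X _; rewrite mulmxDl.
Qed.

Lemma C1_trVVW_inv : C1 tau D (fun X => (w2 X)^-1)
  (fun E X => - der_trVVW P (Y X) c (V X) (dW E X) / w2 X ^+ 2).
Proof.
apply: (C1V C1_trVVW) => [X /tgt0 t0|].
  by rewrite gt_eqF// trVVW_gt0.
have [_ bt _ _ _] := C1_trW D.
have [B [k h]] := poly_boundedM bt (poly_bounded_cst tau D ((1 + c) ^+ 2)).
exists B, k => X DX; have t0 := tgt0 DX; apply: le_trans (h X DX).
have w0 := trVVW_gt0 n_gt0 Spd c0 t0.
have tc0 : 0 < t X * (1 + c) ^+ 2 by rewrite mulr_gt0// exprn_gt0// addr_gt0.
rewrite ger0_norm ?invr_ge0 ?(ltW w0)// ger0_norm ?(ltW tc0)//.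
by rewrite -[leRHS]invrK lef_pV2 ?posrE ?invr_gt0// trVVW_lower_bound.
Qed.

Lemma C1_weight_a : C1 tau D (fun X => weight_a P (Y X) c (V X))
  (fun E X => der_a P (Y X) c (V X) (dW E X)).
Proof.
have hv := C1_trace tau_ge1 C1mx_Vmat.
have hal := C1Z tau_ge1 c (C1_trW D).
have hN := C1D tau_ge1 (C1Z tau_ge1 (n%:R - p%:R - 1) hv)
  (C1M tau_ge1 hal (C1M tau_ge1 hv hv)).
have h := C1D tau_ge1 (C1M tau_ge1 hN C1_trVVW_inv) (C1_cst tau D (- (2 * c + 1))).
apply: (eq_C1 _ _ h) => [X|E X DX]; rewrite /weight_a /der_a /der_N /der_trV.
  by rewrite expr2.
have w0 := trVVW_gt0 n_gt0 Spd c0 (tgt0 DX).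
by field; rewrite gt_eqF.
Qed.

Lemma C1_weight_b : C1 tau D (fun X => weight_b P (Y X) c (V X))
  (fun E X => der_b P (Y X) c (V X) (dW E X)).
Proof.
have hu := C1_trace tau_ge1 (C1mxM tau_ge1 C1mx_Vmat (C1mx_Wmat D)).
have h := C1D tau_ge1 (C1_cst tau D ((n%:R - 1) * p%:R - 2))
  (C1Z tau_ge1 (-1) (C1M tau_ge1 hu C1_weight_a)).
apply: (eq_C1 _ _ h) => [X|E X DX]; rewrite /weight_b /der_b /der_trVW.
  by rewrite mulN1r.
by rewrite add0r mulN1r.
Qed.

Lemma C1mx_shrinkage : C1mx tau D (fun X => shrinkage S c X)
  (fun E X => der_shrinkage S c E X).
Proof.
have hb := C1M tau_ge1 C1_weight_b C1_trW_inv.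
have h := C1mxM tau_ge1 (C1mxD tau_ge1 (C1mxZ tau_ge1 C1_weight_a C1mx_Vmat)
  (C1mx_scalar hb (r := p))) (C1mx_centered D).
apply: (eq_C1mx _ _ h) => // E X DX; rewrite /der_shrinkage /der_shrink.
by congr ((_ + _%:M) *m _ + _); rewrite mulrA mulrN; congr (_ + _); ring.
Qed.

End ShrinkC1.

(** * Cutoff near the degenerate set *)

Section Cutoff.
Variable R : realType.
Implicit Types (e x : R).

(** With [g = max(0, x - e)] this is [g^2 / (g^2 + e)]. It takes values in [[0, 1]], is continuously
    differentiable because [g^2] is, and tends to 1 at each [x > 0] as [e] tends to 0; [e] is both
    threshold and scale. *)
Definition cutoff e x : R :=
  (Num.max 0 (x - e)) ^+ 2 / ((Num.max 0 (x - e)) ^+ 2 + e).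
Definition dcutoff e x : R :=
  2 * Num.max 0 (x - e) * e / ((Num.max 0 (x - e)) ^+ 2 + e) ^+ 2.

Lemma cutoff_eq0 e x : x <= e -> cutoff e x = 0.
Proof. by move=> xe; rewrite /cutoff max_l ?subr_le0// expr0n mul0r. Qed.

Lemma dcutoff_eq0 e x : x <= e -> dcutoff e x = 0.
Proof. by move=> xe; rewrite /dcutoff max_l ?subr_le0// mulr0 !mul0r. Qed.

Let max_ge0 (a : R) : 0 <= Num.max 0 a. Proof. by rewrite le_max lexx. Qed.

Let den_gt0 e x : 0 < e -> 0 < (Num.max 0 (x - e)) ^+ 2 + e.
Proof. by move=> e0; rewrite ltr_wpDl// sqr_ge0. Qed.

Lemma cutoff_ge0 e x : 0 < e -> 0 <= cutoff e x.
Proof. by move=> e0; rewrite divr_ge0 ?sqr_ge0// ltW// den_gt0. Qed.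

Lemma cutoff_le1 e x : 0 < e -> cutoff e x <= 1.
Proof. by move=> e0; rewrite ler_pdivrMr ?den_gt0// mul1r lerDl ltW. Qed.

Lemma dcutoff_ge0 e x : 0 < e -> 0 <= dcutoff e x.
Proof. by move=> e0; rewrite divr_ge0 ?sqr_ge0// !mulr_ge0// ltW. Qed.

Lemma dcutoff_le e x : 0 < e -> `|dcutoff e x| <= 2 / e * (`|x| + e).
Proof.
move=> e0; rewrite ger0_norm ?dcutoff_ge0// /dcutoff.
set g := Num.max 0 (x - e).
have g0 : 0 <= g by exact: max_ge0.
have gx : g <= `|x| + e.
  rewrite ge_max addr_ge0 ?(ltW e0)//=; have := ler_norm x; lra.
have h : e ^+ 2 <= (g ^+ 2 + e) ^+ 2.
  by rewrite lerXn2r ?nnegrE ?addr_ge0 ?sqr_ge0 ?(ltW e0)// lerDr sqr_ge0.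
have d0 : 0 < (g ^+ 2 + e) ^+ 2 by rewrite exprn_gt0// den_gt0.
rewrite ler_pdivrMr//; apply: (@le_trans _ _ (2 / e * g * e ^+ 2)).
  by rewrite le_eqVlt; apply/orP; left; apply/eqP; field; rewrite gt_eqF.
by rewrite ler_pM ?sqr_ge0 ?mulr_ge0 ?invr_ge0 ?ler_wpM2l ?divr_ge0// ltW.
Qed.

(** A quadratic remainder bound makes [max(0, x - e)^2] differentiable at its kink by a mere case
    distinction on signs. *)
Lemma is_derive_remainder (f : R -> R) (x d : R) :
  (forall h, `|f (h + x) - f x - d * h| <= h ^+ 2) -> is_derive x 1 f d.
Proof.
move=> H.
have lim : h^-1 *: (f (h *: 1 + x) - f x) @[h --> 0^'] --> d.
  apply/cvgrPdist_le => eps eps0.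
  have : \forall h \near (0:R)^', `|h| <= eps by exact: dnbhs0_le.
  apply: filterS2 (@nbhs_dnbhs_neq _ (0:R)) => h hn0 he.
  have nh : 0 < `|h| by rewrite normr_gt0.
  rewrite [h *: 1]mulr1 /GRing.scale/=.
  have -> : d - h^-1 * (f (h + x) - f x) = - (h^-1 * (f (h + x) - f x - d * h)).
    by field.
  rewrite normrN normrM normfV ler_pdivrMl//; apply: le_trans (H h) _.
  by rewrite -real_normK ?num_real// expr2 ler_wpM2l.
by apply: DeriveDef; [apply/cvg_ex; exists d|exact/cvg_lim].
Qed.

Lemma is_derive_sqr_max e x :
  is_derive x 1 (fun x => (Num.max 0 (x - e)) ^+ 2) (2 * Num.max 0 (x - e)).
Proof.
apply: is_derive_remainder => h; set y := x - e.
have -> : h + x - e = h + y by rewrite /y addrA.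
have [h1|h1] := lerP 0 (h + y); have [h2|h2] := lerP 0 y.
- rewrite ler_norml; apply/andP; split; nra.
- rewrite ler_norml; apply/andP; split; nra.
- rewrite ler_norml; apply/andP; split; nra.
- rewrite ler_norml; apply/andP; split; nra.
Qed.

Lemma is_derive_cutoff e x : 0 < e -> is_derive x 1 (cutoff e) (dcutoff e x).
Proof.
move=> e0; have hg := is_derive_sqr_max e x.
have hd := is_deriveD hg (is_derive_cst e x 1).
have hn : ((fun x : R => (Num.max 0 (x - e)) ^+ 2) + cst e) x != 0 by rewrite gt_eqF// den_gt0.
apply: is_derive_eq (is_deriveM hg (is_deriveV hn hd)) _.
rewrite /dcutoff /GRing.scale/= /cst.
rewrite -[((fun x : R => _) + (fun=> e)) x]/((Num.max 0 (x - e)) ^+ 2 + e).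
have := den_gt0 x e0; set g := Num.max 0 (x - e) => g0.
by field; rewrite gt_eqF.
Qed.

Lemma continuous_cutoff e : 0 < e -> continuous (cutoff e).
Proof.
move=> e0 x; apply/differentiable_continuous/derivable1_diffP.
exact: (@ex_derive _ _ _ _ _ _ _ (is_derive_cutoff x e0)).
Qed.

Lemma continuous_dcutoff e : 0 < e -> continuous (dcutoff e).
Proof.
move=> e0 x.
have cg : Num.max 0 (y - e) @[y --> x] --> Num.max 0 (x - e).
  apply: (@continuous_max _ _ (fun=> 0) (fun y : R => y - e)).
    exact: cvg_cst.
  by apply: cvgB; [exact: cvg_id|exact: cvg_cst].
have cd : (Num.max 0 (y - e)) ^+ 2 + e @[y --> x] --> (Num.max 0 (x - e)) ^+ 2 + e.
  by apply: cvgD; [rewrite expr2; under eq_cvg do rewrite expr2; exact: cvgM|exact: cvg_cst].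
rewrite /dcutoff; apply: cvgM; first by apply: cvgM; [apply: cvgM => //; exact: cvg_cst|exact: cvg_cst].
apply: cvgV; first by rewrite expf_neq0// gt_eqF// den_gt0.
by rewrite expr2; under eq_cvg do rewrite expr2; exact: cvgM.
Qed.

Lemma cvg_cutoff x : 0 < x -> cutoff l.+1%:R^-1 x @[l --> \oo] --> (1 : R).
Proof.
move=> x0.
have ce : l.+1%:R^-1 @[l --> \oo] --> (0:R) by exact: cvg_harmonic.
have cg : Num.max 0 (x - l.+1%:R^-1) @[l --> \oo] --> Num.max 0 (x - 0).
  apply: (@cvg_comp _ _ _ (fun l : nat => x - l.+1%:R^-1) (fun y : R => Num.max 0 y) _ (nbhs (x - 0))).
    by apply: cvgB; [exact: cvg_cst|exact: ce].
  apply: (@continuous_max _ _ (fun=> 0) (fun y : R => y)); [exact: cvg_cst|exact: cvg_id].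
have gx : Num.max 0 (x - 0) = x by rewrite subr0 max_r// ltW.
rewrite gx in cg.
have c2 : (Num.max 0 (x - l.+1%:R^-1)) ^+ 2 @[l --> \oo] --> x ^+ 2.
  by rewrite expr2; under eq_cvg do rewrite expr2; exact: cvgM.
have e1 : x ^+ 2 / (x ^+ 2 + 0) = 1 by rewrite addr0 mulfV// expf_neq0// gt_eqF.
rewrite -[X in _ --> X]e1.
rewrite /cutoff; apply: (cvgM c2); apply: cvgV; last exact: (cvgD c2 ce).
by rewrite addr0 expf_neq0// gt_eqF.
Qed.

End Cutoff.

(** * Extension by zero across the degenerate set *)

Section CutoffExtension.
Variables (R : realType) (p n : nat) (tau : 'M[R]_(p, n) -> R).
Hypothesis tau_ge1 : forall X, 1 <= tau X.
Local Notation M := 'M[R]_(p, n).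
Variables (T : M -> R) (dT : M -> M -> R) (d e : R).
Hypotheses (hT : C1 tau setT T dT) (e0 : 0 < e) (de : d < e).
Local Notation D := [set X : M | d < T X].

(** The gap [d < e] matters: a limit point either has [T > d], so that the sequence eventually stays
    in [D], or has [T <= d < e], so that [psi] eventually vanishes along the sequence. *)
Lemma cont_in_cut (g psi : M -> R) : cont_in D g -> cont_in setT psi ->
  (forall X, T X <= e -> psi X = 0) -> cont_in setT (fun X => psi X * g X).
Proof.
move=> cg cpsi psi0 u X _ _ uX.
have [cT _ _ _ _] := hT.
have uT : T (u l) @[l --> \oo] --> T X by exact: cT.
have [Td|Td] := ltrP d (T X).
  have [N _ HN] : \forall l \near \oo, d < T (u l) by exact: (cvgr_gt (T X)).
  rewrite -(cvg_shiftn N); apply: cvgM.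
    rewrite (cvg_shiftn N (fun l => psi (u l))).
    exact: cpsi.
  apply: (cg (fun l => u (l + N)%N)) => //.
  - by move=> l; apply: HN => /=; rewrite leq_addl.
  - by move=> i j; rewrite (cvg_shiftn N (fun l => u l i j)); exact: uX.
rewrite psi0 ?(le_trans Td) ?(ltW de)// mul0r.
have : \forall l \near \oo, T (u l) < e.
  by apply: (cvgr_lt (T X) uT); exact: le_lt_trans de.
move=> near_e.
have h : (fun _ : nat => (0 : R)) l @[l --> \oo] --> (0 : R) by exact: cvg_cst.
apply: cvg_trans h; apply: near_eq_cvg.
by apply: filterS near_e => l le; rewrite psi0 ?mul0r// ltW.
Qed.

Lemma poly_bounded_cut (g psi : M -> R) : poly_bounded tau D g ->
  poly_bounded tau setT psi ->
  (forall X, T X <= e -> psi X = 0) -> poly_bounded tau setT (fun X => psi X * g X).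
Proof.
move=> [B [k /(poly_boundedW tau_ge1) [B' B0 gB]]].
move=> [C [l /(poly_boundedW tau_ge1) [C' C0 pC]]] psi0.
have tp j X : 0 <= tau X ^+ j by rewrite exprn_ge0// (le_trans ler01).
exists (C' * B'), (l + k)%N => X _.
have [Td|Td] := ltrP d (T X).
  by rewrite normrM exprD mulrACA ler_pM ?pC ?gB.
by rewrite psi0 ?(le_trans Td) ?(ltW de)// mul0r normr0 !mulr_ge0.
Qed.

Lemma C1_cut (G : M -> R) dG : C1 tau D G dG ->
  C1 tau setT (fun X => cutoff e (T X) * G X)
    (fun E X => dcutoff e (T X) * dT E X * G X + cutoff e (T X) * dG E X).
Proof.
move=> [cG bG cdG bdG derG]; have [cT bT cdT bdT derT] := hT.
have c0 X : T X <= e -> cutoff e (T X) = 0 by exact: cutoff_eq0.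
have d0 E X : T X <= e -> dcutoff e (T X) * dT E X = 0.
  by move=> Te; rewrite dcutoff_eq0// mul0r.
have ccut : cont_in setT (fun X => cutoff e (T X)).
  move=> u X _ _ uX; apply: (@cvg_comp _ _ _ (fun l => T (u l)) (cutoff e) _ (nbhs (T X))).
    exact: cT.
  exact: continuous_cutoff.
have cdcut : cont_in setT (fun X => dcutoff e (T X)).
  move=> u X _ _ uX; apply: (@cvg_comp _ _ _ (fun l => T (u l)) (dcutoff e) _ (nbhs (T X))).
    exact: cT.
  exact: continuous_dcutoff.
have bcut : poly_bounded tau setT (fun X => cutoff e (T X)).
  by exists 1, 0%N => X _; rewrite expr0 mulr1 ger0_norm ?cutoff_ge0// cutoff_le1.
have bdcut : poly_bounded tau setT (fun X => dcutoff e (T X)).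
  have [B [k h]] := bT.
  have [B' [k' h']] : poly_bounded tau setT (fun X => 2 / e * (B * tau X ^+ k + e)).
    apply: poly_boundedM; first exact: poly_bounded_cst.
    apply: poly_boundedD => //; last exact: poly_bounded_cst.
    exists `|B|, k => X _; rewrite normrM [X in _ * X]ger0_norm//.
    by rewrite exprn_ge0// (le_trans ler01).
  exists B', k' => X DX; apply: le_trans (h' X DX).
  apply: le_trans (dcutoff_le _ e0) _; apply: le_trans (ler_norm _).
  by rewrite ler_wpM2l ?divr_ge0 ?(ltW e0)// lerD2r h.
split.
- exact: cont_in_cut.
- exact: poly_bounded_cut.
- move=> E; apply: cont_inD; apply: cont_in_cut => //; first exact: cont_inM.
  exact: d0.
- move=> E; apply: poly_boundedD => //; apply: poly_bounded_cut => //.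
    exact: poly_boundedM.
  exact: d0.
move=> E X _; have dTX := derT E X I.
have T0 : T (X + 0 *: E) = T X by rewrite scale0r addr0.
have dcut : is_derive (0 : R) 1 (cutoff e \o (fun s : R => T (X + s *: E)))
    (dcutoff e (T X) * dT E X).
  by apply: is_derive1_comp => //; rewrite T0; exact: is_derive_cutoff.
have [Td|Td] := ltrP d (T X).
  apply: is_derive_eq (is_deriveM dcut (derG E X Td)) _.
  rewrite /= scale0r addr0 /GRing.scale/=; ring.
rewrite d0 ?c0 ?(le_trans Td) ?(ltW de)// !mul0r addr0.
apply: near_eq_is_derive (is_derive_cst (0 : R) (0 : R) 1).
have cs : (fun s : R => T (X + s *: E)) s @[s --> (0 : R)] --> T X.
  rewrite -[X in _ --> X]T0.
  apply/differentiable_continuous/derivable1_diffP.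
  exact: (@ex_derive _ _ _ _ _ _ _ dTX).
have : \forall s \near (0 : R), T (X + s *: E) < e.
  by apply: (cvgr_lt (T X) cs); exact: le_lt_trans de.
by apply: filterS => s le; rewrite cutoff_eq0 ?mul0r// ltW.
Qed.

End CutoffExtension.

(** * Gaussian weights and Stein's identity *)

Lemma mod_add_mul_div (r q : nat) : (r %% q + q * (r %/ q))%N = r.
Proof. by rewrite addnC mulnC -divn_eq. Qed.

Section GaussianWeight.
Variables (R : realType) (p n : nat) (S : 'M[R]_p) (Th : 'M[R]_(p, n)).
Hypothesis Spd : posdef S.
Local Notation M := 'M[R]_(p, n).
Implicit Types (X E : M).
Local Notation P := (invmx S).
Local Notation phi := (gauss_density S Th).

Definition tau X : R := 1 + \tr ((X - Th)^T *m P *m (X - Th)).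

Lemma quad_form_ge0 X : 0 <= \tr (X^T *m P *m X).
Proof.
have [Q Qu ->] := posdef_gram (posdef_inv Spd).
rewrite mulmxA -trmx_mul -mulmxA; apply: sumr_ge0 => j _.
by rewrite mxE; apply: sumr_ge0 => i _; rewrite mxE -expr2 sqr_ge0.
Qed.

Lemma tau_ge1 X : 1 <= tau X.
Proof. by rewrite lerDl quad_form_ge0. Qed.

(** With [Z = Q (X - Th)], each squared entry of [Z] is below [tau], and [X = Th + Q^-1 Z]. The
    factors 2 come from [x^2 <= 2 (x - y)^2 + 2 y^2]. *)
Lemma tau_entry : exists2 B, 0 < B & forall X i j, 1 + X i j ^+ 2 <= B * tau X.
Proof.
have [Q Qu PE] := posdef_gram (posdef_inv Spd).
pose a := \sum_i \sum_k `|invmx Q i k|.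
pose b := \sum_i \sum_j Th i j ^+ 2.
have a0 : 0 <= a by apply: sumr_ge0 => i _; apply: sumr_ge0 => k _.
have b0 : 0 <= b by apply: sumr_ge0 => i _; apply: sumr_ge0 => k _; rewrite sqr_ge0.
exists (1 + 2 * b + 2 * a ^+ 2) => [|X i j].
  by rewrite ltr_pwDl ?mulr_ge0 ?sqr_ge0// ltr_pwDl ?mulr_ge0.
pose Z := Q *m (X - Th).
have Ztau k l : Z k l ^+ 2 <= tau X.
  rewrite /tau PE mulmxA -trmx_mul -mulmxA -/Z.
  apply: (@le_trans _ _ (\tr (Z^T *m Z))); last by rewrite lerDr.
  have Zjj s : (Z^T *m Z) s s = \sum_r Z r s ^+ 2.
    by rewrite mxE; apply: eq_bigr => r _; rewrite [Z^T _ _]mxE -expr2.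
  rewrite /mxtrace (bigD1 l)//= -[leLHS]addr0 lerD//.
    by rewrite Zjj (bigD1 k)//= lerDl sumr_ge0// => r _; exact: sqr_ge0.
  by apply: sumr_ge0 => s _; rewrite Zjj sumr_ge0// => r _; exact: sqr_ge0.
have tau0 : 0 <= tau X by rewrite (le_trans ler01)// tau_ge1.
pose s := Num.sqrt (tau X).
have s2 : s ^+ 2 = tau X by rewrite sqr_sqrtr.
have s0 : 0 <= s by exact: sqrtr_ge0.
have Zs k l : `|Z k l| <= s by rewrite -sqrtr_sqr ler_wsqrtr.
have Xd : `|X i j - Th i j| <= a * s.
  have -> : X i j - Th i j = \sum_k invmx Q i k * Z k j.
    have -> : \sum_k invmx Q i k * Z k j = (invmx Q *m Z) i j by rewrite mxE.
    by rewrite mulKmx// !mxE.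
  apply: le_trans (ler_norm_sum _ _ _) _; rewrite /a mulr_suml [leRHS](bigD1 i)//=.
  apply: ler_wpDr.
    by apply: sumr_ge0 => k _; rewrite mulr_ge0// sumr_ge0.
  by rewrite mulr_suml; apply: ler_sum => k _; rewrite normrM ler_wpM2l.
have Xd2 : (X i j - Th i j) ^+ 2 <= a ^+ 2 * tau X.
  rewrite -s2 -exprMn -real_normK ?num_real// lerXn2r// nnegrE mulr_ge0//.
have Thb : Th i j ^+ 2 <= b.
  rewrite /b (bigD1 i)//= (bigD1 j)//= -addrA lerDl addr_ge0// sumr_ge0// => k _.
    exact: sqr_ge0.
  by apply: sumr_ge0 => l _; exact: sqr_ge0.
have t1 := tau_ge1 X.
have bt : b <= b * tau X by rewrite ler_peMr.
have sq := sqr_ge0 (X i j - 2 * Th i j).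
nra.
Qed.

Lemma tau_coord i j : exists B, forall X, `|X i j| <= B * tau X.
Proof.
have [B B0 h] := tau_entry; exists B => X; apply: le_trans (h X i j).
by rewrite -[X i j ^+ 2]real_normK ?num_real//; have := sqr_ge0 (`|X i j| - 1); nra.
Qed.

Lemma power_le_exp (k : nat) : exists C : R, forall x : R, 0 <= x -> x ^+ k <= C * expR x.
Proof.
exists (k.+1%:R ^+ k) => x x0; have k0 : 0 < k.+1%:R :> R by rewrite ltr0n.
have -> : x ^+ k = k.+1%:R ^+ k * (x / k.+1%:R) ^+ k.
  by rewrite -exprMn mulrC divfK// gt_eqF.
rewrite ler_wpM2l ?exprn_ge0 ?(ltW k0)//.
apply: (@le_trans _ _ (expR (x / k.+1%:R) ^+ k)).
  rewrite lerXn2r ?nnegrE ?divr_ge0 ?expR_ge0 ?(ltW k0)//.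
  by apply: le_trans (expR_ge1Dx _); rewrite lerDr.
rewrite -expRM_natl ler_expR mulrA ler_pdivrMr// mulrC ler_wpM2l//.
by rewrite ler_nat.
Qed.

Lemma gauss_density_tau : exists2 K : R, 0 <= K & forall X,
  phi X = K * expR (- (tau X / 2)).
Proof.
exists (((Num.sqrt ((2 * pi) ^+ p * \det S))^-1) ^+ n * expR (2^-1)).
  by rewrite mulr_ge0 ?expR_ge0// exprn_ge0// invr_ge0 sqrtr_ge0.
move=> X; rewrite /gauss_density -mulrA -expRD; congr (_ * expR _).
by rewrite /tau; field.
Qed.

Lemma gauss_density_ge0 X : 0 <= phi X.
Proof. by have [K K0 ->] := gauss_density_tau; rewrite mulr_ge0// expR_ge0. Qed.

(** The inverse of the envelope is at most [(B tau)^(p n)] by [tau_entry], and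
    [tau^(k + p n) exp(- tau / 2)] is bounded. *)
Lemma gauss_enveloped (F : M -> R) : poly_bounded tau setT F ->
  exists C, enveloped (p * n) C (fun v => F (mat_of p n v) * phi (mat_of p n v)).
Proof.
move=> [C [k FC]]; have [K K0 phiE] := gauss_density_tau.
have [B B0 hB] := tau_entry.
have [C1_ hC1] := power_le_exp (k + p * n).
exists (`|C| * K * (C1_ * 2 ^+ (k + p * n)) * B ^+ (p * n)) => v.
set X := mat_of p n v; have t0 : 0 < tau X := lt_le_trans ltr01 (tau_ge1 X).
have envB : 1 <= (B * tau X) ^+ (p * n) * envelope (p * n) v.
  rewrite /envelope -[X in _ ^+ X]card_ord -prodr_const -big_split/=.
  have : \prod_(i < p * n) (1 : R) <= \prod_(i < p * n) (B * tau X * cauchy_weight (v i)).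
    apply: ler_prod => l _; rewrite ler01/= ler_pdivlMr ?mul1r; last first.
      by rewrite (lt_le_trans ltr01)// oneDsqr_ge1.
    have p0 : (0 < p)%N by case: (p) l => [|//] [l]; rewrite mul0n.
    have lp : (l %% p < p)%N by rewrite ltn_mod.
    have ln : (l %/ p < n)%N.
      by rewrite ltn_divLR//; apply: leq_trans (ltn_ord l) _; rewrite mulnC.
    apply: le_trans (hB X (Ordinal lp) (Ordinal ln)).
    by rewrite mxE /= mod_add_mul_div.
  by rewrite big1.
have phib : tau X ^+ (k + p * n) * expR (- (tau X / 2)) <= C1_ * 2 ^+ (k + p * n).
  rewrite expRN ler_pdivrMr ?expR_gt0// mulrAC -ler_pdivrMr ?exprn_gt0//.
  by rewrite -expr_div_n hC1// divr_ge0// ltW.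
rewrite normrM [`|phi X|]ger0_norm ?gauss_density_ge0//.
have tk : 0 <= tau X ^+ k by rewrite exprn_ge0// ltW.
have ev0 : 0 < envelope (p * n) v := envelope_gt0 _ _.
apply: (@le_trans _ _ (`|C| * tau X ^+ k * phi X)).
  rewrite ler_wpM2r ?gauss_density_ge0//; apply: le_trans (FC X Logic.I) _.
  by rewrite ler_wpM2r// ler_norm.
rewrite phiE.
have CK : 0 <= `|C| * K by rewrite mulr_ge0.
apply: (@le_trans _ _ (`|C| * K * (tau X ^+ k * expR (- (tau X / 2)))
    * ((B * tau X) ^+ (p * n) * envelope (p * n) v))).
  rewrite -[leLHS]mulr1 [X in X * 1 <= _](_ : _ = `|C| * K * (tau X ^+ k * expR (- (tau X / 2)))); last by ring.
  by rewrite ler_wpM2l// !mulr_ge0// expR_ge0.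
have -> : `|C| * K * (tau X ^+ k * expR (- (tau X / 2))) * ((B * tau X) ^+ (p * n) * envelope (p * n) v)
  = `|C| * K * (tau X ^+ (k + p * n) * expR (- (tau X / 2))) * B ^+ (p * n) * envelope (p * n) v.
  by rewrite exprMn exprD; ring.
rewrite ler_wpM2r ?(ltW ev0)// ler_wpM2r ?exprn_ge0 ?(ltW B0)//.
by rewrite ler_wpM2l.
Qed.

End GaussianWeight.

Lemma is_derive_scaled_expR (R : realType) (g : R -> R) (x d K a : R) :
  is_derive x 1 g d ->
  is_derive x 1 (fun s => K * expR (a * g s)) (K * (expR (a * g x) * (a * d))).
Proof.
move=> dg; have h1 := is_deriveM (is_derive_cst a x 1) dg.
have h2 := is_derive1_comp (is_derive_expR _) h1.
apply: is_derive_eq (is_deriveM (is_derive_cst K x 1) h2) _.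
rewrite !scaler0 !addr0 /GRing.scale /=.
by rewrite -[(cst a * g) x]/(a * g x).
Qed.

(** * Stein's identity for the matrix normal density *)

Section SteinIdentity.
Variables (R : realType) (p n : nat) (S : 'M[R]_p) (Th : 'M[R]_(p, n)).
Hypothesis Spd : posdef S.
Local Notation M := 'M[R]_(p, n).
Implicit Types (X E : M).
Local Notation P := (invmx S).
Local Notation phi := (gauss_density S Th).
Local Notation tau := (tau S Th).
Local Notation mat := (mat_of p n).

Let tau1 : forall X, 1 <= tau X := tau_ge1 Th Spd.
Let PT : P^T = P. Proof. by case: (posdef_inv Spd). Qed.

Lemma seq_cont_mat_of (F : M -> R) : cont_in setT F -> seq_cont (fun v => F (mat v)).
Proof.
move=> cF u v uv; apply: (cF (fun l => mat (u l)) (mat v)) => // i j.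
by rewrite mxE; under eq_cvg do rewrite mxE; exact: uv.
Qed.

Lemma mat_of_shift (i : 'I_p) (j : 'I_n) (s : R) v :
  mat (shift (i + p * j) s v) = mat v + s *: delta_mx i j.
Proof.
apply/matrixP => k l; rewrite !mxE /shift.
have -> : (k + p * l == i + p * j)%N = (k == i) && (l == j).
  apply/eqP/andP => [h|[/eqP -> /eqP ->//]].
  have p0 : (0 < p)%N by exact: leq_ltn_trans (leq0n i) (ltn_ord i).
  have modE (a : 'I_p) b : ((a + p * b) %% p = a)%N.
    by rewrite addnC mulnC modnMDl modn_small.
  have divE (a : 'I_p) b : ((a + p * b) %/ p = b)%N.
    by rewrite addnC mulnC divnMDl// divn_small// addn0.
  split; apply/eqP/val_inj => /=.
    by rewrite -(modE k l) h modE.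
  by rewrite -(divE k l) h divE.
by case: ifP => _; rewrite ?mulr1 ?mulr0 ?addr0.
Qed.

Lemma C1mx_sub_cst : C1mx tau setT (fun X => X - Th) (fun E X => E).
Proof.
have h := C1mxD tau1 (C1mx_id (tau_coord Th Spd) setT) (C1mx_cst tau setT (- Th)).
by apply: (eq_C1mx _ _ h) => // E X _; rewrite addr0.
Qed.

Lemma C1_quad (A : M -> M) dA : C1mx tau setT A dA ->
  C1 tau setT (fun X => \tr ((A X)^T *m P *m A X))
   (fun E X => 2 * \tr ((dA E X)^T *m (P *m A X))).
Proof.
move=> hA.
have h := C1_trace tau1 (C1mxM tau1 (C1mxM tau1 (C1mx_tr hA) (C1mx_cst tau setT P)) hA).
apply: (eq_C1 _ _ h) => // E X _; rewrite mulmx0 addr0 mxtraceD mulmxA.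
have -> : \tr ((A X)^T *m P *m dA E X) = \tr ((dA E X)^T *m P *m A X).
  by rewrite -mxtrace_tr !trmx_mul trmxK PT mulmxA.
by ring.
Qed.

Lemma trace_delta_tr (A : M) i j : \tr ((delta_mx i j)^T *m A) = A i j.
Proof.
rewrite trmx_delta /mxtrace (bigD1 j)//= big1 ?addr0 => [|k kj]; rewrite mxE.
  rewrite (bigD1 i)//= big1 ?addr0 => [|l li]; first by rewrite mxE !eqxx mul1r.
  by rewrite mxE (negbTE li) andbF mul0r.
by rewrite big1// => l _; rewrite mxE (negbTE kj) mul0r.
Qed.

Lemma cont_gauss_density : cont_in setT phi.
Proof.
have [cq _ _ _ _] := C1_quad C1mx_sub_cst.
move=> u X _ _ uX; apply: cvgM; first exact: cvg_cst.
apply: (@cvg_comp _ _ _ (fun l => - 2^-1 * \tr ((u l - Th)^T *m P *m (u l - Th))) expR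
  _ (nbhs (- 2^-1 * \tr ((X - Th)^T *m P *m (X - Th))))).
  by apply: cvgM; [exact: cvg_cst|exact: cq].
exact: continuous_expR.
Qed.

Lemma is_derive_gauss_density X i j :
  is_derive (0 : R) 1 (fun s : R => phi (X + s *: delta_mx i j))
    (- (P *m (X - Th)) i j * phi X).
Proof.
have [_ _ _ _ dq] := C1_quad C1mx_sub_cst.
have {}dq := dq (delta_mx i j) X Logic.I; rewrite trace_delta_tr in dq.
have h := is_derive_scaled_expR ((Num.sqrt ((2 * pi) ^+ p * \det S))^-1 ^+ n) (- 2^-1) dq.
apply: is_derive_eq h _.
by rewrite scale0r addr0 /gauss_density; field.
Qed.

Lemma stein_identity (F : M -> R) dF i j : C1 tau setT F dF ->
  let f v := (dF (delta_mx i j) (mat v)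
     - F (mat v) * (P *m (mat v - Th)) i j) * phi (mat v) in
  [/\ seq_cont f, exists C, enveloped (p * n) C f & riter (p * n) f = 0].
Proof.
move=> hF f; have [cF bF cdF bdF derF] := hF.
have hP := C1mxM tau1 (C1mx_cst tau setT P) C1mx_sub_cst.
have [cP bP _ _ _] := hP i j.
pose E : M := delta_mx i j.
have cG : cont_in setT (fun X => dF E X + - 1 * (F X * (P *m (X - Th)) i j)).
  by apply: cont_inD => //; apply: cont_inM; [exact: cont_in_cst|exact: cont_inM].
have bG : poly_bounded tau setT (fun X => dF E X + - 1 * (F X * (P *m (X - Th)) i j)).
  apply: poly_boundedD => //; apply: poly_boundedM; first exact: poly_bounded_cst.
  exact: poly_boundedM.
have [C1' e1] := gauss_enveloped Spd bF.
have [C2 e2] := gauss_enveloped Spd bG.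
have lt_k : (i + p * j < p * n)%N.
  apply: (@leq_trans (p + p * j)); first by rewrite ltn_add2r.
  by rewrite -mulnS leq_mul2l ltn_ord orbT.
have fE : f = fun v => (dF E (mat v)
    + - 1 * (F (mat v) * (P *m (mat v - Th)) i j)) * phi (mat v).
  by apply/funext => v; rewrite mulN1r.
have cf : seq_cont f by rewrite fE; exact: (seq_cont_mat_of (cont_inM cG cont_gauss_density)).
have ef : enveloped (p * n) C2 f by rewrite fE.
split=> //; first by exists C2.
apply: (riter_derive lt_k _ e1 cf ef).
  exact: (seq_cont_mat_of (cont_inM cF cont_gauss_density)).
move=> v; set X := mat v.
have -> : (fun s => F (mat (shift (i + p * j) s v)) * phi (mat (shift (i + p * j) s v)))
    = (fun s => F (X + s *: E)) * (fun s => phi (X + s *: E)).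
  by apply/funext => s; rewrite mat_of_shift.
apply: is_derive_eq (is_deriveM (derF E X Logic.I) (is_derive_gauss_density X i j)) _.
rewrite scale0r addr0 /GRing.scale/= /f -/X -/E; ring.
Qed.

End SteinIdentity.

(** * Minimaxity *)

Section Minimaxity.
Variables (R : realType) (p n : nat) (S : 'M[R]_p) (c : R).
Hypotheses (p_gt0 : (0 < p)%N) (n_gt1 : (1 < n)%N) (Spd : posdef S) (c0 : 0 < c).
Let m : R := (minn p n.-1)%:R.
Let A0 : R := (maxn p n.-1)%:R - (minn p n.-1)%:R.
Hypothesis cond : 0 <= (m * A0 + m ^+ 2 - 16 + 4 / m) * c ^+ 2
       + ((m + 1) * A0 + m ^+ 2 - 8 * m - 18) * c + A0 - 14.
Local Notation M := 'M[R]_(p, n).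
Implicit Types (X E : M) (e : R).
Local Notation P := (invmx S).
Local Notation t X := (\tr (Wmat S X)).
Local Notation dW E X := (der_W P (centering R n) (X - Xbar X) E).

Let n_gt0 : (0 < n)%N. Proof. exact: ltnW. Qed.

(** It could fail only for [p = n - 1 = 1], where the condition reads [- 11 c^2 - 25 c - 14 >= 0]
    and excludes every [c > 0]. *)
Lemma kappa_ge0 : 0 <= (n%:R - 1) * p%:R - 2 :> R.
Proof.
have nE : n%:R - 1 = n.-1%:R :> R.
  by rewrite -{1}(prednK n_gt0) -[n.-1.+1]addn1 natrD addrK.
rewrite nE -natrM subr_ge0 ler_nat.
have n1 : (0 < n.-1)%N by rewrite -ltnS prednK.
rewrite ltnNge; apply/negP => h.
have : (n.-1 * p == 1)%N by rewrite eqn_leq h muln_gt0 n1.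
rewrite muln_eq1 => /andP[/eqP n11 /eqP p1].
have mE : m = 1 by rewrite /m n11 p1.
have A0E : A0 = 0 by rewrite /A0 n11 p1 subrr.
have := cond; rewrite mE A0E divr1 expr1n leNgt => /negP; apply.
have c2 := exprn_gt0 2 c0.
have -> : (1 * 0 + 1 - 16 + 4) * c ^+ 2 + ((1 + 1) * 0 + 1 - 8 * 1 - 18) * c + 0 - 14
  = - 11 * c ^+ 2 - 25 * c - 14 by ring.
have c1 : 0 < c by exact: c0.
lra.
Qed.

Definition reg_shrinkage e X : M := cutoff e (t X) *: shrinkage S c X.
Definition der_reg_shrinkage e E X : M :=
  (dcutoff e (t X) * \tr (dW E X)) *: shrinkage S c X
  + cutoff e (t X) *: der_shrinkage S c E X.

(** As the cutoff [h] lies in [[0, 1]], [h^2 |G|^2 <= h |G|^2 <= 2 h div G], and the derivative of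
    [h] adds a nonnegative multiple of [kappa] to the right side. *)
Lemma reg_shrinkage_ineq e X : 0 < e ->
  \tr ((reg_shrinkage e X)^T *m P *m reg_shrinkage e X)
  <= 2 * \sum_i \sum_j der_reg_shrinkage e (delta_mx i j) X i j.
Proof.
move=> e0; have [te|et] := lerP (t X) e.
  rewrite /reg_shrinkage cutoff_eq0// scale0r mulmx0 mxtrace0.
  rewrite big1 ?mulr0// => i _; rewrite big1// => j _.
  by rewrite /der_reg_shrinkage cutoff_eq0// dcutoff_eq0// mul0r !scale0r addr0 mxE.
have t0 : 0 < t X := lt_trans e0 et.
have -> : \sum_i \sum_j der_reg_shrinkage e (delta_mx i j) X i j
    = dcutoff e (t X) * (2 * ((n%:R - 1) * p%:R - 2))
      + cutoff e (t X) * \sum_i \sum_j der_shrinkage S c (delta_mx i j) X i j.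
  rewrite -(shrinkage_radial n_gt0 Spd c0 t0) !mulr_sumr -big_split; apply: eq_bigr => i _ /=.
  by rewrite !mulr_sumr -big_split; apply: eq_bigr => j _ /=; rewrite !mxE mulrA.
have key := shrinkage_risk_difference n_gt0 p_gt0 Spd c0 t0 n_gt1 cond.
have q0 := quad_form_ge0 Spd (shrinkage S c X).
set Q := \tr _ in key q0; set Sg := \sum_i _ in key *.
have -> : \tr ((reg_shrinkage e X)^T *m P *m reg_shrinkage e X) = cutoff e (t X) ^+ 2 * Q.
  by rewrite /reg_shrinkage [(_ *: _)^T]linearZ/= -!scalemxAl -scalemxAr !mxtraceZ mulrA -expr2.
have h0 := cutoff_ge0 (t X) e0; have h1 := cutoff_le1 (t X) e0.
have d0 := dcutoff_ge0 (t X) e0.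
apply: (@le_trans _ _ (cutoff e (t X) * Q)).
  by rewrite ler_wpM2r// expr2 ler_piMl.
rewrite mulrDr; apply: ler_wpDl.
  by do 3 (apply: mulr_ge0 => //); exact: kappa_ge0.
by rewrite mulrCA ler_wpM2l.
Qed.

Variable Th : M.
Local Notation phi := (gauss_density S Th).
Local Notation tau := (tau S Th).
Local Notation mat := (mat_of p n).
Let tau1 : forall X, 1 <= tau X := tau_ge1 Th Spd.

Lemma quad_formB (D g : M) : \tr ((D - g)^T *m P *m (D - g))
  = \tr (D^T *m (P *m D)) - 2 * \tr (g^T *m (P *m D)) + \tr (g^T *m P *m g).
Proof.
have PT : P^T = P by case: (posdef_inv Spd).
have sym : \tr (D^T *m P *m g) = \tr (g^T *m P *m D).
  by rewrite -mxtrace_tr !trmx_mul trmxK PT mulmxA.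
rewrite [(D - g)^T]linearB/= !mulmxBl !mulmxBr !raddfB/= sym !mulmxA; ring.
Qed.

Lemma C1mx_reg_shrinkage e : 0 < e ->
  C1mx tau setT (fun X => reg_shrinkage e X) (fun E X => der_reg_shrinkage e E X).
Proof.
move=> e0 i j; have e2 : 0 < e / 2 by rewrite divr_gt0.
have e2e : e / 2 < e by lra.
have hG := C1mx_shrinkage n_gt0 p_gt0 Spd c0 tau1 (tau_coord Th Spd) e2 i j.
have hT := C1_trW S tau1 (tau_coord Th Spd) setT.
apply: (eq_C1 _ _ (C1_cut tau1 hT e0 e2e hG)) => [X|E X _]; first by rewrite [RHS]mxE.
by rewrite [RHS]mxE [X in _ = X + _]mxE [X in _ = _ + X]mxE.
Qed.

Lemma C1_loss (est : M -> M) dest : C1mx tau setT est dest ->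
  exists dl, C1 tau setT (fun X => loss S Th (est X)) dl.
Proof.
move=> h; have hd := C1mxD tau1 h (C1mx_cst tau setT (- Th)).
have h2 := C1Z tau1 ((n%:R * p%:R)^-1) (C1_quad Spd hd).
by eexists; exact: h2.
Qed.

Lemma reg_risk_le1 e : 0 < e ->
  let F v := loss S Th (mat v - reg_shrinkage e (mat v)) * phi (mat v) in
  [/\ seq_cont F, exists C, enveloped (p * n) C F & riter (p * n) F <= 1].
Proof.
move=> e0 F; have hG := C1mx_reg_shrinkage e0.
have hid := C1mx_id (tau_coord Th Spd) setT.
have hest : C1mx tau setT (fun X => X - reg_shrinkage e X)
    (fun E X => E + - 1 *: der_reg_shrinkage e E X).
  have h := C1mxD tau1 hid (C1mxZ tau1 (C1_cst tau setT (- 1)) hG).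
  apply: (eq_C1mx _ _ h) => [X|E X _]; first by rewrite scaleN1r.
  by rewrite scale0r add0r.
have [dl [cl bl _ _ _]] := C1_loss hest.
have cphi := cont_gauss_density Spd (Th := Th).
have cF : seq_cont F := seq_cont_mat_of (cont_inM cl cphi).
have [C eF] := gauss_enveloped Spd bl.
split=> //; first by exists C.
(* Stein's identity for the field [X - Th - 2 g] treats the risk of [X] and the cross term together:
   with [D = X - Th], the functions [G i j] sum to [(p n - 2 div g - |D|^2 + 2 <D, g>) phi]. *)
pose U i j X := (X - Th) i j - 2 * reg_shrinkage e X i j.
pose dU i j E X := E i j + - 2 * der_reg_shrinkage e E X i j.
have hU i j : C1 tau setT (U i j) (dU i j).
  have h := C1D tau1 (C1mx_sub_cst Th Spd i j) (C1Z tau1 (- 2) (hG i j)).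
  by apply: (eq_C1 _ _ h) => // X; rewrite /U; ring.
pose G i j v := (dU i j (delta_mx i j) (mat v) - U i j (mat v) * (P *m (mat v - Th)) i j)
   * phi (mat v).
have hG3 i j : [/\ seq_cont (G i j), exists C, enveloped (p * n) C (G i j)
    & riter (p * n) (G i j) = 0] := stein_identity Spd i j (hU i j).
pose G2 (ij : 'I_p * 'I_n) := G ij.1 ij.2.
have [cS [CS eS] rS] := @riter_sum _ (p * n) _ (index_enum _) xpredT G2
  (fun ij => let: And3 h _ _ := hG3 ij.1 ij.2 in h)
  (fun ij => let: And3 _ h _ := hG3 ij.1 ij.2 in h).
have {}rS : riter (p * n) (fun v => \sum_ij G2 ij v) = 0.
  by rewrite rS big1// => ij _; have [] := hG3 ij.1 ij.2.
have cp : seq_cont (fun v => phi (mat v)) := seq_cont_mat_of cphi.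
have [Cp ep] : exists C, enveloped (p * n) C (fun v => phi (mat v)).
  have [C' h] := gauss_enveloped Spd (poly_bounded_cst tau setT 1).
  by exists C' => v; have := h v; rewrite mul1r.
have rp : riter (p * n) (fun v => phi (mat v)) = 1.
  apply: EFin_inj; rewrite -(iter_int_riter cp ep).
  exact: iter_gauss_density.
pose k : R := (n%:R * p%:R)^-1.
have cH := seq_contD cp (seq_contM (@seq_cont_cst _ (- k)) cS).
have eH := envelopedD ep (envelopedZ (- k) eS).
(* 1 becomes the integral of a function that dominates the integrand of the risk pointwise: up to
   the factors [k] and [phi], the comparison is [reg_shrinkage_ineq]. *)
have -> : 1 = riter (p * n) (fun v => phi (mat v) + - k * \sum_ij G2 ij v) :> R.
  rewrite (riterD cp ep (seq_contM (@seq_cont_cst _ (- k)) cS) (envelopedZ (- k) eS)).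
  by rewrite rp (riterZ _ cS eS) rS mulr0 addr0.
apply: (le_riter cF eF cH eH) => v.
set X := mat v; set g := reg_shrinkage e X; set D := X - Th.
have -> : \sum_ij G2 ij v = (\sum_i \sum_j (dU i j (delta_mx i j) X
    - U i j X * (P *m D) i j)) * phi X.
  rewrite mulr_suml -(pair_bigA _ (fun i j => G i j v))/=; apply: eq_bigr => i _.
  by rewrite mulr_suml.
rewrite mulrA -[X in _ <= X + _]mul1r -mulrDl.
rewrite ler_wpM2r ?gauss_density_ge0//.
have tr_sum (A B : M) : \tr (A^T *m B) = \sum_i \sum_j A i j * B i j.
  rewrite exchange_big; apply: eq_bigr => j _; rewrite mxE; apply: eq_bigr => i _.
  by rewrite mxE.
have -> : \sum_i \sum_j (dU i j (delta_mx i j) X - U i j X * (P *m D) i j)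
    = p%:R * n%:R - 2 * (\sum_i \sum_j der_reg_shrinkage e (delta_mx i j) X i j)
      - \tr (D^T *m (P *m D)) + 2 * \tr (g^T *m (P *m D)).
  rewrite !tr_sum.
  have -> : p%:R * n%:R = \sum_(i < p) \sum_(j < n) (1 : R).
    under [RHS]eq_bigr do rewrite sumr_const card_ord.
    by rewrite sumr_const card_ord -[RHS]mulr_natl.
  rewrite !mulr_sumr -!sumrB -!big_split; apply: eq_bigr => i _ /=.
  rewrite !mulr_sumr -!sumrB -!big_split; apply: eq_bigr => j _ /=.
  rewrite /dU /U -/D -/g [delta_mx i j i j]mxE !eqxx /=; ring.
have key := reg_shrinkage_ineq X e0.
rewrite /loss -/k -/X -/g.
have -> : X - g - Th = D - g by rewrite /D addrAC.
rewrite (quad_formB D g).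
have k0 : 0 < k by rewrite invr_gt0 mulr_gt0// ltr0n.
have kE : k * (p%:R * n%:R) = 1.
  by rewrite /k [p%:R * _]mulrC mulVf// mulf_neq0// pnatr_eq0 -lt0n.
have := ler_wpM2l (ltW k0) key; rewrite -/g; lra.
Qed.

(** At [t = 0] the conventions [invmx 0 = 0] and [b / 0 = 0] make the shrinkage vanish, like all its
    cutoff versions, so these converge at every point, as [iter_int_fatou] asks. *)
Lemma shrinkage_degenerate X : t X = 0 -> shrinkage S c X = 0.
Proof.
move=> t0; have V0 : Vmat c S X = 0.
  rewrite Vmat_adj// /alpha_hat t0 mulr0 (Wmat_eq0 n_gt0 Spd t0) raddf0 addr0.
  by rewrite -{1}(scale0r 1%:M) detZ expr0n gtn_eqF// mul0r invr0 scale0r.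
rewrite /shrinkage /shrink V0 scaler0 add0r.
have -> : \tr ((X - Xbar X) *m (X - Xbar X)^T *m P) = 0 by exact: t0.
by rewrite invr0 mulr0 mul_scalar_mx scale0r.
Qed.

Lemma cvg_reg_shrinkage X i j :
  reg_shrinkage l.+1%:R^-1 X i j @[l --> \oo] --> shrinkage S c X i j.
Proof.
have -> : (fun l : nat => reg_shrinkage l.+1%:R^-1 X i j)
    = (fun l => cutoff l.+1%:R^-1 (t X) * shrinkage S c X i j).
  by apply/funext => l; rewrite [LHS]mxE.
have := trW_ge0 n_gt0 Spd X; rewrite le_eqVlt => /predU1P[t0|t0].
  have -> : shrinkage S c X i j = 0 by rewrite shrinkage_degenerate// mxE.
  have -> : (fun l : nat => cutoff l.+1%:R^-1 (t X) * 0) = (fun=> 0).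
    by apply/funext => l; rewrite mulr0.
  exact: cvg_cst.
rewrite -[X in _ --> X]mul1r; apply: cvgM; last exact: cvg_cst.
exact: cvg_cutoff.
Qed.

Lemma risk_RLS_S_le1 : (risk S Th (RLS_S (n := n) c S) <= 1%:E)%E.
Proof.
rewrite /risk /expect.
pose F l v := loss S Th (mat v - reg_shrinkage l.+1%:R^-1 (mat v)) * phi (mat v).
have e0 l : 0 < l.+1%:R^-1 :> R by rewrite invr_gt0.
have loss_ge0 X : 0 <= loss S Th X.
  by rewrite mulr_ge0 ?invr_ge0 ?mulr_ge0// quad_form_ge0.
have [dl [cl _ _ _ _]] := C1_loss (C1mx_id (tau_coord Th Spd) setT).
apply: le_trans (@iter_int_fatou _ (p * n) F _ _ _ _ _) _.
- by move=> l; have [] := reg_risk_le1 (e0 l).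
- by move=> l; have [] := reg_risk_le1 (e0 l).
- by move=> l v; rewrite mulr_ge0// gauss_density_ge0.
- move=> v; rewrite RLS_S_shrinkage; apply: cvgM; last exact: cvg_cst.
  apply: (cl (fun l => mat v - reg_shrinkage l.+1%:R^-1 (mat v))) => // i j.
  rewrite [X in _ --> X]mxE [(- shrinkage _ _ _) _ _]mxE.
  under eq_cvg do rewrite mxE [(- reg_shrinkage _ _) _ _]mxE.
  by apply: cvgB; [exact: cvg_cst|exact: cvg_reg_shrinkage].
rewrite limn_einf_lim; apply: lime_le; first exact: is_cvg_einfs.
apply: nearW => l; apply: (@le_trans _ _ (riter (p * n) (F l))%:E).
  by apply: ereal_inf_lbound; exists l => /=.
by rewrite lee_fin; have [] := reg_risk_le1 (e0 l).
Qed.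

End Minimaxity.

Theorem theorem3 (R : realType) (p n : nat) (S : 'M[R]_p) (c : R) :
  (2 <= n)%N -> (1 <= p)%N -> posdef S ->
  let m : R := (minn p n.-1)%:R in
  let A0 : R := (maxn p n.-1)%:R - (minn p n.-1)%:R in
  (0 < c /\
     0 <= (m * A0 + m ^+ 2 - 16 + 4 / m) * c ^+ 2
          + ((m + 1) * A0 + m ^+ 2 - 8 * m - 18) * c + A0 - 14)
  \/
  (c = m^-1 /\
     (- m ^+ 4 + 21 * m ^+ 3 + 18 * m ^+ 2 + 16 * m - 4) / (2 * m ^+ 2 * (m + 1))
       <= A0) ->
  minimax S (RLS_S (n := n) c S).
Proof.
move=> n2 p1 Spd m A0 H Th.
have m0 : 0 < m.
  by rewrite ltr0n leq_min p1 -ltnS prednK// (leq_trans _ n2).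
have [c0 cond] : 0 < c /\ 0 <= (m * A0 + m ^+ 2 - 16 + 4 / m) * c ^+ 2
    + ((m + 1) * A0 + m ^+ 2 - 8 * m - 18) * c + A0 - 14.
  case: H => [//|[cE hA]]; split; first by rewrite cE invr_gt0.
  exact: condition_ii_i.
exact: risk_RLS_S_le1.
Qed.
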